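(* Let $\beta,\beta'\in(0,1)$ and $p,p'\in(0,1)$. Let $\mu^+_{\beta,p}$ be the $(\beta,p)$-Bernoulli convolution and $\nu^+_{\beta',p'}$ the $(\beta',p')$-Bernoulli convolution. If $\log\beta/\log \beta'$ is irrational, then $$\dim \mu^+_{\beta,p}*\nu^+_{\beta',p'}=\min\{1,\dim \mu^+_{\beta,p}+\dim \nu^+_{\beta',p'}\}.$$
   Context: Let $\Sigma_2^+=\{1,2\}^{\mathbb{N}}$. For $\beta\in(0,1)$ consider the iterated function system $\{f_1(x)=\beta x-1,\ f_2(x)=\beta x+1\}$ on $\mathbb{R}$ and its canonical mapping $\Phi_\beta:\Sigma_2^+\to\mathbb{R}$, $\Phi_\beta(i_1i_2\cdots)=\lim_{n\to\infty}f_{i_1}\circ\cdots\circ f_{i_n}(0)$. For $p\in(0,1)$ let $\mu^+_p$ be the $p$-Bernoulli measure on $\Sigma_2^+$, i.e. the product measure with weights $p,1-p$ on the two letters. The $(\beta,p)$-Bernoulli convolution is the push-forward measure $\mu_p^+\circ\Phi_\beta^{-1}$ on $\mathbb{R}$. $*$ denotes convolution of measures on $\mathbb{R}$. A measure $\lambda$ on a metric space is exact-dimensional with dimension $D\ge0$, written $\dim\lambda=D$, if $\lim_{r\to0}\frac{\log\lambda(B(x,r))}{\log r}=D$ for $\lambda$-a.e. $x$, where $B(x,r)$ is the closed ball; writing $\dim\lambda$ asserts that $\lambda$ is exact-dimensional. *)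

(* Defs.v *)
From HB Require Import structures.
From mathcomp Require Import all_boot all_order all_algebra.
From mathcomp Require Import all_classical all_reals all_analysis.
From mathcomp Require Import measurable_realfun.
From mathcomp Require Import ring lra.

Set Implicit Arguments.
Unset Strict Implicit.
Unset Printing Implicit Defensive.
Import Order.TTheory GRing.Theory Num.Theory.
Import numFieldNormedType.Exports.

Local Open Scope classical_set_scope.
Local Open Scope ring_scope.

(* Letters are booleans: [false] is the letter 1, [true] is the letter 2. *)
Definition cylinder (s : seq bool) : set (nat -> bool) :=
  [set w | mkseq w (size s) = s].

(* The one-sided full shift {1,2}^N with its product sigma-algebra. *)
Definition shift_space : Type := g_sigma_algebraType (range cylinder).

HB.instance Definition _ := Measurable.on shift_space.

Definition letter_weight (R : realType) (p : R) (i : bool) : R :=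
  if i then 1 - p else p.

(* Cylinders form a pi-system generating the sigma-algebra, so these values
   determine the product measure. *)
Definition is_bernoulli_measure (R : realType) (p : R)
    (mu : set shift_space -> \bar R) : Prop :=
  forall s : seq bool, mu (cylinder s) = (\prod_(i <- s) letter_weight p i)%:E.

(* Existence: push Lebesgue measure on [0, 1[ forward by the itinerary map of the
   two-branch full map with slopes 1 / p and 1 / (1 - p). *)
Section bernoulli_measure_exists.
Context {R : realType} (p : R) (p01 : 0 < p < 1).

Let T (x : R) : R := if x < p then x / p else (x - p) / (1 - p).
Let code (x : measurableTypeR R) : shift_space := fun n => ~~ (iter n T x < p).

Let left (s : seq bool) : R :=
  foldr (fun (i : bool) a => if i then p + (1 - p) * a else p * a) 0 s.

Let weight (s : seq bool) : R := \prod_(i <- s) letter_weight p i.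

Let mkseq_code (x : R) (n : nat) :
  mkseq (code x) n.+1 = ~~ (x < p) :: mkseq (code (T x)) n.
Proof.
rewrite /mkseq/= (iotaDl 1 0) -map_comp; congr cons; apply: eq_map => k /=.
by rewrite /code add1n iterSr.
Qed.

Let left_weight (s : seq bool) :
  [/\ 0 <= left s, 0 <= weight s & left s + weight s <= 1].
Proof.
case/andP: p01 => p0 p1; rewrite /weight; elim: s => [|i s [l0 w0 lw]].
  by rewrite big_nil /= add0r.
rewrite big_cons /=; case: i => /=; split; nra.
Qed.

Let T01 (x : R) : 0 <= x < 1 -> 0 <= T x < 1.
Proof.
case/andP: p01 => p0 p1 /andP[x0 x1]; rewrite /T; case: ltP => xp.
  by rewrite divr_ge0 ?(ltW p0)//= ltr_pdivrMr// mul1r.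
by rewrite divr_ge0/= ?subr_ge0 ?(ltW p1)// ltr_pdivrMr ?subr_gt0//; lra.
Qed.

Let codeP (s : seq bool) (x : R) : 0 <= x < 1 ->
  (mkseq (code x) (size s) == s) = (left s <= x < left s + weight s).
Proof.
case/andP: p01 => p0 p1.
rewrite /weight; elim: s x => [|i s IH] x x01 /=.
  by rewrite big_nil add0r x01.
rewrite mkseq_code big_cons eqseq_cons IH ?T01// /T.
have [l0 w0 lw] := left_weight s; rewrite /weight in w0 lw *.
have q0 : 0 < 1 - p by rewrite subr_gt0.
case/andP: x01 => x0 x1.
case: (ltP x p) => xp /=; case: i => /=.
- by apply/esym/negbTE; rewrite negb_and -!ltNge; apply/orP; left; nra.
- by rewrite ler_pdivlMr// ltr_pdivrMr// mulrDl ![_ * p]mulrC.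
- rewrite ler_pdivlMr// ltr_pdivrMr// mulrDl ![_ * (1 - p)]mulrC.
  by rewrite lerBrDl ltrBlDl addrA.
- by apply/esym/negbTE; rewrite negb_and -leNgt; apply/orP; right; nra.
Qed.

Let measurable_T : measurable_fun setT T.
Proof.
apply: measurable_fun_ifT.
- exact: measurable_fun_ltr.
- exact: measurable_funM.
- by apply: measurable_funM => //; exact: measurable_funB.
Qed.

Let measurable_code : measurable_fun setT code.
Proof.
apply: (@measurability _ _ (measurableTypeR R) shift_space setT code (range cylinder)); first by [].
move=> _ [_ [s _ <-] <-]; rewrite setTI.
have mc n : measurable_fun setT (fun x : R => ~~ (iter n T x < p)).
  apply: measurable_neg; apply: measurable_fun_ltr => //.
  elim: n => [|n IH] /=; first exact: measurable_id.
  exact: (measurableT_comp measurable_T IH).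
rewrite (_ : _ @^-1` _ = \bigcap_(k in `I_(size s))
    [set x | code x k = nth false s k]); last first.
  apply/seteqP; split => x /= xs.
    by move=> k /= ks; rewrite -{}xs nth_mkseq.
  rewrite /cylinder/=; apply: (@eq_from_nth _ false); rewrite size_mkseq//.
  by move=> k ks; rewrite nth_mkseq//; exact: xs.
apply: bigcap_measurableType => k _; rewrite -[X in measurable X]setTI.
exact: (mc k measurableT [set nth false s k]).
Qed.

HB.instance Definition _ := isMeasurableFun.Build _ _ _ _ code measurable_code.

Let unit_itv : set (measurableTypeR R) := `[0, 1[%classic.
Let measurable_unit_itv : measurable unit_itv. Proof. exact: measurable_itv. Qed.
Let unif : set (measurableTypeR R) -> \bar R := mrestr (@lebesgue_measure R) measurable_unit_itv.
HB.instance Definition _ := Measure.on unif.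

Let unif_setT : unif setT = 1%E.
Proof.
by rewrite /unif /mrestr setTI lebesgue_measure_itv/= lte_fin ltr01 oppr0 adde0.
Qed.

HB.instance Definition _ := Measure_isProbability.Build _ _ _ unif unif_setT.

Lemma bernoulli_measure_exists :
  exists mu : probability shift_space R, is_bernoulli_measure p mu.
Proof.
exists (distribution unif code) => s.
rewrite /distribution /pushforward /= /unif /mrestr.
rewrite (_ : _ `&` _ = `[left s, left s + weight s[%classic); last first.
  have [l0 w0 lw] := left_weight s.
  apply/seteqP; split => x /=; rewrite !in_itv/=.
    by move=> [/eqP xs x01]; rewrite -codeP.
  move=> xs; have x01 : 0 <= x < 1.
    by case/andP: xs => ? ?; apply/andP; split; lra.
  by split => //; apply/eqP; rewrite codeP.
have [l0 w0 lw] := left_weight s.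
rewrite lebesgue_measure_itv/= lte_fin ltrDl; case: ifPn => [_|].
  by rewrite -EFinB addrC addKr.
by rewrite -leNgt => w0'; congr EFin; apply/eqP; rewrite eq_le w0 w0'.
Qed.

End bernoulli_measure_exists.

Definition ifs (R : realType) (b : R) (i : bool) (x : R) : R :=
  if i then b * x + 1 else b * x - 1.

(* [foldr (ifs b) 0 [:: i1; ...; in]] is f_{i1} (... (f_{in} 0)). *)
Definition coding (R : realType) (b : R) (w : shift_space) : R :=
  limn (fun n => foldr (ifs b) 0 (mkseq w n)).

Lemma measurable_cylinder (s : seq bool) :
  measurable (cylinder s : set shift_space).
Proof. by apply: sub_sigma_algebra; exists s. Qed.

Lemma measurable_mkseq (n : nat) (A : set (seq bool)) :
  measurable ([set w | A (mkseq w n)] : set shift_space).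
Proof.
rewrite (_ : [set w | _] =
  \bigcup_(s in [set s | size s = n /\ A s]) (cylinder s)); last first.
  apply/seteqP; split => w /=.
    by move=> Aw; exists (mkseq w n) => /=; rewrite /cylinder/= size_mkseq.
  by move=> [s [<- As]]; rewrite /cylinder /= => ->.
rewrite bigcup_mkcond; apply: countable_bigcupT_measurable => [|s].
  exact: countableP.
by case: ifP => _; [exact: measurable_cylinder|exact: measurable0].
Qed.

Section coding_measurable.
Context {R : realType} (b : R).

Lemma foldr_ifs (s : seq bool) (x : R) :
  foldr (ifs b) x s = foldr (ifs b) 0 s + b ^+ size s * x.
Proof.
elim: s => [|i s IH] /=; first by rewrite expr0 mul1r add0r.
by rewrite IH /ifs exprS; case: i; ring.
Qed.

Lemma coding_series (w : shift_space) :
  (fun n => foldr (ifs b) 0 (mkseq w n)) =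
  series (fun k => b ^+ k * (if w k then 1 else -1)).
Proof.
apply/funext; elim => [|n IH]; first by rewrite /series/= big_geq.
rewrite mkseqS -cats1 foldr_cat foldr_ifs IH size_mkseq seriesSr.
by congr (_ + _ * _); rewrite /= /ifs mulr0 add0r sub0r.
Qed.

Lemma is_cvg_coding (w : shift_space) : `|b| < 1 ->
  cvgn (fun n => foldr (ifs b) 0 (mkseq w n)).
Proof.
move=> b1; rewrite coding_series; apply: normed_cvg.
rewrite [X in cvgn X](_ : _ = series (geometric 1 `|b|)); last first.
  congr series; apply/funext => k; rewrite /geometric/= mul1r normrM normrX.
  by case: (w k); rewrite ?normrN normr1 mulr1.
by apply: is_cvg_geometric_series; rewrite normr_id.
Qed.

Lemma coding_dvg (w : shift_space) : 1 <= `|b| ->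
  ~ cvgn (fun n => foldr (ifs b) 0 (mkseq w n)).
Proof.
move=> b1; rewrite coding_series => /cvg_series_cvg_0/cvgrPdist_lt/(_ 1 ltr01).
move=> [n _ /(_ n (leqnn n))]; apply/negP; rewrite -leNgt sub0r normrN.
rewrite normrM normrX (_ : `|if _ then _ else _| = 1) ?mulr1 ?exprn_ege1//.
by case: (w n); rewrite ?normrN normr1.
Qed.

Lemma measurable_coding : measurable_fun setT (coding b).
Proof.
have [b1|b1] := ltP `|b| 1; last first.
  rewrite (_ : coding b = cst point); first exact: measurable_cst.
  by apply/funext => w; apply: dvgP; exact: coding_dvg.
apply: (@measurable_fun_cvg _ _ _ setT
  (fun n (w : shift_space) => foldr (ifs b) 0 (mkseq w n))).
  move=> n _ B mB; rewrite setTI.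
  exact: (@measurable_mkseq n [set s | B (foldr (ifs b) 0 s)]).
by move=> w _; exact: is_cvg_coding.
Qed.

HB.instance Definition _ := isMeasurableFun.Build _ _ _ _ (coding b)
  measurable_coding.

End coding_measurable.

(* The (b, p)-Bernoulli convolution, when [mu] is the p-Bernoulli measure. *)
Definition bernoulli_convolution (R : realType) (b : R)
    (mu : probability shift_space R) : probability R R :=
  distribution mu (coding b).

Section measure_convolution.
Context {R : realType} (mu nu : probability R R).

Definition measure_convolution : set R -> \bar R :=
  pushforward (mu \x nu)%E (fun z : R * R => z.1 + z.2).

Let measurable_add : measurable_fun setT (fun z : R * R => z.1 + z.2).
Proof. exact: measurable_funD. Qed.

Let image := measure_function_pushforward__canonical__measure_function_Measure
  (mu \x nu)%E measurable_add.

Let convolution0 : measure_convolution set0 = 0%E.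
Proof. exact: (measure0 image). Qed.

Let convolution_ge0 A : (0 <= measure_convolution A)%E.
Proof. exact: (measure_ge0 image). Qed.

Let convolution_sigma_additive : semi_sigma_additive measure_convolution.
Proof. exact: (@measure_semi_sigma_additive _ _ _ image). Qed.

HB.instance Definition _ := isMeasure.Build _ _ _ measure_convolution
  convolution0 convolution_ge0 convolution_sigma_additive.

Let convolution_setT : measure_convolution setT = 1%E.
Proof.
transitivity (mu setT * nu setT)%E; last by rewrite !probability_setT mule1.
rewrite /measure_convolution /pushforward preimage_setT -setXTT.
exact: product_measure1E.
Qed.

HB.instance Definition _ := Measure_isProbability.Build _ _ _
  measure_convolution convolution_setT.

End measure_convolution.

(* [lne 0 = -oo], so the ratio is +oo when the ball has measure zero. *)
Definition exact_dimensional (R : realType) (mu : set R -> \bar R) (D : R) :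
    Prop :=
  0 <= D /\
  {ae mu, forall x : R,
    (lne (mu (closed_ball_ Num.norm x r)) * ((ln r)^-1)%:E)%E
      @[r --> 0^'+] --> D%:E}.

(* Main.v *)
(* Throughout, X and Y are independent codings, with ratios b and b', of
   Bernoulli sequences.

   Exact dimensionality of one Bernoulli convolution.  Let g_i (x) be the
   conditional probability that the first letter is i given X = x.  The
   dimension is - I / ln b, where I, the expectation of
   ln g_{w_0} (X w) - ln (weight of w_0), is the mutual information of the first
   letter and X: the law of X gives to the image of the cylinder of w_0 ... w_{n-1}
   a mass comparable to the weight of that word divided by its conditional
   probability given X = X w, and the latter is a product along the shift orbit.
   Both bounds come from a Borel-Cantelli argument over words and Birkhoff's
   theorem; for the upper bound on the mass of balls g is replaced by a Lipschitz
   function, so that the conditional weights of words with nearby values are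
   comparable.

   Upper bound for the convolution.  A ball of X + Y contains a product of balls
   of X and Y, and no compactly supported measure on R has dimension above 1.

   Lower bound for the convolution.  Read X in blocks of m letters and Y in
   blocks of l_k letters with b'^(l_0 + ... + l_(k-1)) = c_k b^(km) and
   1 <= c_k <= 1/b'.  Then X + Y is a sum of b^(km) times independent block
   values S u + c_k S' v.  A block is bad when the mass of the b^m-ball around its
   value exceeds b^(m s2), with s2 slightly below min (1, D + D').  If all blocks
   are good the mass of a b^(mN)-ball is at most A^N b^(m N s2) for a constant A
   independent of m, and a small proportion of bad blocks costs little.  The
   logarithms of the c_k are an irrational rotation, so the lines x + c_k y are
   spread in all directions: for typical (x, y), the average over k of the mass
   of a b^m-neighbourhood of the k-th line through (x, y) is of order
   m b^(m min (1, D + D')), as for a projection theorem.  Hence bad blocks are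
   rare on average and, by independence, rare almost surely. *)

From HB Require Import structures.
Require Import Defs.
From mathcomp Require Import all_boot all_order all_algebra.
From mathcomp Require Import all_classical all_reals all_analysis.
From mathcomp Require Import measurable_realfun.
From mathcomp Require Import ring lra.

Set Implicit Arguments.
Unset Strict Implicit.
Unset Printing Implicit Defensive.
Import Order.TTheory GRing.Theory Num.Theory.
Import numFieldNormedType.Exports.
Local Open Scope classical_set_scope.
Local Open Scope ring_scope.

(** * Bernoulli measures on words and sequences *)

(** Two obstacles shape the estimates. The conditional letter probability [g] is only a
    Radon-Nikodym derivative, possibly tiny and discontinuous. A floor [t] keeps its logarithm
    bounded, and a Lipschitz [q] close to [g] in L1 makes conditional word probabilities comparable
    at distance [b ^+ n]; the price, [2 * t] per letter and an error in the pressure, can be made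
    arbitrarily small. In the convolution, distinct block sequences may have close values, so the
    masses of blocks cannot simply be multiplied. Instead, the mass of a window is weighted by a
    factor [R1^-1] for every good block. Rescaling after one block reproduces a window of the same
    relative size, so the expected weighted mass grows by at most a constant factor per block, which
    long blocks make negligible in the exponent; a bad block only forfeits one factor [R1^-1]. The
    blocks are independent but, as [c_k] varies, not identically distributed: their number is
    controlled by an exponential moment, into which only the sum over [k] of the probabilities of
    being bad enters. *)

Section word_expectation.
Context {R : realType}.
Implicit Types (p : R) (n : nat) (s t : seq bool) (F G : seq bool -> R).

(** Expectations over finite words are recursions on the first letter, so that linearity, exchange
    and concatenation are inductions free of measurability conditions. *)
Fixpoint wexp p n F : R :=
  if n is n'.+1 then
    p * wexp p n' (fun s => F (false :: s)) +
    (1 - p) * wexp p n' (fun s => F (true :: s))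
  else F [::].

Lemma eq_wexp p n F G :
  (forall s, size s = n -> F s = G s) -> wexp p n F = wexp p n G.
Proof.
elim: n F G => [|n IH] F G FG /=; first exact: FG.
by congr (_ * _ + _ * _); apply: IH => s sn; apply: FG; rewrite /= sn.
Qed.

Lemma le_wexp p n F G : 0 < p < 1 ->
  (forall s, size s = n -> F s <= G s) -> wexp p n F <= wexp p n G.
Proof.
move=> p01; elim: n F G => [|n IH] F G FG /=; first exact: FG.
have [p0 p1] : 0 <= p /\ 0 <= 1 - p by split; lra.
by apply: lerD; apply: ler_wpM2l => //; apply: IH => s sn; apply: FG;
  rewrite /= sn.
Qed.

Lemma wexp_cst p n (c : R) : wexp p n (fun=> c) = c.
Proof. by elim: n => //= n ->; rewrite -mulrDl addrC subrK mul1r. Qed.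

Lemma wexpD p n F G :
  wexp p n (fun s => F s + G s) = wexp p n F + wexp p n G.
Proof. by elim: n F G => //= n IH F G; rewrite !IH; ring. Qed.

Lemma wexpZ p n (c : R) F : wexp p n (fun s => c * F s) = c * wexp p n F.
Proof. by elim: n F => //= n IH F; rewrite !IH; ring. Qed.

Lemma wexp_ge0 p n F : 0 < p < 1 ->
  (forall s, size s = n -> 0 <= F s) -> 0 <= wexp p n F.
Proof. by move=> p01 F0; rewrite -(wexp_cst p n 0); apply: le_wexp. Qed.

Lemma wexp_cat p n m F :
  wexp p (n + m) F = wexp p n (fun s => wexp p m (fun t => F (s ++ t))).
Proof. by elim: n F => //= n IH F; rewrite !IH. Qed.

Lemma wexp_exchange p p' n m (F : seq bool -> seq bool -> R) :
  wexp p n (fun s => wexp p' m (F s)) =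
  wexp p' m (fun t => wexp p n (fun s => F s t)).
Proof.
elim: n F => //= n IH F.
by rewrite !IH wexpD !wexpZ.
Qed.

Lemma wexp_markov p n F (c : R) : 0 < p < 1 -> 0 < c ->
  (forall s, size s = n -> 0 <= F s) ->
  wexp p n (\1_[set s | c < F s]) <= wexp p n F / c.
Proof.
move=> p01 c0 F0; rewrite ler_pdivlMr// mulrC -wexpZ.
apply: le_wexp => // s sn; rewrite indicE; case: (boolP (s \in _)).
  by rewrite inE/= mulr1 => /ltW.
by rewrite mulr0 F0.
Qed.

End word_expectation.

Definition shiftn n (w : shift_space) : shift_space := fun k => w (n + k)%N.

Lemma mkseq_addn (T : Type) (f : nat -> T) n m :
  mkseq f (n + m) = mkseq f n ++ mkseq (fun k => f (n + k)%N) m.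
Proof. by rewrite /mkseq iotaD map_cat add0n -[in iota n m](addn0 n) iotaDl -map_comp. Qed.

Lemma take_mkseq (T : Type) (f : nat -> T) n m : (n <= m)%N ->
  take n (mkseq f m) = mkseq f n.
Proof. by move=> nm; rewrite /mkseq -map_take take_iota (minn_idPl nm). Qed.

Lemma drop_mkseq (w : shift_space) n m :
  drop n (mkseq w (n + m)) = mkseq (shiftn n w) m.
Proof. by rewrite mkseq_addn drop_size_cat// size_mkseq. Qed.

Lemma shiftnD n m (w : shift_space) : shiftn n (shiftn m w) = shiftn (m + n) w.
Proof. by apply/funext => k; rewrite /shiftn addnA. Qed.

Lemma shiftn0 (w : shift_space) : shiftn 0 w = w.
Proof. exact/funext. Qed.

(** Cylinders alone are not closed under intersection, since two disjoint ones meet in the empty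
    set; events depending on finitely many letters are, by passing to the longer prefix. *)
Definition word_events : set (set shift_space) :=
  [set A | exists n (B : set (seq bool)), A = [set w | B (mkseq w n)]].

Lemma setI_closed_word_events : setI_closed word_events.
Proof.
move=> _ _ [n [A ->]] [m [B ->]].
exists (maxn n m), [set s | A (take n s) /\ B (take m s)].
apply/seteqP; split => w /=.
  by rewrite !take_mkseq ?leq_maxl ?leq_maxr.
by rewrite !take_mkseq ?leq_maxl ?leq_maxr.
Qed.

Lemma measurable_word_events :
  @measurable _ shift_space = <<s word_events >>.
Proof.
apply/seteqP; split.
  apply: smallest_sub; first exact: smallest_sigma_algebra.
  move=> _ [s _ <-]; apply: sub_sigma_algebra.
  by exists (size s), [set s].
apply: smallest_sub.
  have h := @sigma_algebra_measurable _ shift_space.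
  by split; [case: h|case: h|case: h].
by move=> _ [n [B ->]]; exact: measurable_mkseq.
Qed.

Lemma measurable_shiftn n : measurable_fun setT (shiftn n).
Proof.
apply: (@measurability _ _ shift_space shift_space setT (shiftn n)
  (range cylinder)); first by [].
move=> _ [_ [s _ <-] <-]; rewrite setTI.
rewrite (_ : _ @^-1` _ = [set w | [set t | drop n t = s] (mkseq w (n + size s))]).
  exact: measurable_mkseq.
by apply/seteqP; split => w /=; rewrite drop_mkseq.
Qed.

Section bernoulli.
Context {R : realType} (p : R) (mu : probability shift_space R).
Hypothesis mup : is_bernoulli_measure p mu.

(** The prefix [s] is what the induction varies: the next letter splits the event into two with a
    longer prefix, until only the mass of a cylinder is left. *)
Lemma bernoulli_prefix (s : seq bool) n (A : set (seq bool)) :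
  mu [set w | mkseq w (size s) = s /\ A (mkseq w (size s + n))] =
  ((\prod_(i <- s) letter_weight p i) * wexp p n (fun t => \1_A (s ++ t)))%:E.
Proof.
elim: n s => [|n IH] s.
  rewrite /= cats0 addn0 indicE; have [As|As] := asboolP (A s).
    rewrite mem_set// mulr1 -mup; congr (mu _).
    by apply/seteqP; split => w /=; [move=> []|move=> ws; rewrite ws].
  rewrite memNset// mulr0 (_ : [set _ | _] = set0) ?measure0//.
  by rewrite -subset0 => w /= [->].
rewrite (_ : [set _ | _] =
    [set w | mkseq w (size (rcons s false)) = rcons s false /\
             A (mkseq w (size (rcons s false) + n))] `|`
    [set w | mkseq w (size (rcons s true)) = rcons s true /\
             A (mkseq w (size (rcons s true) + n))]); last first.
  apply/seteqP; split => w /=; rewrite !size_rcons !(mkseqS w (size s)) !addSn addnS.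
    by move=> [-> ?]; case: (w (size s)); [right|left].
  by move=> [[/rcons_inj[-> ?] ?]|[/rcons_inj[-> ?] ?]].
have mp t : measurable ([set w | mkseq w (size t) = t /\
    A (mkseq w (size t + n))] : set shift_space).
  by apply: measurableI; [exact: measurable_cylinder|exact: measurable_mkseq].
rewrite measureU; [|exact: mp|exact: mp|]; last 1 first.
  rewrite -subset0 => w [/= [+ _] [+ _]]; rewrite !size_rcons => -> .
  by move=> /rcons_inj[].
etransitivity; first exact: (f_equal2 adde (IH (rcons s false))
  (IH (rcons s true))).
rewrite -[adde _ _]EFinD !big_rcons/=; congr EFin.
under eq_wexp => t _ do rewrite cat_rcons.
under [X in _ + _ * X = _]eq_wexp => t _ do rewrite cat_rcons.
by ring.
Qed.

Lemma bernoulli_word n (A : set (seq bool)) :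
  mu [set w | A (mkseq w n)] = (wexp p n \1_A)%:E.
Proof.
have := bernoulli_prefix [::] n A; rewrite big_nil mul1r /= => <-.
by congr (mu _); apply/seteqP; split => w /=; [split|case].
Qed.

(** By Dynkin's theorem [B] may be taken to depend on finitely many letters; both sides are then
    word expectations, which [wexp_cat] factors. *)
Lemma bernoulli_shift n (A : set (seq bool)) (B : set shift_space) :
  measurable B ->
  mu [set w | A (mkseq w n) /\ B (shiftn n w)] = ((wexp p n \1_A)%:E * mu B)%E.
Proof.
have mA : measurable ([set w | A (mkseq w n)] : set shift_space).
  exact: measurable_mkseq.
have mS (S : set shift_space) : measurable S ->
    measurable ([set w | A (mkseq w n) /\ S (shiftn n w)] : set shift_space).
  move=> mS; apply: measurableI => //.
  by rewrite -[X in measurable X]setTI; exact: measurable_shiftn.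
rewrite measurable_word_events.
move: B; apply: (dynkin_induction measurable_word_events
  setI_closed_word_events).
- rewrite probability_setT mule1 -bernoulli_word; congr (mu _).
  by apply/seteqP; split => w /=; [case|split].
- move=> _ [m [B ->]].
  rewrite bernoulli_word -EFinM.
  transitivity (mu [set w | [set s | A (take n s) /\ B (drop n s)]
      (mkseq w (n + m))]).
    congr (mu _); apply/seteqP; split => w /=;
    by rewrite take_mkseq ?leq_addr// drop_mkseq.
  rewrite bernoulli_word wexp_cat; congr EFin.
  rewrite mulrC -wexpZ; apply: eq_wexp => s sn.
  rewrite mulrC -wexpZ; apply: eq_wexp => t tm.
  rewrite !indicE -natrM mulnb; congr ((nat_of_bool _)%:R).
  by apply/idP/andP; rewrite !inE/= take_size_cat// drop_size_cat.
- move=> S mS' HS.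
  rewrite probability_setC// muleBr//.
  rewrite -HS mule1 -bernoulli_word.
  rewrite (_ : [set w | A (mkseq w n) /\ (~` S) _] =
      [set w | A (mkseq w n)] `\` [set w | A (mkseq w n) /\ S (shiftn n w)]).
    rewrite measureD//=; last 2 first.
    + exact: mS.
    + by rewrite ltey_eq fin_num_measure.
    congr (_ - mu _)%E; apply/seteqP; split => w /=; first by case.
    by move=> [? ?].
  apply/seteqP; split => w /=; first by move=> [? ?]; split => // -[].
  by move=> [? h]; split => // ?; apply: h.
- move=> F mF tF HF.
  rewrite (_ : [set _ | _] = \bigcup_k [set w | A (mkseq w n) /\ F k (shiftn n w)]).
    rewrite measure_bigcup//=; last 2 first.
    + by move=> k _; exact: mS.
    + by move=> i j _ _ [w [[_ Fi] [_ Fj]]]; apply: tF => //; exists (shiftn n w).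
    rewrite measure_bigcup// -nneseriesZl//.
    by apply: eq_eseriesr => k _; exact: HF.
  apply/seteqP; split => w /=; first by move=> [? [k _ ?]]; exists k.
  by move=> [k _ [? ?]]; split => //; exists k.
Qed.

Lemma bernoulli_shiftn n (B : set shift_space) : measurable B ->
  mu (shiftn n @^-1` B) = mu B.
Proof.
move=> mB; have := @bernoulli_shift n setT B mB.
rewrite indicT wexp_cst mul1e => <-; congr (mu _).
by apply/seteqP; split => w /=; [split|case].
Qed.

End bernoulli.

Section bounded_expectation.
Context d (T : measurableType d) (R : realType) (P : probability T R).

Lemma bounded_integrable (f : T -> R) (M : R) : measurable_fun setT f ->
  (forall x, `|f x| <= M) -> P.-integrable setT (EFin \o f).
Proof.
move=> mf fM; apply: measurable_bounded_integrable => //.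
  by rewrite ltey_eq fin_num_measure.
exists M; split; first exact: num_real.
by move=> y My x _ /=; rewrite (le_trans (fM x))// ltW.
Qed.

Lemma Rintegral_indic (A : set T) : measurable A ->
  \int[P]_x (\1_A x) = fine (P A).
Proof. by move=> mA; rewrite /Rintegral integral_indic// setIT. Qed.

(** Continuity from above along the complements. It turns a threshold depending on the point into
    one that serves outside a set of small mass. *)
Lemma probability_exhaust (F : (set T)^nat) (e : R) :
  (forall n, measurable (F n)) -> (forall n, F n `<=` F n.+1) ->
  {ae P, forall x, exists n, F n x} -> 0 < e ->
  exists n, (P (~` F n) < e%:E)%E.
Proof.
move=> mF incF aeF e0.
have cF : P \o (fun n => ~` F n) @ \oo --> P (\bigcap_n ~` F n).
  apply: nonincreasing_cvg_mu.
  - by rewrite ltey_eq fin_num_measure//; exact: measurableC.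
  - by move=> n; exact: measurableC.
  - by apply: bigcapT_measurable => n; exact: measurableC.
  - by apply/nonincreasing_seqP => n; apply/subsetPset/subsetC/incF.
have P0 : P (\bigcap_n ~` F n) = 0%E.
  apply: measure_negligible.
    by apply: bigcapT_measurable => n; exact: measurableC.
  apply: negligibleS aeF => x /= Fx [n Fn]; exact: Fx Fn.
rewrite P0 in cF.
have /fine_cvgP[_ /cvgr_lt/(_ e e0)[N _ /(_ N (leqnn N)) /= h]] := cF.
by exists N; rewrite -[P _]fineK ?lte_fin// fin_num_measure//; exact: measurableC.
Qed.

End bounded_expectation.

(** * Birkhoff's upper bound for the shift *)

Section birkhoff.
Context {R : realType} (p : R) (mu : probability shift_space R).
Hypothesis mup : is_bernoulli_measure p mu.

Lemma Rintegral_shiftn (f : shift_space -> R) (n : nat) :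
  measurable_fun setT f -> (exists M, forall w, `|f w| <= M) ->
  \int[mu]_w f (shiftn n w) = \int[mu]_w f w.
Proof.
move=> mf [M fM]; rewrite /Rintegral; congr fine.
have ms := @measurable_shiftn n.
transitivity (\int[pushforward mu (shiftn n)]_w (f w)%:E)%E; last first.
  apply: eq_measure_integral => A mA _.
  exact: (bernoulli_shiftn mup).
rewrite (integral_pushforward ms) => //.
- exact/measurable_EFinP.
- apply: (@bounded_integrable _ _ _ _ _ M) => //.
  exact: (measurableT_comp mf ms).
Qed.

(** Being its own preimage under [shiftn n], [E] is independent of the first [n] letters; by
    Dynkin's theorem it is independent of every event, itself included. *)
Lemma shift_invariant_01 (E : set shift_space) : measurable E ->
  shiftn 1 @^-1` E = E -> mu E = 0%E \/ mu E = 1%E.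
Proof.
move=> mE invE.
have invn n : shiftn n @^-1` E = E.
  elim: n => [|n IH]; first by apply/funext => w; rewrite /preimage/= shiftn0.
  rewrite -[RHS]IH -[in RHS]invE; apply/funext => w.
  by rewrite /preimage/= shiftnD addn1.
suff H (B : set shift_space) : measurable B ->
    mu (B `&` E) = (mu B * mu E)%E.
  have := H E mE; rewrite setIid.
  have : mu E \is a fin_num by rewrite fin_num_measure.
  case: (mu E) => // r _; rewrite -EFinM => -[] /eqP.
  rewrite -subr_eq0 -{1}(mulr1 r) -mulrBr mulf_eq0 => /orP[/eqP ->|]; first by left.
  by rewrite subr_eq0 => /eqP <-; right.
rewrite measurable_word_events.
move: B; apply: (dynkin_induction measurable_word_events
  setI_closed_word_events).
- by rewrite setTI probability_setT mul1e.
- move=> _ [n [B ->]].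
  rewrite (bernoulli_word mup) -(bernoulli_shift mup)//; congr (mu _).
  by rewrite -[in LHS](invn n).
- move=> S mS HS.
  rewrite probability_setC// muleBl// ?mul1e.
    rewrite -HS setIC -setDE measureD//; first by rewrite setIC.
    by rewrite ltey_eq fin_num_measure.
  by rewrite fin_num_measure.
- move=> F mF tF HF.
  rewrite setI_bigcupl measure_bigcup//=; last 2 first.
  + by move=> k _; exact: measurableI.
  + by apply: trivIset_setIr.
  rewrite measure_bigcup//=.
  have <- : (fine (mu E))%:E = mu E by rewrite fineK// fin_num_measure.
  rewrite muleC -nneseriesZl//.
  apply: eq_eseriesr => k _; rewrite muleC fineK; first exact: HF.
  by rewrite fin_num_measure.
Qed.

Section maximal.
Context (f : shift_space -> R) (M : R).
Hypothesis mf : measurable_fun setT f.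
Hypothesis fM : forall w, `|f w| <= M.

(* [ergodic_max n w] is the maximum of the ergodic sums of length at most [n],
   the empty one included. *)
Fixpoint ergodic_max n (w : shift_space) : R :=
  if n is n'.+1 then Num.max 0 (f w + ergodic_max n' (shiftn 1 w)) else 0.

Lemma ergodic_max_ge0 n w : 0 <= ergodic_max n w.
Proof. by case: n => //= n; rewrite le_max lexx. Qed.

Lemma measurable_ergodic_max n : measurable_fun setT (ergodic_max n).
Proof.
elim: n => [|n IH] /=; first exact: measurable_cst.
apply: measurable_maxr; first exact: measurable_cst.
apply: measurable_funD => //.
exact: (measurableT_comp IH (@measurable_shiftn 1)).
Qed.

Lemma ergodic_max_le n w : ergodic_max n w <= ergodic_max n.+1 w.
Proof.
elim: n w => [|n IH] w; first exact: ergodic_max_ge0.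
rewrite [leLHS]/= [leRHS]/= ge_max !le_max lexx /= lerD2l.
by rewrite (IH (shiftn 1 w)) orbT.
Qed.

Lemma ergodic_sum_le_max n w :
  \sum_(k < n) f (shiftn k w) <= ergodic_max n w.
Proof.
elim: n w => [|n IH] w; first by rewrite big_ord0.
rewrite big_ord_recl /= shiftn0 le_max lerD2l; apply/orP; right.
apply: le_trans (IH (shiftn 1 w)); apply: ler_sum => k _.
by rewrite shiftnD.
Qed.

Lemma ergodic_max_bounded n w : ergodic_max n w <= n%:R * M.
Proof.
have M0 : 0 <= M by apply: le_trans (fM w).
elim: n w => [|n IH] w /=; first by rewrite mul0r.
rewrite ge_max; apply/andP; split; first by rewrite mulr_ge0.
rewrite -[n.+1%:R]natr1 mulrDl mul1r addrC.
by rewrite lerD// (le_trans (ler_norm _)).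
Qed.

(* Garsia's proof: [f >= ergodic_max n.+1 - ergodic_max n \o shift] on the set. *)
Lemma maximal_ergodic n :
  0 <= \int[mu]_w (f w * \1_[set w | 0 < ergodic_max n.+1 w] w).
Proof.
set A := [set w | _].
have mA : measurable A.
  rewrite -[A]setTI; apply: measurable_fun_ltr => //.
  exact: measurable_ergodic_max.
have mM := @measurable_ergodic_max n.+1.
have bM w : `|ergodic_max n.+1 w| <= n.+1%:R * M.
  by rewrite ger0_norm ?ergodic_max_ge0// ergodic_max_bounded.
have <- : \int[mu]_w (ergodic_max n.+1 w - ergodic_max n.+1 (shiftn 1 w)) = 0.
  rewrite RintegralB//.
  - by rewrite Rintegral_shiftn ?subrr//; exists (n.+1%:R * M).
  - exact: bounded_integrable bM.
  - apply: (@bounded_integrable _ _ _ _ _ (n.+1%:R * M)) => //.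
    exact: (measurableT_comp mM (@measurable_shiftn 1)).
apply: le_Rintegral => //.
- apply: (@bounded_integrable _ _ _ _ _ (n.+1%:R * M + n.+1%:R * M)).
    apply: measurable_funB => //.
    exact: (measurableT_comp mM (@measurable_shiftn 1)).
  by move=> w; rewrite (le_trans (ler_normB _ _))// lerD.
- apply: (@bounded_integrable _ _ _ _ _ M).
    by apply: measurable_funM => //; exact: measurable_indic.
  move=> w; rewrite normrM indicE; have := fM w.
  by case: (_ \in _); rewrite ?normr1 ?mulr1// normr0 mulr0; exact: le_trans.
move=> w _; rewrite indicE; case: (boolP (w \in A)) => [|] wA.
  move: wA; rewrite inE /A/= mulr1 lt_max ltxx /= => h.
  rewrite (max_r (ltW h)) lerBlDr lerD2l.
  exact: (ergodic_max_le n (shiftn 1 w)).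
rewrite mulr0 subr_le0; move: wA; rewrite notin_setE /A/= => /negP.
by rewrite -leNgt => /le_trans; apply; exact: (ergodic_max_ge0 n.+1 (shiftn 1 w)).
Qed.

(** The set [E] of unbounded running maxima is invariant, hence null or of full mass. Full mass
    would let the sets of the maximal inequality exhaust the space and force a nonnegative
    integral. *)
Lemma birkhoff_bounded : \int[mu]_w f w < 0 ->
  {ae mu, forall w, exists K : R, forall n, \sum_(k < n) f (shiftn k w) <= K}.
Proof.
move=> f0; have M0 : 0 <= M by apply: le_trans (fM point).
pose E : set shift_space := \bigcap_c \bigcup_n [set w | c%:R < ergodic_max n w].
have mA c n : measurable ([set w | c%:R < ergodic_max n w] : set shift_space).
  rewrite -[X in measurable X]setTI; apply: measurable_fun_ltr => //.
  exact: measurable_ergodic_max.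
have mE : measurable E.
  by apply: bigcapT_measurable => c; apply: bigcupT_measurable => n.
have invE : shiftn 1 @^-1` E = E.
  apply/seteqP; split => w Ew c _.
    (* Adding or removing the first term changes an ergodic sum by at most [M]; raising the
       threshold by [Num.bound M] pays for it in both inclusions. *)
    have [n _ /= h] := Ew (c + Num.bound M)%N Logic.I.
    exists n.+1 => //=; rewrite lt_max; apply/orP; right.
    have := fM w; rewrite ler_norml => /andP[+ _].
    by have := archi_boundP M0; move: h; rewrite natrD; lra.
  have [[|n] _ /=] := Ew (c + Num.bound M)%N Logic.I.
    by rewrite ltNge ler0n.
  rewrite lt_max ltNge ler0n /= => h; exists n => //=.
  have := fM w; rewrite ler_norml => /andP[_ +].
  by have := archi_boundP M0; move: h; rewrite natrD; lra.
have [E0|E1] := shift_invariant_01 mE invE.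
  exists E; split => // w /= h c _; apply: contrapT => h2; apply: h.
  exists c%:R => n; apply: le_trans (ergodic_sum_le_max n w) _.
  by rewrite leNgt; apply/negP => h3; apply: h2; exists n.
exfalso.
(* The omitted set contributes at most [M] times its mass, which stays below minus the integral of
   [f]; the integral over the rest is then still negative. *)
have [||||n] := @probability_exhaust _ _ _ mu
  (fun n => [set w | 0 < ergodic_max n.+1 w])
  (- (\int[mu]_w f w) / (M + 1)).
- by move=> n; exact: (mA 0%N).
- by move=> n w /= /lt_le_trans; apply; exact: (ergodic_max_le n.+1).
- exists (~` E); split; first exact: measurableC.
    by rewrite probability_setC// E1 subee.
  move=> w /= h Ew; apply: h; have [[|n] _ /= h] := Ew 0%N Logic.I.
    by rewrite ltxx in h.
  by exists n.
- by rewrite divr_gt0//; lra.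
set A := [set w | _] => hA.
have mA' : measurable A by exact: (mA 0%N).
have := maximal_ergodic n; rewrite -/A; apply/negP; rewrite -ltNge.
have -> : \int[mu]_w (f w * \1_A w) =
  \int[mu]_w (f w) + \int[mu]_w (- f w * \1_(~` A) w).
  rewrite -RintegralD//.
  - apply: eq_Rintegral => w _; rewrite !indicE in_setC.
    by case: (w \in A) => /=; ring.
  - exact: bounded_integrable fM.
  - apply: (@bounded_integrable _ _ _ _ _ M).
      apply: measurable_funM; first exact: measurable_funN.
      by apply: measurable_indic; exact: measurableC.
    move=> w; rewrite normrM normrN indicE; have := fM w.
    by case: (_ \in _); rewrite ?normr1 ?mulr1// normr0 mulr0; exact: le_trans.
have mC : measurable (~` A) by exact: measurableC.
have h1 : \int[mu]_w (- f w * \1_(~` A) w) <= M * fine (mu (~` A)).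
  rewrite -Rintegral_indic// -RintegralZl//; last first.
    apply: (@bounded_integrable _ _ _ _ _ 1); first exact: measurable_indic.
    by move=> w; rewrite indicE; case: (_ \in _); rewrite ?normr1// normr0.
  apply: le_Rintegral => //.
  - apply: (@bounded_integrable _ _ _ _ _ M).
      by apply: measurable_funM; [exact: measurable_funN|exact: measurable_indic].
    move=> w; rewrite normrM normrN indicE; have := fM w.
    by case: (_ \in _); rewrite ?normr1 ?mulr1// normr0 mulr0; exact: le_trans.
  - apply: (@bounded_integrable _ _ _ _ _ M).
      by apply: measurable_funM; [exact: measurable_cst|exact: measurable_indic].
    move=> w; rewrite normrM indicE ger0_norm//.
    by case: (_ \in _); rewrite ?normr1 ?mulr1// normr0 mulr0.
  move=> w _; apply: ler_wpM2r.
    by rewrite indicE; case: (_ \in _).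
  by have := fM w; rewrite ler_norml => /andP[+ _]; lra.
have h2 : fine (mu (~` A)) < - (\int[mu]_w f w) / (M + 1).
  by rewrite -lte_fin fineK// fin_num_measure.
have h3 : 0 <= fine (mu (~` A)) by rewrite fine_ge0.
move: h2; rewrite ltr_pdivlMr; last lra.
by nra.
Qed.

End maximal.

(** A one-sided bound suits both mass estimates: one applies it to a potential, the other to the
    opposite of a potential. *)
Lemma birkhoff_upper (f : shift_space -> R) (c : R) :
  measurable_fun setT f -> (exists M, forall w, `|f w| <= M) ->
  \int[mu]_w f w < c ->
  {ae mu, forall w, exists K : R, forall n,
    \sum_(k < n) f (shiftn k w) <= n%:R * c + K}.
Proof.
move=> mf [M fM] fc.
have mg : measurable_fun setT (fun w => f w - c).
  by apply: measurable_funB => //; exact: measurable_cst.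
have := @birkhoff_bounded (fun w => f w - c) (M + `|c|) mg.
case=> [w||N [mN N0 h]].
- by rewrite (le_trans (ler_normB _ _))// lerD.
- rewrite RintegralB//.
  + rewrite Rintegral_cst// (_ : fine _ = 1) ?mulr1; first lra.
    by have /(congr1 fine) := @probability_setT _ _ _ mu.
  + exact: bounded_integrable fM.
  + apply: (@bounded_integrable _ _ _ _ _ `|c|) => //; exact: measurable_cst.
exists N; split => // w /= h2; apply: h => /= -[K hK]; apply: h2.
exists K => n; have := hK n.
by rewrite sumrB sumr_const card_ord -mulr_natl; lra.
Qed.

End birkhoff.

(** * Local dimension *)

Section local_dimension.
Context {R : realType}.
Implicit Types (lam : probability R R) (D b c e r : R).

Definition ball_mass lam (x : R) r : R := fine (lam (closed_ball_ Num.norm x r)).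

(** The constant [K] absorbs the large radii, so that no threshold on [r] appears. A lower bound on
    masses is an upper bound on the dimension. *)
Definition dim_le lam D := forall e, 0 < e ->
  {ae lam, forall x, exists K, forall r, 0 < r <= 1 ->
    expR ((D + e) * ln r - K) <= ball_mass lam x r}.

Definition dim_ge lam D := forall e, 0 < e ->
  {ae lam, forall x, exists K, forall r, 0 < r <= 1 ->
    ball_mass lam x r <= expR ((D - e) * ln r + K)}.

Lemma closed_ball_itvE (x : R) r : closed_ball_ Num.norm x r = `[x - r, x + r]%classic.
Proof.
by apply/seteqP; split => y /=; rewrite in_itv/= /closed_ball_/= ler_norml; lra.
Qed.

Lemma measurable_closed_ball_ (x : R) r :
  measurable (closed_ball_ Num.norm x r : set R).
Proof. by rewrite closed_ball_itvE; exact: measurable_itv. Qed.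

Lemma le_fine_measure d (T : measurableType d) (P : probability T R)
    (A B : set T) : measurable A -> measurable B -> A `<=` B ->
  fine (P A) <= fine (P B).
Proof.
move=> mA mB AB; apply: fine_le; rewrite ?fin_num_measure//.
by apply: le_measure; rewrite ?inE.
Qed.

Lemma ball_mass_ge0 lam x r : 0 <= ball_mass lam x r.
Proof. exact: fine_ge0. Qed.

Lemma ball_mass_le1 lam x r : ball_mass lam x r <= 1.
Proof.
have mB := @measurable_closed_ball_ x r.
by rewrite -lee_fin fineK ?fin_num_measure//; exact: probability_le1.
Qed.

Lemma le_ball_mass lam x r r' : r <= r' -> ball_mass lam x r <= ball_mass lam x r'.
Proof.
move=> rr'; apply: le_fine_measure; [exact: measurable_closed_ball_..|].
by move=> y /= /le_trans; apply.
Qed.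

Lemma ae_imply d (T : measurableType d) (P : {measure set T -> \bar R})
    (Q Q' : T -> Prop) : (forall x, Q x -> Q' x) ->
  {ae P, forall x, Q x} -> {ae P, forall x, Q' x}.
Proof. by move=> QQ'; apply: filterS. Qed.

Lemma ae_and d (T : measurableType d) (P : {measure set T -> \bar R})
    (Q Q' : T -> Prop) : {ae P, forall x, Q x} -> {ae P, forall x, Q' x} ->
  {ae P, forall x, Q x /\ Q' x}.
Proof. exact: filterI. Qed.

Lemma dim_le_scale lam b c D : 0 < b < 1 -> 0 < c -> 0 <= D ->
  (forall e, 0 < e -> {ae lam, forall x, exists K N, forall n, (N <= n)%N ->
    expR (n%:R * (D + e) * ln b - K) <= ball_mass lam x (c * b ^+ n)}) ->
  dim_le lam D.
Proof.
move=> b01 c0 D0 H e e0; apply: ae_imply (H e e0) => x [K [N HN]].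
have [b0 b1] := andP b01; have lb := ln_lt0 b01.
exists (K + (D + e) * (`|ln c| + (N.+1)%:R * - ln b)) => r /andP[r0 r1].
have lr : ln r <= 0 by rewrite ln_le0.
pose y := (ln r - ln c) / ln b.
have yE : y * ln b = ln r - ln c by rewrite divfK// lt_eqF.
have [n yn ny] : exists2 n : nat, y <= n%:R & n%:R * ln b >= ln r - `|ln c| + ln b.
  have [y0|y0] := leP 0 y.
    exists (Num.truncn y).+1; first by rewrite ltW// Num.Theory.truncnS_gt.
    have /andP[+ _] := Num.Theory.truncn_itv y0.
    have := ler_norm (ln c).
    rewrite -natr1; nra.
  exists 0%N; first by rewrite ltW.
  have := ler_norm (- ln c); rewrite normrN mul0r; have := normr_ge0 (ln c); lra.
apply: le_trans (le_trans (HN (n + N)%N (leq_addl _ _)) _).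
  rewrite ler_expR natrD -natr1.
  have : (D + e) * (n%:R * ln b) >= (D + e) * (ln r - `|ln c| + ln b).
    by rewrite ler_wpM2l//; lra.
  lra.
apply: le_ball_mass; rewrite -ler_ln ?posrE ?mulr_gt0 ?exprn_gt0//.
rewrite lnM ?posrE ?exprn_gt0// lnXn// -mulr_natl natrD.
have : 0 <= N%:R :> R by [].
nra.
Qed.

(** Here [r] is compared with the scale just above it. Scales before the threshold and nonpositive
    exponents are covered by the trivial bound 1 on masses. *)
Lemma dim_ge_scale lam b D : 0 < b < 1 ->
  (forall e, 0 < e -> {ae lam, forall x, exists K N, forall n, (N <= n)%N ->
    ball_mass lam x (b ^+ n) <= expR (n%:R * (D - e) * ln b + K)}) ->
  dim_ge lam D.
Proof.
move=> b01 H e e0; apply: ae_imply (H e e0) => x [K [N HN]].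
have [b0 b1] := andP b01; have lb := ln_lt0 b01.
exists (`|K| + `|D - e| * (N.+1%:R * - ln b)) => r /andP[r0 r1].
have lr : ln r <= 0 by rewrite ln_le0.
have K0 := normr_ge0 K; have De0 := normr_ge0 (D - e).
have NR : 0 <= N%:R :> R by [].
have [De|De] := leP (D - e) 0.
  apply: le_trans (ball_mass_le1 _ _ _) _; rewrite -[leLHS]expR0 ler_expR.
  rewrite -natr1; have : 0 <= `|D - e| * ((N%:R + 1) * - ln b).
    by rewrite !mulr_ge0//; lra.
  nra.
rewrite (gtr0_norm De).
pose y := ln r / ln b.
have yE : y * ln b = ln r by rewrite divfK// lt_eqF.
have y0 : 0 <= y by rewrite leNgt; apply/negP => yneg; nra.
have /andP[ny yn] := Num.Theory.truncn_itv y0.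
set n := Num.truncn y in ny yn.
have [Nn|nN] := leqP N n.
  apply: le_trans (le_trans _ (HN n Nn)) _.
    apply: le_ball_mass; rewrite -ler_ln ?posrE ?exprn_gt0// lnXn// -mulr_natl.
    nra.
  rewrite ler_expR; have := ler_norm K; rewrite -natr1 in yn *.
  have : (D - e) * (n%:R * ln b) <= (D - e) * (ln r - ln b).
    by rewrite ler_wpM2l//; [lra|nra].
  have : 0 <= (D - e) * (N%:R * - ln b) by rewrite mulr_ge0//; nra.
  lra.
apply: le_trans (ball_mass_le1 _ _ _) _; rewrite -[leLHS]expR0 ler_expR.
have nN' : n.+1%:R <= N%:R :> R by rewrite ler_nat.
have : (D - e) * ln r >= (D - e) * (N%:R * ln b).
  by rewrite ler_wpM2l//; nra.
rewrite -natr1; nra.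
Qed.

Lemma ae_nonempty d (T : measurableType d) (P : probability T R)
  (Q : T -> Prop) : {ae P, forall x, Q x} -> exists x, Q x.
Proof.
move=> [N [mN N0 h]]; apply: contrapT => /forallNP hQ.
have : P setT = 0%E.
  apply/eqP; rewrite eq_le measure_ge0 andbT -N0 le_measure ?inE//.
  by move=> x _; apply: h => /=; exact: hQ.
by rewrite probability_setT => /eqP; rewrite onee_eq0.
Qed.

(** Restricting [e] to reciprocals of integers leaves countably many null sets, so that one
    full-measure set serves all [e]. *)
Lemma exact_dimensional_le_ge lam D : dim_le lam D -> dim_ge lam D ->
  exact_dimensional lam D.
Proof.
move=> lamD Dlam.
have e0 n : 0 < n.+1%:R^-1 :> R by rewrite invr_gt0.
have inve e : 0 < e -> exists n, n.+1%:R^-1 < e :> R.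
  move=> e0'; exists (Num.bound e^-1).
  rewrite invf_plt ?posrE//; apply: lt_trans (archi_boundP _) _.
    by rewrite invr_ge0 ltW.
  by rewrite ltr_nat.
split.
  rewrite leNgt; apply/negP => D0.
  have [n ne] := inve (- D) ltac:(lra).
  have [x [K HK]] := ae_nonempty (lamD _ (e0 n)).
  set t := D + n.+1%:R^-1 in HK.
  have t0 : t < 0 by move: ne; rewrite /t; set u := _^-1; lra.
  (* At this radius the lower bound on the mass is at least [expR 1], which no probability reaches;
     hence [D] is nonnegative. *)
  pose r := expR ((`|K| + 1) / t).
  have := HK r; rewrite expR_gt0/= expRK mulrC divfK ?lt_eqF//.
  have K0 := normr_ge0 K; have K1 := ler_norm K.
  have -> : r <= 1.
    by rewrite -[leRHS]expR0 ler_expR -mulrNN -invrN mulr_le0_ge0 ?invr_ge0; lra.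
  move=> /(_ isT) /le_trans /(_ (ball_mass_le1 _ _ _)).
  by rewrite -[leRHS]expR0 ler_expR; lra.
have := ae_and (ae_foralln (fun n => lamD _ (e0 n)))
  (ae_foralln (fun n => Dlam _ (e0 n))).
apply: ae_imply => x [Hle Hge].
have mass_gt0 r : 0 < r <= 1 -> 0 < ball_mass lam x r.
  have [K HK] := Hle 0%N.
  by move=> /HK; apply: lt_le_trans; exact: expR_gt0.
have key : (fun r => ln (ball_mass lam x r) / ln r) @ 0^'+ --> D.
  apply/cvgrPdist_le.
  suff H (e : R) : 0 < e ->
    \forall r \near 0^'+, `|D - ln (ball_mass lam x r) / ln r| <= e by [].
  move=> ege0.
  have [n ne] := inve (e / 2) ltac:(lra).
  have [K HK] := Hle n; have [K' HK'] := Hge n.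
  pose k : R := `|K| + `|K'| + 1.
  have k0 : 0 < k by rewrite /k; have := normr_ge0 K; have := normr_ge0 K'; lra.
  (* Below this radius both constants are less than [e / 2] times [- ln r]; the other half of [e]
     covers the error [n.+1%:R^-1] in the exponent. *)
  exists (expR (- (2 * k / e))) => /=; first exact: expR_gt0.
  move=> r /=; rewrite sub0r normrN => rk r0.
  rewrite gtr0_norm// in rk.
  have lr : ln r < - (2 * k / e).
    by rewrite -[ltRHS]expRK ltr_ln ?posrE ?expR_gt0.
  have ke : 0 < 2 * k / e by rewrite divr_gt0//; lra.
  have r01 : 0 < r <= 1.
    rewrite r0/= ltW// (lt_trans rk)// expR_lt1; lra.
  have m0 := mass_gt0 r r01.
  have h1 := HK r r01; have h2 := HK' r r01.
  rewrite -ler_ln ?posrE ?expR_gt0// expRK in h1.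
  rewrite -ler_ln ?posrE ?expR_gt0// expRK in h2.
  set L := ln r in lr h1 h2 *; set m := ln _ in h1 h2 *.
  have L0 : L < 0 by lra.
  have kL : 2 * k < e * - L.
    by rewrite [ltRHS]mulrC -ltr_pdivrMr//; lra.
  have Ln0 : L != 0 by rewrite lt_eqF.
  rewrite -[X in `|X - _|](mulfK Ln0) -mulrBl normrM normfV.
  rewrite ler_pdivrMr ?normr_gt0// (ltr0_norm L0).
  have := ler_norm K; have := ler_norm K'.
  have := normr_ge0 K; have := normr_ge0 K'.
  rewrite /k in kL; rewrite ler_norml => ? ? ? ?.
  have : 0 <= n.+1%:R^-1 :> R by rewrite ltW.
  by move: ne h1 h2; set t := n.+1%:R^-1 => ne h1 h2 t0; apply/andP; split; nra.
have : (fun r => (ln (ball_mass lam x r) / ln r)%:E) @ 0^'+ --> D%:E.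
  by apply: cvg_EFin => //; exact: nearW.
apply: cvg_trans; apply: near_eq_cvg; near=> r.
have r01 : 0 < r <= 1.
  apply/andP; split; near: r; first exact: nbhs_right_gt.
  by apply: nbhs_right_le.
rewrite -[lam _]fineK ?fin_num_measure//; last exact: measurable_closed_ball_.
by rewrite -/(ball_mass lam x r) lne_EFin ?mass_gt0// -EFinM.
Unshelve. all: by end_near.
Qed.

End local_dimension.

Lemma borel_cantelli_geometric d (T : measurableType d) (R : realType)
    (P : probability T R) (F : (set T)^nat) (C q : R) :
  0 <= q < 1 -> (forall n, measurable (F n)) ->
  (exists N, forall n, (N <= n)%N -> fine (P (F n)) <= C * q ^+ n) ->
  {ae P, forall x, exists N, forall n, (N <= n)%N -> ~ F n x}.
Proof.
move=> /andP[q0 q1] mF [N FN].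
pose G n := F (N + n)%N.
have mG n : measurable (G n) by exact: mF.
exists (lim_sup_set G); split.
- by apply: bigcapT_measurable => n; apply: bigcup_measurable.
- apply: lim_sup_set_cvg0 => //.
  apply: (@le_lt_trans _ _ (\sum_(0 <= n <oo) (C * q ^+ N * q ^+ n)%:E)%E).
    apply: lee_nneseries => // n _.
    rewrite -[leLHS]fineK ?fin_num_measure// lee_fin.
    by rewrite -mulrA -exprD; apply: FN; exact: leq_addr.
  have -> : (\sum_(0 <= n <oo) (C * q ^+ N * q ^+ n)%:E)%E =
      (limn (series (geometric (C * q ^+ N) q)))%:E.
    rewrite -EFin_lim; last by apply: is_cvg_geometric_series; rewrite ger0_norm.
    by apply: congr_lim; apply/funext => n /=; rewrite sumEFin.
  exact: ltry.
move=> x /= h n _; apply: contrapT => hn; apply: h.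
exists (N + n)%N => k Nk Fk; apply: hn; exists (k - N)%N => /=.
  by rewrite leq_subRL//; apply: leq_trans Nk; exact: leq_addr.
by rewrite /G subnKC//; apply: leq_trans Nk; exact: leq_addr.
Qed.

(** * Codings and the convolution upper bound *)

Section coding.
Context {R : realType} (b : R).
Hypothesis b01 : 0 < b < 1.
Implicit Types (s t : seq bool) (w : shift_space).

Lemma ifsE i x : ifs b i x = (if i then 1 else -1) + b * x.
Proof. by rewrite /ifs; case: i; rewrite addrC. Qed.

Lemma partial_cat s t : foldr (ifs b) 0 (s ++ t) =
  foldr (ifs b) 0 s + b ^+ size s * foldr (ifs b) 0 t.
Proof. by rewrite foldr_cat foldr_ifs. Qed.

Lemma partial_bound s : `|foldr (ifs b) 0 s| <= (1 - b)^-1.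
Proof.
have [b0 b1] := andP b01.
elim: s => [|i s IH]; first by rewrite normr0 invr_ge0; lra.
rewrite [foldr _ _ _]/= ifsE (le_trans (ler_normD _ _))//.
rewrite normrM (gtr0_norm b0) (_ : `|if i then 1 else -1| = 1); last first.
  by case: i; rewrite ?normrN normr1.
have <- : 1 + b * (1 - b)^-1 = (1 - b)^-1 by field; lra.
by rewrite lerD2l ler_pM2l.
Qed.

Let b1n : `|b| < 1. Proof. by case/andP: b01 => ? ?; rewrite gtr0_norm. Qed.

Lemma codingE w n : coding b w =
  foldr (ifs b) 0 (mkseq w n) + b ^+ n * coding b (shiftn n w).
Proof.
apply: cvg_lim => //.
have := @is_cvg_coding _ b (shiftn n w) b1n.
rewrite -(cvg_shiftn n (fun n => foldr (ifs b) 0 (mkseq w n))) => cw.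
rewrite (_ : [sequence _]_n = (fun k => foldr (ifs b) 0 (mkseq w n) +
    b ^+ n * foldr (ifs b) 0 (mkseq (shiftn n w) k))).
  by apply: cvgD; [exact: cvg_cst|apply: cvgM => //; exact: cvg_cst].
apply/funext => k /=; rewrite addnC mkseq_addn partial_cat size_mkseq.
by rewrite /shiftn.
Qed.

Lemma coding_bound w : `|coding b w| <= (1 - b)^-1.
Proof.
have cw := @is_cvg_coding _ b w b1n.
rewrite ler_norml; apply/andP; split.
  apply: limr_ge => //; apply: nearW => n.
  by have := partial_bound (mkseq w n); rewrite ler_norml => /andP[].
apply: limr_le => //; apply: nearW => n.
by have := partial_bound (mkseq w n); rewrite ler_norml => /andP[].
Qed.

Lemma coding_partial w n :
  `|coding b w - foldr (ifs b) 0 (mkseq w n)| <= b ^+ n * (1 - b)^-1.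
Proof.
have [b0 b1] := andP b01.
rewrite (codingE w n) addrAC subrr add0r normrM ger0_norm ?exprn_ge0 ?(ltW b0)//.
by rewrite ler_pM2l ?exprn_gt0// coding_bound.
Qed.

End coding.

Section ball_mass_measurability.
Context {R : realType} (lam : probability R R).

Lemma measurable_ball_mass (r : R) :
  measurable_fun setT (fun x => ball_mass lam x r).
Proof.
pose A : set (R * R) := [set z | `|z.1 - z.2| <= r].
have mA : measurable A.
  rewrite -[A]setTI; apply: measurable_fun_ler => //.
  apply: measurableT_comp => //; exact: measurable_funB.
have := measurable_fun_xsection lam mA.
move=> /(measurableT_comp (@fine_measurable R _ measurableT)).
apply: eq_measurable_fun => x _ /=; rewrite /ball_mass; congr (fine (lam _)).
by apply/seteqP; split => y; rewrite /xsection/= inE.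
Qed.

Lemma measurable_ball_mass_lt (r c : R) :
  measurable [set x | ball_mass lam x r < c].
Proof.
rewrite -[X in measurable X]setTI; apply: measurable_fun_ltr => //.
exact: measurable_ball_mass.
Qed.

Lemma measurable_ball_mass_gt (r c : R) :
  measurable [set x | c < ball_mass lam x r].
Proof.
rewrite -[X in measurable X]setTI; apply: measurable_fun_ltr => //.
exact: measurable_ball_mass.
Qed.

End ball_mass_measurability.

(** * Upper bound for the dimension of a convolution *)

Section convolution.
Context {R : realType} (mu nu : probability R R).

Lemma measure_convolutionE (A : set R) : measure_convolution mu nu A =
  (mu \x nu)%E [set z | A (z.1 + z.2)].
Proof. by []. Qed.

Lemma measurable_add_preimage (A : set R) : measurable A ->
  measurable ([set z | A (z.1 + z.2)] : set (R * R)).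
Proof.
move=> mA; rewrite -[X in measurable X]setTI.
have : measurable_fun setT (fun z : R * R => z.1 + z.2).
  exact: measurable_funD.
exact.
Qed.

(** The sum of two sets of full measure need not be Borel. The limsup of the [F n] is, and its
    preimage under addition lies in the union of two null strips. *)
Lemma ae_convolution (F : (set R)^nat) (P Q : R -> Prop) :
  (forall n, measurable (F n)) ->
  {ae mu, forall x, P x} -> {ae nu, forall y, Q y} ->
  (forall x y, P x -> Q y -> exists N, forall n, (N <= n)%N -> ~ F n (x + y)) ->
  {ae measure_convolution mu nu,
    forall z, exists N, forall n, (N <= n)%N -> ~ F n z}.
Proof.
move=> mF [A [mA A0 PA]] [B [mB B0 QB]] PQ.
have mL : measurable (lim_sup_set F).
  by apply: bigcapT_measurable => n; apply: bigcup_measurable.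
exists (lim_sup_set F); split => //.
- apply/eqP; rewrite eq_le measure_ge0 andbT measure_convolutionE.
  apply: (@le_trans _ _ ((mu \x nu)%E (A `*` setT `|` setT `*` B))).
    apply: le_measure; rewrite ?inE.
    + exact: measurable_add_preimage.
    + by apply: measurableU; exact: measurableX.
    move=> [x y] /= Lxy; apply: contrapT => /not_orP[hA hB].
    have Px : P x by apply: contrapT => /PA h; apply: hA.
    have Qy : Q y by apply: contrapT => /QB h; apply: hB.
    have [N hN] := PQ x y Px Qy.
    by have [n /= /hN h /h] := Lxy N Logic.I.
  have h1 : ((mu \x nu)%E (A `*` setT) <= 0)%E.
    by rewrite product_measure1E// [X in (X * _)%E](_ : _ = 0%E) ?mul0e.
  have h2 : ((mu \x nu)%E (setT `*` B) <= 0)%E.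
    by rewrite product_measure1E// [X in (_ * X)%E](_ : _ = 0%E) ?mule0.
  apply: le_trans; first by apply: measureU2; exact: measurableX.
  rewrite -[leRHS]adde0; apply: leeD; [exact: h1|exact: h2].
- move=> z /= h n _; apply: contrapT => hn; apply: h.
  by exists n => k nk Fk; apply: hn; exists k.
Qed.

Lemma ball_mass_convolution (x y r : R) :
  ball_mass mu x r * ball_mass nu y r <=
  ball_mass (measure_convolution mu nu) (x + y) (2 * r).
Proof.
have mB := @measurable_closed_ball_ R.
rewrite /ball_mass -fineM ?fin_num_measure//.
rewrite -product_measure1E//; apply: fine_le.
- by rewrite product_measure1E// fin_numM// fin_num_measure.
- by rewrite fin_num_measure.
rewrite [leRHS](_ : _ = (mu \x nu)%E
  [set z | closed_ball_ Num.norm (x + y) (2 * r) (z.1 + z.2)])//.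
apply: le_measure; rewrite ?inE.
- exact: measurableX.
- exact: measurable_add_preimage.
move=> [x' y'] [/= xx' yy'].
rewrite /closed_ball_/= (_ : _ - _ = (x - x') + (y - y')); last by ring.
by rewrite (le_trans (ler_normD _ _))// mulr_natl mulr2n lerD.
Qed.

Lemma dim_le_convolution D D' : 0 <= D -> 0 <= D' ->
  dim_le mu D -> dim_le nu D' -> dim_le (measure_convolution mu nu) (D + D').
Proof.
move=> D0 D'0 muD nuD'.
have b01 : 0 < (2^-1 : R) < 1 by apply/andP; split; lra.
apply: (@dim_le_scale _ _ 2^-1 2) => //; first exact: addr_ge0.
move=> e e0.
pose F n := [set z | ball_mass (measure_convolution mu nu) z (2 * 2^-1 ^+ n) <
  expR (n%:R * (D + D' + e) * ln 2^-1)].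
have := @ae_convolution F _ _ _ (muD (e / 3) ltac:(lra)) (nuD' (e / 3) ltac:(lra)).
have lb := ln_lt0 b01.
move=> /(_ (fun n => measurable_ball_mass_lt _ _ _)) H.
apply: ae_imply (H _) => [z [N hN]|x y [K hK] [K' hK']].
  exists 0, N => n Nn; rewrite subr0 leNgt; apply/negP; exact: hN.
pose L := - ln 2^-1 : R.
have L0 : 0 < L by rewrite oppr_gt0.
(* Two thirds of [e] are spent on the two factors; from this [n] on the last third absorbs both
   constants. *)
exists (Num.bound ((`|K| + `|K'|) * 3 / (e * L))) => n hn.
apply/negP; rewrite -leNgt.
have h0 : 0 <= (`|K| + `|K'|) * 3 / (e * L).
  by rewrite divr_ge0// ?mulr_ge0 ?addr_ge0//; lra.
have hn' : (`|K| + `|K'|) * 3 < n%:R * (e * L).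
  rewrite -ltr_pdivrMr ?mulr_gt0//; apply: lt_le_trans (archi_boundP h0) _.
  by rewrite ler_nat.
apply: le_trans (ball_mass_convolution _ _ _).
have r01 : 0 < (2^-1 : R) ^+ n <= 1.
  by rewrite exprn_gt0/= ?exprn_ile1//; lra.
apply: (le_trans _ (ler_pM (expR_ge0 _) (expR_ge0 _) (hK _ r01) (hK' _ r01))).
rewrite -expRD ler_expR lnXn; last lra.
have := ler_norm K; have := ler_norm K'.
rewrite -mulr_natl; rewrite /L in hn'; nra.
Qed.

End convolution.

(** About [2 * C / r] intervals of length [r] cover the support, and each carries less than
    [r ^ (1 + e)] of the points whose [r]-ball is lighter than that. The total is of order [r ^ e],
    summable over [r = 2^-n]. *)
Lemma dim_le1 (R : realType) (lam : probability R R) (C : R) :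
  {ae lam, forall x, `|x| <= C} -> dim_le lam 1.
Proof.
move=> lamC.
have C0 : 0 <= C by have [x] := ae_nonempty lamC; exact: le_trans.
have b01 : 0 < (2^-1 : R) < 1 by apply/andP; split; lra.
apply: (@dim_le_scale _ _ 2^-1 1) => // e e0.
have lb := ln_lt0 b01.
pose F n := [set z | ball_mass lam z (2^-1 ^+ n) <
  expR (n%:R * (1 + e) * ln 2^-1)] `&` [set z | `|z| <= C].
have mF n : measurable (F n).
  apply: measurableI; first exact: measurable_ball_mass_lt.
  rewrite (_ : [set _ | _] = closed_ball_ Num.norm 0 C).
    exact: measurable_closed_ball_.
  by apply/seteqP; split => x; rewrite /closed_ball_/= sub0r normrN.
have bc : {ae lam, forall x, exists N, forall n, (N <= n)%N -> ~ F n x}.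
  apply: (@borel_cantelli_geometric _ _ _ _ _ (2 * C + 1) (expR (e * ln 2^-1))) => //.
    by rewrite expR_ge0 expR_lt1; nra.
  exists 0%N => n _.
  pose r : R := 2^-1 ^+ n.
  have r0 : 0 < r by rewrite exprn_gt0//; lra.
  have r1 : r <= 1 by rewrite exprn_ile1//; lra.
  have y0 : 0 <= 2 * C / r by rewrite divr_ge0//; lra.
  (* The extra interval makes [J * r] exceed [2 * C], so that the endpoint [C] is covered too. *)
  pose J := (Num.truncn (2 * C / r)).+1.
  have Jle : J%:R * r <= 2 * C + r.
    have /andP[+ _] := Num.Theory.truncn_itv y0.
    rewrite ler_pdivlMr// /J -natr1; lra.
  have Jgt : 2 * C < J%:R * r.
    by rewrite -ltr_pdivrMr// Num.Theory.truncnS_gt.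
  pose I (j : nat) : set R := F n `&` closed_ball_ Num.norm (- C + j%:R * r + r / 2) (r / 2).
  have mI j : measurable (I j).
    by apply: measurableI => //; exact: measurable_closed_ball_.
  have FI : F n `<=` \big[setU/set0]_(j < J) I j.
    move=> z Fz; have [_ /=] := Fz; rewrite ler_norml => /andP[z1 z2].
    have yz0 : 0 <= (z + C) / r by rewrite divr_ge0//; lra.
    have /andP[t1 t2] := Num.Theory.truncn_itv yz0.
    set j := Num.truncn _ in t1 t2.
    rewrite ler_pdivlMr// in t1; rewrite ltr_pdivrMr// -natr1 in t2.
    have [jJ|Jj] := ltnP j J.
      rewrite -bigcup_mkord; exists j => //; split => //.
      rewrite /closed_ball_/= ler_norml; lra.
    have : J%:R <= j%:R :> R by rewrite ler_nat.
    move=> Jj'.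
    have zC : z = C by nra.
    nra.
  have Ile j : (lam (I j) <= (expR (n%:R * (1 + e) * ln 2^-1))%:E)%E.
    have [I0|/set0P[z [[/= Fz _] Iz]]] := eqVneq (I j) set0.
      by rewrite I0 measure0 lee_fin expR_ge0.
    rewrite -[leLHS]fineK ?fin_num_measure// lee_fin.
    apply: le_trans (ltW Fz); apply: le_fine_measure => //.
      exact: measurable_closed_ball_.
    move=> y [_]; move: Iz; rewrite /closed_ball_/= -/r !ler_norml.
    by move=> /andP[? ?] /andP[? ?]; apply/andP; split; lra.
  apply: (@le_trans _ _ (J%:R * expR (n%:R * (1 + e) * ln 2^-1))).
    rewrite -lee_fin fineK ?fin_num_measure//.
    apply: le_trans (_ : (lam (\big[setU/set0]_(j < J) I j) <= _)%E).
      apply: le_measure; rewrite ?inE//.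
      by apply: bigsetU_measurable.
    apply: (le_trans (Boole_inequality _ _)) => //.
    apply: (@le_trans _ _ (\sum_(j < J) (expR (n%:R * (1 + e) * ln 2^-1))%:E)%E).
      by apply: lee_sum => j _; exact: Ile.
    by rewrite sumEFin lee_fin sumr_const card_ord [leRHS]mulr_natl.
  have -> : n%:R * (1 + e) * ln 2^-1 = n%:R * ln 2^-1 + n%:R * (e * ln 2^-1) :> R.
    by ring.
  rewrite expRD (expRM_natl n (e * _)) (expRM_natl n (ln _)) lnK ?posrE; last lra.
  rewrite mulrA -/r; apply: ler_wpM2r; first by rewrite exprn_ge0// expR_ge0.
  lra.
apply: ae_imply (ae_and lamC bc) => x [xC [N hN]].
exists 0, N => n Nn; rewrite subr0 mul1r leNgt; apply/negP => h.
exact: (hN n Nn).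
Qed.

Lemma dim_le_min (R : realType) (lam : probability R R) (D D' : R) :
  dim_le lam D -> dim_le lam D' -> dim_le lam (Num.min D D').
Proof. by rewrite /Num.min; case: ifP. Qed.

Lemma bernoulli_convolution_bound (R : realType) (b : R)
    (mu : probability shift_space R) : 0 < b < 1 ->
  {ae bernoulli_convolution b mu, forall x, `|x| <= (1 - b)^-1}.
Proof.
move=> b01; exists (~` closed_ball_ Num.norm 0 (1 - b)^-1); split.
- by apply: measurableC; exact: measurable_closed_ball_.
- rewrite /= /bernoulli_convolution /distribution /pushforward.
  rewrite (_ : _ @^-1` _ = set0) ?measure0//.
  rewrite -subset0 => w /=; apply; rewrite /closed_ball_/= sub0r normrN.
  exact: coding_bound.
- move=> x /= h h'; apply: h; move: h'.
  by rewrite /closed_ball_/= sub0r normrN.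
Qed.

Lemma convolution_bound (R : realType) (mu nu : probability R R) (C C' : R) :
  {ae mu, forall x, `|x| <= C} -> {ae nu, forall x, `|x| <= C'} ->
  {ae measure_convolution mu nu, forall x, `|x| <= C + C'}.
Proof.
move=> muC nuC.
pose F (n : nat) : set R := ~` closed_ball_ Num.norm 0 (C + C').
have mF n : measurable (F n).
  by apply: measurableC; exact: measurable_closed_ball_.
have := @ae_convolution _ mu nu F _ _ mF muC nuC.
move=> H; apply: ae_imply (H _).
  move=> x [N /(_ N (leqnn N))]; rewrite /F/= => /contrapT.
  by rewrite /closed_ball_/= sub0r normrN.
move=> x y xC yC; exists 0%N => n _; apply.
rewrite /closed_ball_/= sub0r normrN.
by rewrite (le_trans (ler_normD _ _))// lerD.
Qed.

Lemma ler_dist_min (R : realDomainType) (c x y : R) :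
  `|Num.min c x - Num.min c y| <= `|x - y|.
Proof.
rewrite ler_norml; have := ler_norm (x - y); have := ler_norm (- (x - y)).
rewrite normrN => ? ?; have := normr_ge0 (x - y).
rewrite /Num.min; case: ltP => /= ?; case: ltP => /= ? ?;
by apply/andP; split; lra.
Qed.

Lemma ler_dist_max (R : realDomainType) (c x y : R) :
  `|Num.max c x - Num.max c y| <= `|x - y|.
Proof.
rewrite ler_norml; have := ler_norm (x - y); have := ler_norm (- (x - y)).
rewrite normrN => ? ?; have := normr_ge0 (x - y).
rewrite /Num.max; case: ltP => /= ?; case: ltP => /= ? ?;
by apply/andP; split; lra.
Qed.

(** * Lipschitz approximation in L1 *)

Section lipschitz_approximation.
Context {R : realType} (lam : probability R R).
Implicit Types (f h q : R -> R) (t : R).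

Definition unit_measurable f := measurable_fun setT f /\ forall x, 0 <= f x <= 1.

(** Values stay in the unit interval so that [q] and [1 - q] can again serve as letter
    probabilities. *)
Definition unit_lipschitz q := (forall x, 0 <= q x <= 1) /\
  exists2 L : R, 0 <= L & forall x y, `|q x - q y| <= L * `|x - y|.

Lemma measurable_unit_lipschitz q : unit_lipschitz q -> measurable_fun setT q.
Proof.
move=> [_ [L L0 qL]]; apply: continuous_measurable_fun => x.
apply/cvgrPdist_le => e e0; exists (e / (L + 1)) => /=.
  by rewrite divr_gt0//; lra.
move=> y /= xy; apply: le_trans (qL x y) _.
have : `|x - y| * (L + 1) < e by rewrite -ltr_pdivlMr//; lra.
have := normr_ge0 (x - y); set u : R := `|x - y|; set e' : R := e; nra.
Qed.

Definition lipschitz_approx f := unit_measurable f /\ forall t, 0 < t ->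
  exists2 q, unit_lipschitz q & \int[lam]_x `|f x - q x| <= t.

Lemma unit_measurable_integrable f h : unit_measurable f -> unit_measurable h ->
  lam.-integrable setT (EFin \o (fun x => `|f x - h x|)).
Proof.
move=> [mf f01] [mh h01]; apply: (@bounded_integrable _ _ _ _ _ 1).
  by apply: measurableT_comp => //; exact: measurable_funB.
by move=> x; rewrite normr_id ler_norml; have := f01 x; have := h01 x; lra.
Qed.

Lemma unit_lipschitz_measurable q : unit_lipschitz q -> unit_measurable q.
Proof. by move=> ql; split; [exact: measurable_unit_lipschitz|case: ql]. Qed.

Lemma Rintegral_dist_triangle f h q :
  unit_measurable f -> unit_measurable h -> unit_measurable q ->
  \int[lam]_x `|f x - q x| <=
  \int[lam]_x `|f x - h x| + \int[lam]_x `|h x - q x|.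
Proof.
move=> uf uh uq.
have i1 := unit_measurable_integrable uf uh.
have i2 := unit_measurable_integrable uh uq.
rewrite -RintegralD//; apply: le_Rintegral => //.
- exact: unit_measurable_integrable.
- by have := integrableD measurableT i1 i2.
- by move=> x _; rewrite (le_trans _ (ler_normD _ _))// addrA subrK.
Qed.

Lemma lipschitz_approx_limit f : unit_measurable f ->
  (forall t, 0 < t -> exists2 h, lipschitz_approx h & \int[lam]_x `|f x - h x| <= t) ->
  lipschitz_approx f.
Proof.
move=> uf H; split => // t t0.
have [h [uh ah] fh] := H (t / 2) ltac:(lra).
have [q ql hq] := ah (t / 2) ltac:(lra).
exists q => //; have := Rintegral_dist_triangle uf uh (unit_lipschitz_measurable ql).
lra.
Qed.

Lemma lipschitz_approx_half f h : lipschitz_approx f -> lipschitz_approx h ->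
  lipschitz_approx (fun x => (f x + h x) / 2).
Proof.
move=> [uf af] [uh ah]; split.
  split.
    apply: measurable_funM => //; apply: measurable_funD; by [case: uf|case: uh].
  by move=> x; have := uf.2 x; have := uh.2 x; lra.
move=> t t0.
have [q ql fq] := af t t0; have [q' ql' hq'] := ah t t0.
exists (fun x => (q x + q' x) / 2).
  split; first by move=> x; have := ql.1 x; have := ql'.1 x; lra.
  have [_ [L L0 qL]] := ql; have [_ [L' L'0 qL']] := ql'.
  exists ((L + L') / 2) => [|x y]; first lra.
  rewrite (_ : _ - _ = ((q x - q y) + (q' x - q' y)) / 2); last by field.
  rewrite normrM (gtr0_norm (_ : 0 < 2^-1)); last lra.
  have := ler_normD (q x - q y) (q' x - q' y).
  have := qL x y; have := qL' x y; lra.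
have i1 := unit_measurable_integrable uf (unit_lipschitz_measurable ql).
have i2 := unit_measurable_integrable uh (unit_lipschitz_measurable ql').
have i12 := integrableD measurableT i1 i2.
apply: (@le_trans _ _ (\int[lam]_x (2^-1 * (`|f x - q x| + `|h x - q' x|)))).
  apply: le_Rintegral => //.
  - apply: (@bounded_integrable _ _ _ _ _ 1).
      apply: measurableT_comp => //; apply: measurable_funB.
        apply: measurable_funM => //; apply: measurable_funD; by [case: uf|case: uh].
      apply: measurable_funM => //.
      by apply: measurable_funD; exact: measurable_unit_lipschitz.
    move=> x; rewrite normr_id ler_norml.
    by have := uf.2 x; have := uh.2 x; have := ql.1 x; have := ql'.1 x; lra.
  - exact: integrableZl i12.
  - move=> x _; rewrite (_ : _ - _ = 2^-1 * ((f x - q x) + (h x - q' x))).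
      by rewrite normrM (gtr0_norm (_ : 0 < 2^-1)) ?ler_pM2l ?ler_normD//; lra.
    by field.
rewrite RintegralZl// RintegralD//; lra.
Qed.

(** The truncation keeps values in the unit interval and turns a sum of two indicators into the
    indicator of the union. *)
Lemma lipschitz_approx_add f h : lipschitz_approx f -> lipschitz_approx h ->
  lipschitz_approx (fun x => Num.min 1 (f x + h x)).
Proof.
move=> [uf af] [uh ah].
have um f' h' : unit_measurable f' -> unit_measurable h' ->
    unit_measurable (fun x => Num.min 1 (f' x + h' x)).
  move=> [mf f01] [mh h01]; split.
    by apply: measurable_minr => //; exact: measurable_funD.
  move=> x; rewrite le_min ge_min lexx /= andbT ler01/=.
  by have := f01 x; have := h01 x; lra.

split; first exact: um.
move=> t t0.
have [q ql fq] := af (t / 2) ltac:(lra).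
have [q' ql' hq'] := ah (t / 2) ltac:(lra).
have uq := unit_lipschitz_measurable ql.
have uq' := unit_lipschitz_measurable ql'.
exists (fun x => Num.min 1 (q x + q' x)).
  split; first by case: (um _ _ uq uq').
  have [_ [L L0 qL]] := ql; have [_ [L' L'0 qL']] := ql'.
  exists (L + L') => [|x y]; first lra.
  apply: le_trans (ler_dist_min _ _ _) _.
  rewrite (_ : _ - _ = ((q x - q y) + (q' x - q' y))); last by ring.
  have := ler_normD (q x - q y) (q' x - q' y).
  have := qL x y; have := qL' x y; lra.
have i1 := unit_measurable_integrable uf uq.
have i2 := unit_measurable_integrable uh uq'.
apply: (@le_trans _ _ (\int[lam]_x (`|f x - q x| + `|h x - q' x|))).
  apply: le_Rintegral => //.
  - by apply: unit_measurable_integrable; exact: um.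
  - by have := integrableD measurableT i1 i2.
  - move=> x _; apply: le_trans (ler_dist_min _ _ _) _.
    by rewrite (_ : _ - _ = (f x - q x) + (h x - q' x)) ?ler_normD//; ring.
rewrite RintegralD//; lra.
Qed.

Lemma unit_measurable_indic (A : set R) : measurable A -> unit_measurable \1_A.
Proof.
move=> mA; split; first exact: measurable_indic.
by move=> x; rewrite indicE; case: (_ \in _); rewrite !(ler01, lexx).
Qed.

(** Sets with approximable indicator form a Dynkin system: complements replace [q] by [1 - q], and
    countable unions are exhausted by finite ones. Ramps approximate the indicators of
    half-lines. *)
Lemma lipschitz_approx_indic (A : set R) : measurable A -> lipschitz_approx \1_A.
Proof.
have mE : @measurable _ R = <<s @RGenOInfty.G R >>.
  exact: RGenOInfty.measurableE.
suff H : forall A, <<s @RGenOInfty.G R >> A -> lipschitz_approx \1_A.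
  by move=> mA; apply: H; rewrite -mE.
move: A => _.
apply: (@dynkin_induction _ _ (@RGenOInfty.G R) (fun A => lipschitz_approx \1_A)).
- exact: mE.
- move=> _ _ [x ->] [y ->]; exists (Num.max x y).
  apply/seteqP; split => z /=; rewrite !in_itv/= !andbT gt_max.
    by move=> [-> ->].
  by move=> /andP[].
- split; first exact: unit_measurable_indic.
  move=> t t0; exists (cst 1).
    split; first by move=> x; rewrite /= ler01 lexx.
    by exists 0 => // x y; rewrite subrr normr0 mul0r.
  rewrite (_ : (fun x => _) = cst 0) ?Rintegral_cst ?mul0r ?ltW//.
  by apply/funext => x; rewrite indicT /= subrr normr0.
- move=> _ [a ->].
  have mA : measurable (`]a, +oo[%classic : set R) by exact: measurable_itv.
  split; first exact: unit_measurable_indic.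
  move=> t t0.
  (* The ramp of slope [n.+1%:R] differs from the indicator only here, and these intervals decrease
     to the empty set. *)
  pose B (n : nat) : set R := `]a, a + n.+1%:R^-1[%classic.
  have mB n : measurable (B n) by exact: measurable_itv.
  have [||||n hn] := @probability_exhaust _ _ _ lam (fun n => ~` B n) t.
  + by move=> n; exact: measurableC.
  + move=> n x; apply: subsetC => {}x; rewrite /B/= !in_itv/= => /andP[-> /= h].
    apply: lt_le_trans h _; rewrite lerD2l lef_pV2 ?posrE//.
    by rewrite ler_nat.
  + apply: aeW => x; have [xa|ax] := leP x a.
      by exists 0%N; rewrite /B/= in_itv/= ltNge xa.
    exists (Num.bound (x - a)^-1); rewrite /B/= in_itv/= ax/=; apply/negP.
    rewrite -leNgt -lerBrDl -[leRHS]invrK lef_pV2 ?posrE ?invr_gt0 ?subr_gt0//.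
    rewrite ltW// (lt_trans (archi_boundP _))// ?ltr_nat//.
    by rewrite invr_ge0 subr_ge0 ltW.
  + exact: t0.
  rewrite setCK in hn.
  have N0 : 0 < n.+1%:R :> R by [].
  exists (fun x => Num.max 0 (Num.min 1 (n.+1%:R * (x - a)))).
    split.
      move=> x; rewrite le_max lexx/= ge_max ler01/= ge_min lexx//.
    exists n.+1%:R => // x y; set N := n.+1%:R in N0 *.
    have -> : N * `|x - y| = `|N * (x - a) - N * (y - a)|.
      by rewrite -mulrBr normrM (gtr0_norm N0); congr (_ * `|_|); ring.
    exact: le_trans (ler_dist_max _ _ _) (ler_dist_min _ _ _).
  apply: (@le_trans _ _ (\int[lam]_x (\1_(B n) x))).
    apply: le_Rintegral => //.
    + apply: unit_measurable_integrable; first exact: unit_measurable_indic.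
      split.
        apply: measurable_maxr => //; apply: measurable_minr => //.
        apply: measurable_funM => //; exact: measurable_funB.
      by move=> x; rewrite le_max lexx/= ge_max ler01/= ge_min lexx//.
    + exact: integrable_indic.
    move=> x _; rewrite !indicE; pose A : set R := `]a, +oo[%classic.
    rewrite -/A.
    have Am : (x \in A) = (a < x) by apply/idP/idP; rewrite inE /A/= in_itv/= andbT.
    have Bm : (x \in B n) = (a < x < a + n.+1%:R^-1).
      by apply/idP/idP; rewrite inE /B/= in_itv.
    rewrite Am Bm.
    have [xa|ax] := leP x a; rewrite /=.
      rewrite min_r; last by nra.
      by rewrite max_l ?subrr ?normr0//; nra.
    case: ltP => h /=.
      rewrite ler_norml /Num.max /Num.min.
      have : 0 < n.+1%:R * (x - a) by rewrite mulr_gt0// subr_gt0.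
      set u := _ * (x - a) => u0; case: (ltP 1 u) => /= ?; case: ltP => /= ?;
      by apply/andP; split; lra.
    have : 1 <= n.+1%:R * (x - a).
      by rewrite -ler_pdivrMl// mulr1 lerBrDl.
    move=> h'; rewrite min_l// max_r ?ler01// subrr normr0//.
  by rewrite Rintegral_indic// -lee_fin fineK ?fin_num_measure// ltW.
- move=> S mS [_ aS]; split.
    by apply: unit_measurable_indic; exact: measurableC.
  move=> t /aS[q [q01 [L L0 qL]] Sq].
  exists (fun x => 1 - q x).
    split; first by move=> x; have := q01 x; lra.
    exists L => // x y; apply: le_trans _ (qL x y).
    by rewrite distrC (_ : _ - _ = q x - q y)//; ring.
  apply: le_trans Sq; rewrite le_eqVlt; apply/orP; left; apply/eqP.
  apply: eq_Rintegral => x _; rewrite !indicE in_setC.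
  by rewrite distrC; case: (x \in S) => /=; congr (`|_|); ring.
- move=> F mF tF aF.
  have mU N : measurable (\big[setU/set0]_(k < N) F k).
    by apply: bigsetU_measurable.
  have aU N : lipschitz_approx \1_(\big[setU/set0]_(k < N) F k).
    elim: N => [|N IH].
      rewrite big_ord0; split; first exact: unit_measurable_indic.
      move=> t t0; exists (cst 0).
        split; first by move=> x; rewrite /= ler01 lexx.
        by exists 0 => // x y; rewrite subrr normr0 mul0r.
      rewrite (_ : (fun x => _) = cst 0) ?Rintegral_cst ?mul0r ?ltW//.
      by apply/funext => x; rewrite indic0 /= subrr normr0.
    have := lipschitz_approx_add IH (aF N).
    rewrite big_ord_recr/=; congr lipschitz_approx; apply/funext => x.
    rewrite !indicE in_setU; case: (_ \in _); case: (_ \in _) => /=;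
      rewrite ?addr0 ?add0r ?minxx//.
      by rewrite min_l//; lra.
    by rewrite min_r//; lra.
  have mFU : measurable (\bigcup_k F k) by exact: bigcupT_measurable.
  apply: lipschitz_approx_limit; first exact: unit_measurable_indic.
  move=> t t0.
  have [||||N hN] := @probability_exhaust _ _ _ lam
    (fun N => \big[setU/set0]_(k < N) F k `|` ~` \bigcup_k F k) t.
  + by move=> N; apply: measurableU => //; exact: measurableC.
  + by move=> N x; rewrite big_ord_recr/= => -[]; [left; left|right].
  + apply: aeW => x; have [[k _ Fk]|nF] := pselect ((\bigcup_k F k) x).
      by exists k.+1; left; rewrite big_ord_recr/=; right.
    by exists 0%N; right.
  + exact: t0.
  exists \1_(\big[setU/set0]_(k < N) F k) => //.
  rewrite (_ : \int[lam]_x _ = \int[lam]_x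
    (\1_(~` (\big[setU/set0]_(k < N) F k `|` ~` \bigcup_k F k)) x)).
    rewrite Rintegral_indic.
      rewrite -lee_fin fineK ?ltW// fin_num_measure//.
      by apply: measurableC; apply: measurableU => //; exact: measurableC.
    by apply: measurableC; apply: measurableU => //; exact: measurableC.
  apply: eq_Rintegral => x _; rewrite !indicE setCU setCK in_setI in_setC.
  have [xU|xU] := boolP (x \in \big[setU/set0]_(k < N) F k) => /=.
    have -> : x \in \bigcup_k F k.
      rewrite inE; move: xU; rewrite inE -bigcup_mkord => -[k _ ?].
      by exists k.
    by rewrite subrr normr0.
  by rewrite subr0 ger0_norm//; case: (_ \in _).
Qed.

(** Binary expansion: with [A] the set where [f] is at least one half, [f] is the mean of [\1_A] and
    of [2 * f - \1_A], which again has values in the unit interval. Each digit halves the uniform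
    error. *)
Lemma lipschitz_approx_unit_measurable f : unit_measurable f -> lipschitz_approx f.
Proof.
move=> uf; apply: lipschitz_approx_limit => // t t0.
suff H n : forall f, unit_measurable f ->
    exists2 h, lipschitz_approx h & forall x, `|f x - h x| <= 2^-1 ^+ n.
  have [n nt] : exists n, (2^-1 : R) ^+ n <= t.
    have : (2^-1 : R) ^+ n @[n --> \oo] --> 0 by apply: cvg_expr; rewrite ger0_norm; lra.
    move=> /cvgr_le/(_ t t0)[n _ /(_ n (leqnn n))] ?; by exists n.
  have [h ah fh] := H n f uf; exists h => //.
  apply: (@le_trans _ _ (\int[lam]_x 2^-1 ^+ n)).
    apply: le_Rintegral => //.
    - by apply: unit_measurable_integrable => //; case: ah.
    - by apply: (@bounded_integrable _ _ _ _ _ (`|2^-1 ^+ n|)).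
  rewrite Rintegral_cst// (_ : fine _ = 1) ?mulr1//.
  by have /(congr1 fine) := @probability_setT _ _ _ lam.
elim: n => [|n IH] {uf}{}f [mf f01].
  exists \1_set0; first exact: lipschitz_approx_indic.
  by move=> x; rewrite indic0 subr0 expr0 ger0_norm; have := f01 x; lra.
pose A := [set x | 2^-1 <= f x].
have mA : measurable A.
  by rewrite -[A]setTI; apply: measurable_fun_ler.
have [|h ah fh] := IH (fun x => 2 * f x - \1_A x).
  split.
    apply: measurable_funB; last exact: measurable_indic.
    exact: measurable_funM.
  move=> x; rewrite indicE; have := f01 x.
  have [|] := boolP (x \in A); rewrite ?inE ?notin_setE /A/=; first lra.
  by move=> /negP; rewrite -ltNge; lra.
exists (fun x => (\1_A x + h x) / 2).
  by apply: lipschitz_approx_half => //; exact: lipschitz_approx_indic.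
move=> x; have := fh x.
rewrite (_ : _ - (_ + _) / 2 = 2^-1 * (2 * f x - \1_A x - h x)); last by field.
rewrite normrM (gtr0_norm (_ : 0 < 2^-1)); last lra.
by rewrite exprS ler_pM2l//; lra.
Qed.

End lipschitz_approximation.

Lemma measurable_ifs (R : realType) (b : R) (i : bool) :
  measurable_fun setT (ifs b i).
Proof.
rewrite /ifs; case: i => /=.
  by apply: measurable_funD => //; exact: measurable_funM.
by apply: measurable_funB => //; exact: measurable_funM.
Qed.

(** Its law under the Bernoulli measure is the conditional law of the coding given that the first
    letter is [i]. *)
Definition coding_ifs (R : realType) (b : R) (i : bool) (w : shift_space) : R :=
  ifs b i (coding b w).

Lemma measurable_coding_ifs (R : realType) (b : R) (i : bool) :
  measurable_fun setT (coding_ifs b i).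
Proof.
exact: (measurableT_comp (@measurable_ifs _ b i) (@measurable_coding _ b)).
Qed.

HB.instance Definition _ (R : realType) (b : R) (i : bool) :=
  isMeasurableFun.Build _ _ _ _ (coding_ifs b i) (@measurable_coding_ifs R b i).

(* For the conditional probability [g] of the first letter being [false]. *)
Definition letter_prob (R : realType) (g : R -> R) (i : bool) (x : R) : R :=
  if i then 1 - g x else g x.

(** * Exact dimensionality of Bernoulli convolutions *)

Section letter_density.
Context {R : realType} (b p : R) (mu : probability shift_space R).
Hypotheses (b01 : 0 < b < 1) (p01 : 0 < p < 1).
Hypothesis mup : is_bernoulli_measure p mu.

Local Notation muX := (bernoulli_convolution b mu).
Local Notation muI i := (distribution mu (coding_ifs b i)).

Lemma letter_weight_gt0 i : 0 < letter_weight p i.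
Proof. by case/andP: p01 => ? ?; case: i; rewrite /letter_weight ?subr_gt0. Qed.

Lemma bernoulli_first_letter (i : bool) (B : set shift_space) : measurable B ->
  mu [set w | w 0%N = i /\ B (shiftn 1 w)] = ((letter_weight p i)%:E * mu B)%E.
Proof.
move=> mB; have := @bernoulli_shift _ _ _ mup 1 [set [:: i]] B mB.
rewrite /= !indicE (_ : p * _ + _ = letter_weight p i).
  move=> <-; congr (mu _); apply/seteqP; split => w /=.
    by move=> [<- ?].
  by move=> [[<-] ?].
have e j : ([:: j] \in [set [:: i]]) = (i == j).
  by apply/idP/eqP; rewrite inE /=; [case|move=> ->].
by rewrite !e; case: i {e} => /=; rewrite ?mulr0 ?mulr1 ?add0r ?addr0.
Qed.

Lemma coding_first w : coding b w = ifs b (w 0%N) (coding b (shiftn 1 w)).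
Proof.
rewrite (codingE b01 w 1) /= !ifsE mulr0 addr0 expr1.
by case: (w 0%N).
Qed.

Lemma first_letter_distribution (i : bool) (A : set R) : measurable A ->
  mu [set w | w 0%N = i /\ A (coding b w)] =
  ((letter_weight p i)%:E * muI i A)%E.
Proof.
move=> mA; rewrite -[muI i A]/(mu (coding_ifs b i @^-1` A)).
rewrite -bernoulli_first_letter.
  congr (mu _); apply/seteqP; split => w /=; rewrite coding_first /coding_ifs.
    by move=> [<- ?].
  by move=> [<- ?].
by rewrite -[X in measurable X]setTI; exact: measurable_coding_ifs.
Qed.

Lemma bernoulli_convolution_split (A : set R) : measurable A ->
  muX A = (p%:E * muI false A + (1 - p)%:E * muI true A)%E.
Proof.
move=> mA.
have mi i : measurable ([set w | w 0%N = i /\ A (coding b w)] : set shift_space).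
  apply: measurableI.
    rewrite [X in measurable X](_ : _ = [set w | [set [:: i]] (mkseq w 1)]).
      exact: measurable_mkseq.
    by apply/seteqP; split => w /=; rewrite /mkseq/=; [move=> -> | case].
  by rewrite -[X in measurable X]setTI; exact: measurable_coding.
rewrite -(first_letter_distribution false mA) -(first_letter_distribution true mA).
transitivity (mu ([set w | w 0%N = false /\ A (coding b w)] `|`
    [set w | w 0%N = true /\ A (coding b w)])).
  congr (mu _); apply/seteqP; split => w /=.
    by move=> Aw; case: (w 0%N); [right|left].
  by move=> [[]|[]].
rewrite measureU; [by []|exact: mi|exact: mi|].
by rewrite -subset0 => w [/= [-> _] []].
Qed.

Lemma Rintegral_coding_ifs i (F : R -> R) : unit_measurable F ->
  (\int[muI i]_x (F x)%:E)%E = (\int[muX]_x (F (ifs b i x)))%:E.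
Proof.
move=> [mF F01].
have mE : measurable_fun setT (EFin \o F) by exact/measurable_EFinP.
have F0 x : (0 <= (F x)%:E)%E by rewrite lee_fin; case/andP: (F01 x).
have mFi : measurable_fun setT (F \o ifs b i).
  exact: (measurableT_comp mF (@measurable_ifs _ b i)).
rewrite (@ge0_integral_distribution _ _ _ _ _ mu (coding_ifs b i) _ mE F0).
rewrite /Rintegral fineK.
  have H := @ge0_integral_distribution _ _ _ _ _ mu (coding b)
    (EFin \o (F \o ifs b i)).
  apply: esym; apply: H; first exact/measurable_EFinP.
  by move=> y; exact: F0.
apply: integrable_fin_num => //.
apply: (@bounded_integrable _ _ _ muX (F \o ifs b i) 1 mFi) => x.
by rewrite ger0_norm; have := F01 (ifs b i x) => /andP[].
Qed.

Lemma Rintegral_unit_measurable (lam : probability R R) (F : R -> R) :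
  unit_measurable F -> (\int[lam]_x (F x)%:E)%E = (\int[lam]_x F x)%:E.
Proof.
move=> [mF F01]; rewrite /Rintegral fineK//.
apply: integrable_fin_num => //.
by apply: (@bounded_integrable _ _ _ _ _ 1) => // x; rewrite ger0_norm;
  have := F01 x => /andP[].
Qed.

Lemma Rintegral_split (F : R -> R) : unit_measurable F ->
  \int[muX]_x F x = p * \int[muX]_x F (ifs b false x) +
                    (1 - p) * \int[muX]_x F (ifs b true x).
Proof.
move=> uF; have [mF F01] := uF.
apply: EFin_inj; rewrite EFinD !EFinM -!Rintegral_coding_ifs//.
rewrite -(Rintegral_unit_measurable muX uF).
have [p0 p1] : 0 <= p /\ 0 <= 1 - p by have := p01; split; lra.
have mE : measurable_fun setT (EFin \o F) by exact/measurable_EFinP.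
have F0 x : setT x -> (0 <= (F x)%:E)%E by rewrite lee_fin; case/andP: (F01 x).
have := @ge0_integral_mscale _ _ _ (muI false) setT measurableT (NngNum p0) _ mE F0.
have := @ge0_integral_mscale _ _ _ (muI true) setT measurableT (NngNum p1) _ mE F0.
move=> /= <- <-; rewrite -ge0_integral_measure_add//.
apply: eq_measure_integral => A mA _.
rewrite [LHS](bernoulli_convolution_split mA).
by rewrite /= /msum !big_ord_recl big_ord0 adde0.
Qed.

(** By self-similarity [p] times the conditional law given the letter [false] is at most [muX]. So
    [p] times its Radon-Nikodym derivative exists and is at most 1 almost everywhere; truncation
    makes this hold everywhere. *)
Lemma letter_density_exists : exists2 g, unit_measurable g &
  forall i F, unit_measurable F ->
    \int[muX]_x (F x * letter_prob g i x) =
    letter_weight p i * \int[muX]_x F (ifs b i x).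
Proof.
have [p0 p1] := andP p01.
have dom : muI false `<< muX.
  apply/null_content_dominatesP => A mA.
  move=> muA0; have : muX A = 0%E by exact: muA0.
  rewrite (bernoulli_convolution_split mA) => /eqP.
  rewrite padde_eq0; last 2 first.
  - by rewrite mule_ge0// lee_fin ltW.
  - by rewrite mule_ge0// lee_fin subr_ge0 ltW.
  by move=> /andP[+ _]; rewrite mule_eq0 eqe gt_eqF//= => /eqP.
pose h := Radon_Nikodym_SigmaFinite.f (muI false) muX.
have h0 x : (0 <= h x)%E by exact: Radon_Nikodym_SigmaFinite.f_ge0.
have hfin x : h x \is a fin_num by exact: Radon_Nikodym_SigmaFinite.f_fin_num.
have hint := Radon_Nikodym_SigmaFinite.f_integrable dom.
have mh : measurable_fun setT h by exact: measurable_int hint.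
pose k x := p * fine (h x).
have mk : measurable_fun setT k.
  by apply: measurable_funM => //; exact: measurableT_comp.
have k0 x : 0 <= k x by rewrite mulr_ge0 ?fine_ge0// ltW.
(* The integral of [k] over [E n] is at least [1 + n.+1%:R^-1] times the mass of [E n], yet equals
   [p * muI false (E n)], which is at most that mass. So [E n] is null, and the union over [n] is
   the set where [k] exceeds 1. *)
pose E n := [set x | 1 + n.+1%:R^-1 <= k x].
have mE n : measurable (E n).
  by rewrite -[E n]setTI; apply: measurable_fun_ler.
have E0 n : muX (E n) = 0%E.
  have h1 : (p%:E * muI false (E n) <= muX (E n))%E.
    rewrite [leRHS](bernoulli_convolution_split (mE n)) leeDl// mule_ge0// lee_fin; lra.
  have h2 : ((1 + n.+1%:R^-1)%:E * muX (E n) <= p%:E * muI false (E n))%E.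
    rewrite (Radon_Nikodym_SigmaFinite.f_integral dom (mE n)).
    rewrite -ge0_integralZl//; last 2 first.
    - exact: measurable_funTS.
    - by rewrite lee_fin ltW.
    rewrite -integral_cst//; apply: ge0_le_integral => //.
    - by move=> x _; rewrite lee_fin addr_ge0.
    - by apply: measurable_funeM; exact: measurable_funTS.
    - move=> x Ex; rewrite -[leRHS]/(p%:E * h x)%E -(fineK (hfin x)) -EFinM.
      by rewrite lee_fin; exact: Ex.
  have := le_trans h2 h1.
  have : muX (E n) \is a fin_num by rewrite fin_num_measure.
  have : (0 <= muX (E n))%E by [].
  case: (muX (E n)) => // r; rewrite lee_fin => r0 _.
  rewrite -EFinM lee_fin => hr; congr EFin; apply/eqP; rewrite eq_le r0 andbT.
  have : 0 < n.+1%:R^-1 :> R by rewrite invr_gt0.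
  by move: hr; set u := _^-1; nra.
have aek : {ae muX, forall x, k x <= 1}.
  exists (\bigcup_n E n); split.
  - exact: bigcupT_measurable.
  - apply: measure_negligible; first exact: bigcupT_measurable.
    by apply: negligible_bigcup => n; exists (E n); split => //; exact: E0.
  - move=> x /= /negP; rewrite -ltNge => k1; exists (Num.bound (k x - 1)^-1) => //.
    rewrite /E/= -lerBrDl -[leRHS]invrK lef_pV2 ?posrE ?invr_gt0 ?subr_gt0//.
    rewrite ltW// (lt_trans (archi_boundP _))// ?ltr_nat//.
    by rewrite invr_ge0 subr_ge0 ltW.
pose g x := Num.min 1 (k x).
have ug : unit_measurable g.
  split; first exact: measurable_minr.
  by move=> x; rewrite le_min ge_min lexx ler01 k0.
have mulu (F F' : R -> R) : unit_measurable F -> unit_measurable F' ->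
    unit_measurable (fun x => F x * F' x).
  move=> [mF F01] [mF' F'01]; split; first exact: measurable_funM.
  by move=> x; have := F01 x; have := F'01 x; nra.
have Hf F : unit_measurable F ->
    \int[muX]_x (F x * g x) = p * \int[muX]_x F (ifs b false x).
  move=> uF; have [mF F01] := uF.
  apply: EFin_inj; rewrite EFinM -Rintegral_coding_ifs//.
  rewrite -Rintegral_unit_measurable; last exact: mulu.
  have H : (\int[muX]_x ((F x)%:E * h x))%E = (\int[muI false]_x (F x)%:E)%E.
    apply: (Radon_Nikodym_SigmaFinite.change_of_variables dom) => //.
    - by move=> x; rewrite lee_fin; have := F01 x => /andP[].
    - exact/measurable_EFinP.
  rewrite -H.
  rewrite -ge0_integralZl//; last 3 first.
  - by apply: emeasurable_funM => //; exact/measurable_EFinP.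
  - by move=> x _; rewrite mule_ge0// lee_fin; have := F01 x => /andP[].
  - by rewrite lee_fin ltW.
  apply: ae_eq_integral => //.
  - by apply/measurable_EFinP; apply: measurable_funM => //; case: ug.
  - apply: measurable_funeM; apply: emeasurable_funM => //; exact/measurable_EFinP.
  apply: ae_imply aek => x kx _; rewrite /g min_r// /k -/h.
  by rewrite -[h x in RHS]fineK//= -!EFinM; congr EFin; ring.
exists g => // -[|] F uF /=; last exact: Hf.
have [mF F01] := uF.
have -> : \int[muX]_x (F x * (1 - g x)) =
    \int[muX]_x F x - \int[muX]_x (F x * g x).
  rewrite -RintegralB//.
  - by apply: eq_Rintegral => x _; ring.
  - apply: (@bounded_integrable _ _ _ _ _ 1) => // x.
    by rewrite ger0_norm; have := F01 x => /andP[].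
  - have [mFg Fg01] := mulu _ _ uF ug.
    apply: (@bounded_integrable _ _ _ _ _ 1) => // x.
    by rewrite ger0_norm; have := Fg01 x => /andP[].
by rewrite Hf// Rintegral_split//; ring.
Qed.

End letter_density.

(** * Events indexed by words and conditional word probabilities *)

Lemma mkseqSl (w : shift_space) n :
  mkseq w n.+1 = w 0%N :: mkseq (shiftn 1 w) n.
Proof. by rewrite -[n.+1]add1n mkseq_addn. Qed.

Section word_cover.
Context {R : realType} (p : R) (mu : probability shift_space R).
Hypotheses (p01 : 0 < p < 1) (mup : is_bernoulli_measure p mu).

Lemma measurable_word_family n (B : seq bool -> set shift_space) :
  (forall u, measurable (B u)) ->
  measurable ([set w | B (mkseq w n) w] : set shift_space).
Proof.
move=> mB.
rewrite (_ : [set w | _] = \bigcup_u (cylinder u `&` [set w | size u = n] `&` B u)).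
  apply: countable_bigcupT_measurable => [|u]; first exact: countableP.
  apply: measurableI => //; apply: measurableI; first exact: measurable_cylinder.
  have [->|un] := eqVneq (size u) n.
    by rewrite (_ : [set _ | _] = setT)//; apply/seteqP.
  rewrite (_ : [set _ | _] = set0)// -subset0 => w /= /eqP.
  by rewrite (negbTE un).
apply/seteqP; split => w /=.
  move=> Bw; exists (mkseq w n) => //; split => //=.
  by rewrite /cylinder/= size_mkseq.
by move=> [u _ [[/= + <-] Bu]]; rewrite /cylinder/= => ->.
Qed.

(** The weights of the words of length [n] add up to 1. The induction recovers this by merging the
    two extensions of a prefix. *)
Lemma word_family_bound n (B : seq bool -> set shift_space) (c : R) :
  (forall u, measurable (B u)) ->
  (forall u, size u = n -> fine (mu (cylinder u `&` B u)) <=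
    c * \prod_(i <- u) letter_weight p i) ->
  fine (mu [set w | B (mkseq w n) w]) <= c.
Proof.
move=> mB HB.
have mpre s m : measurable ([set w | cylinder s w /\ B (mkseq w m) w] :
    set shift_space).
  apply: measurableI; first exact: measurable_cylinder.
  exact: measurable_word_family.
suff H m s : (size s + m)%N = n ->
    fine (mu [set w | cylinder s w /\ B (mkseq w n) w]) <=
    c * \prod_(i <- s) letter_weight p i.
  have := H n [::] erefl; rewrite big_nil mulr1; apply: le_trans.
  apply: le_fine_measure => //; first exact: measurable_word_family.
elim: m s => [|m IH] s.
  rewrite addn0 => sn; apply: le_trans (HB s sn).
  apply: le_fine_measure => //.
    by apply: measurableI => //; exact: measurable_cylinder.
  by move=> w [/= cw]; rewrite -sn cw.
move=> sn.
have smn i : (size (rcons s i) + m)%N = n by rewrite size_rcons -sn addSn addnS.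
have := IH _ (smn false); have := IH _ (smn true).
rewrite !big_rcons/= => h1 h2.
apply: (@le_trans _ _ (fine (mu [set w | cylinder (rcons s false) w /\ B (mkseq w n) w])
  + fine (mu [set w | cylinder (rcons s true) w /\ B (mkseq w n) w]))).
  rewrite -fineD ?fin_num_measure//.
  apply: fine_le; rewrite ?fin_numD ?fin_num_measure//.
  apply: le_trans (measureU2 _ (mpre _ _) (mpre _ _)).
  apply: le_measure; rewrite ?inE//; first exact: measurableU.
  move=> w [cw Bw]; rewrite /cylinder/= in cw.
  by case: (w (size s)) (mkseqS w (size s)) => e; [right|left]; split => //;
    rewrite /cylinder/= size_rcons e cw.
move: h1 h2; set W := \prod_(_ <- _) _; set m1 := fine _; set m2 := fine _; lra.
Qed.

End word_cover.

Section chain.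
Context {R : realType} (b : R).
Hypothesis b01 : 0 < b < 1.
Implicit Types (h : bool -> R -> R).

(** When [h] gives the conditional letter probabilities, this is the conditional probability of the
    prefix [u] given the value [x]; every step applies the inverse of one map of the system. *)
Fixpoint chain h (u : seq bool) (x : R) : R :=
  if u is i :: u' then h i x * chain h u' ((x - (if i then 1 else -1)) / b)
  else 1.

Lemma ifsK i x : (ifs b i x - (if i then 1 else -1)) / b = x.
Proof.
have [b0 _] := andP b01.
by rewrite ifsE addrC addKr mulrC mulKf// gt_eqF.
Qed.

Lemma chain_path h (w : shift_space) n : chain h (mkseq w n) (coding b w) =
  \prod_(k < n) h (w k) (coding b (shiftn k w)).
Proof.
elim: n w => [|n IH] w; first by rewrite big_ord0.
rewrite mkseqSl big_ord_recl /= shiftn0; congr (_ * _).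
rewrite {1}(coding_first b01 w) ifsK IH; apply: eq_bigr => k _.
by rewrite shiftnD.
Qed.

Lemma unit_measurable_letter_prob (g : R -> R) i : unit_measurable g ->
  unit_measurable (letter_prob g i).
Proof.
move=> [mg g01]; rewrite /letter_prob; case: i; split => //.
  exact: measurable_funB.
by move=> x; have := g01 x; lra.
Qed.

Lemma unit_measurableM (F F' : R -> R) : unit_measurable F ->
  unit_measurable F' -> unit_measurable (fun x => F x * F' x).
Proof.
move=> [mF F01] [mF' F'01]; split; first exact: measurable_funM.
by move=> x; have := F01 x; have := F'01 x; nra.
Qed.

Lemma unit_measurable_affine (F : R -> R) (c d : R) : unit_measurable F ->
  unit_measurable (fun x => F ((x - c) / d)).
Proof.
move=> [mF F01]; split => //; apply: (measurableT_comp mF).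
by apply: measurable_funM => //; exact: measurable_funB.
Qed.

Lemma unit_measurable_chain h u : (forall i, unit_measurable (h i)) ->
  unit_measurable (chain h u).
Proof.
move=> uh; elim: u => [|i u IH] /=.
  by split => // x; rewrite ler01 lexx.
by apply: unit_measurableM => //; exact: unit_measurable_affine.
Qed.

Lemma chain_gt0 h u x : (forall i x, 0 < h i x) -> 0 < chain h u x.
Proof. by move=> h0; elim: u x => //= i u IH x; rewrite mulr_gt0. Qed.

End chain.

(** * Local dimension of a Bernoulli convolution through entropy *)

Section bernoulli_dimension.
Context {R : realType} (b p : R) (mu : probability shift_space R).
Hypotheses (b01 : 0 < b < 1) (p01 : 0 < p < 1).
Hypothesis mup : is_bernoulli_measure p mu.

Local Notation muX := (bernoulli_convolution b mu).
Local Notation weight u := (\prod_(i <- u) letter_weight p i).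
Local Notation partial u := (foldr (ifs b) 0 u).

Lemma weight_gt0 u : 0 < weight u.
Proof.
elim: u => [|i u IH]; first by rewrite big_nil.
by rewrite big_cons mulr_gt0// letter_weight_gt0.
Qed.

Lemma weight_path (w : shift_space) n :
  weight (mkseq w n) = \prod_(k < n) letter_weight p (w k).
Proof.
elim: n => [|n IH]; first by rewrite big_nil big_ord0.
by rewrite mkseqS big_rcons/= IH big_ord_recr.
Qed.

Lemma ae_bernoulli_convolution (F : (set R)^nat) :
  (forall n, measurable (F n)) ->
  {ae mu, forall w, exists N, forall n, (N <= n)%N -> ~ F n (coding b w)} ->
  {ae muX, forall x, exists N, forall n, (N <= n)%N -> ~ F n x}.
Proof.
move=> mF aeF.
have mL : measurable (lim_sup_set F).
  by apply: bigcapT_measurable => n; apply: bigcup_measurable.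
have mX (A : set R) : measurable A -> measurable (coding b @^-1` A).
  by move=> mA; rewrite -[X in measurable X]setTI; exact: measurable_coding.
exists (lim_sup_set F); split => //.
- apply: (@measure_negligible _ _ _ mu (coding b @^-1` (lim_sup_set F))).
    exact: mX.
  apply: negligibleS aeF => w /= Lw [N hN].
  by have [n /= /hN h /h] := Lw N Logic.I.
- move=> z /= h n _; apply: contrapT => hn; apply: h.
  by exists n => k nk Fk; apply: hn; exists k.
Qed.

Lemma coding_in_ball (w : shift_space) n u : mkseq w n = u ->
  closed_ball_ Num.norm (partial u) ((1 - b)^-1 * b ^+ n) (coding b w).
Proof.
by move=> <-; rewrite /closed_ball_/= distrC mulrC; exact: coding_partial.
Qed.

(** The floor [t] keeps the logarithm bounded, as [birkhoff_upper] requires. *)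
Definition letter_potential (g : R -> R) (t : R) (w : shift_space) : R :=
  ln (Num.max (letter_prob g (w 0%N) (coding b w)) t) -
  ln (letter_weight p (w 0%N)).

Lemma sum_letter_potential g t (w : shift_space) n : 0 < t ->
  expR (\sum_(k < n) letter_potential g t (shiftn k w)) =
  chain b (fun i x => Num.max (letter_prob g i x) t) (mkseq w n) (coding b w) /
  weight (mkseq w n).
Proof.
move=> t0; rewrite chain_path// weight_path -prodf_div.
rewrite expR_sum; apply: eq_bigr => k _.
rewrite /letter_potential expRB !lnK ?posrE ?letter_weight_gt0//.
  by rewrite /shiftn addn0.
by rewrite lt_max t0 orbT.
Qed.

Lemma measurable_letter : measurable_fun setT (fun w : shift_space => w 0%N).
Proof.
move=> _ B mB; rewrite setTI.
rewrite (_ : _ @^-1` _ = [set w | [set s | B (nth false s 0)] (mkseq w 1)]).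
  exact: measurable_mkseq.
by [].
Qed.

Lemma measurable_letter_potential g t : unit_measurable g -> 0 < t ->
  measurable_fun setT (letter_potential g t).
Proof.
move=> ug t0.
have mi i : measurable_fun setT (fun w : shift_space =>
    ln (Num.max (letter_prob g i (coding b w)) t) - ln (letter_weight p i)).
  apply: measurable_funB => //.
  apply: (measurableT_comp (@measurable_ln R)).
  apply: measurable_maxr => //.
  have [mg _] := unit_measurable_letter_prob i ug.
  exact: (measurableT_comp mg (@measurable_coding _ b)).
have := measurable_fun_ifT measurable_letter (mi true) (mi false).
by apply: eq_measurable_fun => w _; rewrite /letter_potential; case: (w 0%N).
Qed.

Lemma letter_potential_bounded g t : unit_measurable g -> 0 < t < 1 ->
  exists M, forall w, `|letter_potential g t w| <= M.
Proof.
move=> ug /andP[t0 t1].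
exists (- ln t + (`|ln p| + `|ln (1 - p)|)) => w.
apply: le_trans (ler_normB _ _) _; apply: lerD.
  have [_ /(_ (coding b w))] := unit_measurable_letter_prob (w 0%N) ug.
  set m := letter_prob _ _ _ => /andP[m0 m1].
  have M1 : Num.max m t <= 1 by rewrite ge_max m1 ltW.
  have M0 : 0 < Num.max m t by rewrite lt_max t0 orbT.
  rewrite ler0_norm ?ln_le0// lerN2 ler_ln ?posrE//.
  by rewrite le_max lexx orbT.
by rewrite /letter_weight; case: (w 0%N); rewrite ?lerDr ?lerDl.
Qed.

(** For the conditional probability [g] itself, the infimum over [t] is the mutual information of
    the first letter and the value. *)
Definition pressure g t : R := \int[mu]_w letter_potential g t w.

Section upper_bound.
Variable g : R -> R.
Hypothesis ug : unit_measurable g.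
Hypothesis gP : forall i F, unit_measurable F ->
  \int[muX]_x (F x * letter_prob g i x) =
  letter_weight p i * \int[muX]_x F (ifs b i x).

(** Independence of the first letter gives a factor [letter_weight p i], which [gP] trades for a
    factor [letter_prob g i] and one more inverse branch. *)
Lemma word_density u (A : set R) : measurable A ->
  fine (mu (cylinder u `&` coding b @^-1` A)) =
  \int[muX]_x (chain b (letter_prob g) u x * \1_A x).
Proof.
have uc u' : unit_measurable (chain b (letter_prob g) u').
  by apply: unit_measurable_chain => i; exact: unit_measurable_letter_prob.
have mX (A' : set R) : measurable A' -> measurable (coding b @^-1` A').
  by move=> mA; rewrite -[X in measurable X]setTI; exact: measurable_coding.
elim: u A => [|i u IH] A mA /=.
  rewrite (_ : cylinder _ `&` _ = coding b @^-1` A).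
    under eq_Rintegral do rewrite mul1r.
    by rewrite Rintegral_indic.
  by apply/seteqP; split => w /=; [case|split].
have mA' : measurable (ifs b i @^-1` A).
  by rewrite -[X in measurable X]setTI; exact: measurable_ifs.
rewrite (_ : cylinder _ `&` _ = [set w | w 0%N = i /\
    (cylinder u `&` coding b @^-1` (ifs b i @^-1` A)) (shiftn 1 w)]); last first.
  apply/seteqP; split => w /=; rewrite /cylinder/= mkseqSl (coding_first b01 w).
    by move=> [[-> ->] ?].
  by move=> [-> [-> ?]].
rewrite (bernoulli_first_letter mup); last first.
  by apply: measurableI; [exact: measurable_cylinder|exact: mX].
rewrite fineM ?fin_num_measure//=; last first.
  by apply: measurableI; [exact: measurable_cylinder|exact: mX].
rewrite IH//.
pose F x := chain b (letter_prob g) u ((x - (if i then 1 else -1)) / b) * \1_A x.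
have uF : unit_measurable F.
  apply: unit_measurableM; first exact: unit_measurable_affine.
  exact: unit_measurable_indic.
transitivity (letter_weight p i * \int[muX]_x F (ifs b i x)).
  congr (_ * _); apply: eq_Rintegral => x _.
  by rewrite /F ifsK.
rewrite -gP//; apply: eq_Rintegral => x _; rewrite /F; ring.
Qed.

(** Borel-Cantelli leaves [weight u <= chain * (m u * expR (n * e'))] for the prefixes [u] of almost
    every sequence, and Birkhoff bounds [chain / weight] from above. The floor [t] only increases
    the chain, which is harmless on this side. *)
Lemma ball_mass_lower_ae (t e : R) : 0 < t < 1 -> 0 < e ->
  {ae mu, forall w, exists N, forall n, (N <= n)%N ->
    expR (- (n%:R * (pressure g t + e))) <=
    ball_mass muX (coding b w) (2 * (1 - b)^-1 * b ^+ n)}.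
Proof.
move=> t01 e0; have [t0 t1] := andP t01; have [b0 b1] := andP b01.
pose c := (1 - b)^-1.
have c0 : 0 < c by rewrite invr_gt0; lra.
pose e' := e / 4.
have e'0 : 0 < e' by rewrite /e'; lra.
pose m u := ball_mass muX (partial u) (c * b ^+ size u).
(* Values at which the conditional probability of [u] is too small compared with [weight u / m u].
   Integrated over the ball, this gives mass at most [expR (- (n * e'))] times the weight of [u]. *)
pose A u : set R := closed_ball_ Num.norm (partial u) (c * b ^+ size u) `&`
  [set x | chain b (letter_prob g) u x * (m u * expR ((size u)%:R * e')) < weight u].
have uc u' : unit_measurable (chain b (letter_prob g) u').
  by apply: unit_measurable_chain => i; exact: unit_measurable_letter_prob.
have mA u : measurable (A u).
  apply: measurableI; first exact: measurable_closed_ball_.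
  rewrite -[X in measurable X]setTI; apply: measurable_fun_ltr => //.
  by apply: measurable_funM => //; case: (uc u).
have mX (A' : set R) : measurable A' -> measurable (coding b @^-1` A').
  by move=> mA'; rewrite -[X in measurable X]setTI; exact: measurable_coding.
pose F n : set shift_space := [set w | (coding b @^-1` A (mkseq w n)) w].
have mF n : measurable (F n).
  by apply: (@measurable_word_family n (fun u => coding b @^-1` A u)) => u; exact: mX.
have bcF : {ae mu, forall w, exists N, forall n, (N <= n)%N -> ~ F n w}.
  apply: (@borel_cantelli_geometric _ _ _ _ _ 1 (expR (- e'))) => //.
    by rewrite expR_ge0 expR_lt1; lra.
  exists 0%N => n _; rewrite mul1r -expRM_natl.
  apply: (@word_family_bound _ p mu n (fun u => coding b @^-1` A u)) => u.
    exact: mX.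
  move=> un; rewrite word_density//.
  have iAu : muX.-integrable setT (EFin \o (fun x => chain b (letter_prob g) u x * \1_(A u) x)).
    have [mf f01] := unit_measurableM (uc u) (unit_measurable_indic (mA u)).
    apply: (@bounded_integrable _ _ _ _ _ 1) => // x.
    by rewrite ger0_norm; have := f01 x => /andP[].
  have mJ : measurable (closed_ball_ Num.norm (partial u) (c * b ^+ size u) : set R).
    exact: measurable_closed_ball_.
  (* For a ball of mass zero the inequality defining [A u] always holds; the integral is then
     bounded by the mass of the ball instead. *)
  have [m0|m0] := eqVneq (m u) 0.
    apply: (@le_trans _ _ (m u)); last first.
      by rewrite m0 mulr_ge0 ?expR_ge0// ltW// weight_gt0.
    rewrite /m /ball_mass -Rintegral_indic//; apply: le_Rintegral => //.
      exact: integrable_indic.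
    move=> x _; rewrite !indicE in_setI.
    have [_ /(_ x) /andP[]] := uc u.
    case: (x \in closed_ball_ _ _ _) => /=; last by rewrite mulr0.
    by case: (x \in [set _ | _]); rewrite ?mulr1 ?mulr0 ?ler01.
  have {}m0 : 0 < m u by rewrite lt_def m0 ball_mass_ge0.
  pose k := expR (n%:R * - e') * weight u / m u.
  apply: (@le_trans _ _ (k * m u)); last by rewrite /k divfK ?gt_eqF.
  have k0 : 0 <= k by rewrite /k divr_ge0 ?mulr_ge0 ?expR_ge0// ltW// weight_gt0.
  have imJ := integrable_indic muX mJ.
  rewrite [X in _ <= _ * X]/m /ball_mass -Rintegral_indic// -RintegralZl//.
  apply: le_Rintegral => //.
    by have := integrableZl measurableT k imJ.
  move=> x _; rewrite !indicE.
  case: (boolP (x \in A u)) => [|_]; last by rewrite mulr0 mulr_ge0.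
  rewrite inE => -[Jx /= hx]; rewrite mem_set// !mulr1.
  rewrite /k ler_pdivlMr// mulrN expRN mulrC.
  rewrite [leRHS]mulrC ler_pdivlMr ?expR_gt0// -mulrA mulrC.
  by move: hx; rewrite un mulrC => /ltW; rewrite !mulrA => h; lra.
have birk := @birkhoff_upper _ _ _ mup (letter_potential g t) (pressure g t + e')
  (measurable_letter_potential ug t0) (letter_potential_bounded ug t01)
  ltac:(rewrite ltrDl//).
apply: ae_imply (ae_and bcF birk) => w [[N hN] [K hK]].
pose M := Num.bound (`|K| / e').
exists (maxn N M) => n; rewrite geq_max => /andP[Nn Mn].
have Kn : `|K| < n%:R * e'.
  rewrite -ltr_pdivrMr//; apply: lt_le_trans (archi_boundP _) _.
    by rewrite divr_ge0// ltW.
  by rewrite ler_nat.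
set u := mkseq w n.
have un : size u = n by rewrite size_mkseq.
have Jw := @coding_in_ball w n u erefl.
have := hN n Nn; rewrite /F/= -/u => nA.
have h1 : weight u <= chain b (letter_prob g) u (coding b w) *
    (m u * expR (n%:R * e')).
  rewrite leNgt; apply/negP => h; apply: nA; split; first by rewrite un.
  by rewrite -un in h; exact: h.
have h2 : m u <= ball_mass muX (coding b w) (2 * c * b ^+ n).
  apply: le_fine_measure; [exact: measurable_closed_ball_..|].
  move=> y; rewrite /closed_ball_/= un => yJ.
  have -> : coding b w - y = (partial u - y) - (partial u - coding b w) by ring.
  apply: le_trans (ler_normB _ _) _.
  rewrite -mulrA [leRHS]mulr_natl mulr2n; apply: lerD => //.
apply: le_trans h2.
have W0 := weight_gt0 u.
have C0 : 0 < chain b (fun i x => Num.max (letter_prob g i x) t) u (coding b w).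
  by apply: chain_gt0 => i x; rewrite lt_max t0 orbT.
have h3 : chain b (letter_prob g) u (coding b w) <=
    chain b (fun i x => Num.max (letter_prob g i x) t) u (coding b w).
  elim: (u) (coding b w) => //= i v IH x.
  have [_ /(_ x) /andP[l0 _]] := unit_measurable_letter_prob i ug.
  apply: ler_pM => //; last by rewrite le_max lexx.
  by have [_ /(_ ((x - (if i then 1 else -1)) / b)) /andP[]] := uc v.
have h4 := @sum_letter_potential g t w n t0; rewrite -/u in h4.
have h5 : expR (\sum_(k < n) letter_potential g t (shiftn k w)) <=
    expR (n%:R * (pressure g t + e') + K) by rewrite ler_expR.
rewrite h4 ler_pdivrMr// in h5.
have m0 : 0 <= m u by exact: ball_mass_ge0.
have h6 : weight u <= expR (n%:R * (pressure g t + e') + K) * weight u *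
    (m u * expR (n%:R * e')).
  apply: le_trans h1 _; apply: ler_wpM2r; first by rewrite mulr_ge0 ?expR_ge0.
  exact: le_trans h3 h5.
have h7 : 1 <= expR (n%:R * (pressure g t + e') + K) *
    (m u * expR (n%:R * e')).
  by move: h6; rewrite mulrAC -{1}(mul1r (weight u)) ler_pM2r.
pose Y := n%:R * (pressure g t + e') + K + n%:R * e'.
have h8 : 1 <= m u * expR Y.
  by rewrite /Y [expR _]expRD; apply: le_trans h7 _; rewrite le_eqVlt;
    apply/orP; left; apply/eqP; ring.
apply: (@le_trans _ _ (expR (- Y))).
  rewrite ler_expR lerN2 /Y; have := ler_norm K.
  have e4 : n%:R * e = 4 * (n%:R * e') by rewrite /e'; field.
  have ne : 0 <= n%:R * e' by rewrite mulr_ge0// ltW.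
  by rewrite !mulrDr e4; lra.
by rewrite expRN -[leLHS]mul1r ler_pdivrMr ?expR_gt0.
Qed.

End upper_bound.

Section lower_bound.
Variables (q : R -> R) (t : R).
Hypotheses (lq : unit_lipschitz q) (t01 : 0 < t < 1).

Local Notation h := (fun i x => Num.max (letter_prob q i x) t).

Lemma clipped_gt0 i x : 0 < h i x.
Proof. by case/andP: t01 => t0 _; rewrite lt_max t0 orbT. Qed.

Lemma clipped_sum x : h false x + h true x <= 1 + 2 * t.
Proof.
have [t0 t1] := andP t01; have [/(_ x) /andP[q0 q1] _] := lq.
rewrite /letter_prob; have [|] := leP (q x) t; have [|] := leP (1 - q x) t; lra.
Qed.

(** Dividing by the weight turns the expectation into a plain sum over words. Each letter
    contributes [h false + h true], where the floor costs at most [2 * t]. *)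
Lemma wexp_chain_le n x :
  wexp p n (fun u => chain b h u x / weight u) <= expR (2 * t) ^+ n.
Proof.
have [p0 p1] := andP p01.
elim: n x => [|n IH] x; first by rewrite /= big_nil divr1 expr0.
rewrite [wexp _ _ _]/=.
have E i : letter_weight p i * wexp p n (fun s => h i x *
      chain b h s ((x - (if i then 1 else -1)) / b) / weight (i :: s)) =
    h i x * wexp p n (fun s =>
      chain b h s ((x - (if i then 1 else -1)) / b) / weight s).
  rewrite -!wexpZ; apply: eq_wexp => s _; rewrite big_cons.
  have := letter_weight_gt0 p01 i; have := weight_gt0 s.
  set W := weight s; set l := letter_weight p i => W0 l0.
  by field; rewrite !gt_eqF.
have := E false; rewrite /= => ->; have := E true; rewrite /= => ->.
apply: (@le_trans _ _ ((h false x + h true x) * expR (2 * t) ^+ n)).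
  rewrite [leRHS]mulrDl; apply: lerD; apply: ler_wpM2l => //.
    exact: ltW (clipped_gt0 false x).
  exact: ltW (clipped_gt0 true x).
rewrite exprS ler_wpM2r ?exprn_ge0 ?expR_ge0//.
exact: le_trans (clipped_sum x) (expR_ge1Dx _).
Qed.

(** Thanks to the floor the logarithm of each factor is [L / t]-Lipschitz. An inverse branch
    stretches distances by [b^-1], so the last letters dominate, and chains of length [n] are
    comparable at distance [b ^+ n]. *)
Lemma chain_lipschitz : exists2 C : R, 0 <= C & forall u x y,
  chain b h u x <= chain b h u y * expR (C * `|x - y| / b ^+ size u).
Proof.
have [b0 b1] := andP b01; have [t0 t1] := andP t01.
have [q01 [L L0 qL]] := lq.
have hL i x y : h i x <= h i y * expR (L / t * `|x - y|).
  have d : h i x <= h i y + L * `|x - y|.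
    apply: (@le_trans _ _ (h i y + `|h i x - h i y|)).
      by rewrite -lerBlDl ler_norm.
    rewrite lerD2l; apply: le_trans _ (qL x y).
    rewrite -[in leLHS](maxC t) -[X in _ - X](maxC t).
    apply: le_trans (ler_dist_max _ _ _) _.
    rewrite /letter_prob; case: i => //.
    by rewrite distrC (_ : _ - _ = q x - q y)//; ring.
  apply: le_trans d _.
  apply: (@le_trans _ _ (h i y * (1 + L / t * `|x - y|))); last first.
    by rewrite ler_pM2l ?clipped_gt0// expR_ge1Dx.
  rewrite mulrDr mulr1 lerD2l.
  have ht : t <= h i y by rewrite le_max lexx orbT.
  have : 0 <= L / t * `|x - y| by rewrite !mulr_ge0 ?invr_ge0// ltW.
  have -> : L * `|x - y| = t * (L / t * `|x - y|) by field; rewrite gt_eqF.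
  by set z := L / t * _ => z0; apply: ler_wpM2r.
(* [k * (b^-1 ^+ n - 1)] is the sum of the stretching factors [b^-1 ^+ j] for [j < n]. *)
pose k := b / (1 - b).
have k0 : 0 < k by rewrite divr_gt0//; lra.
have main u x y : chain b h u x <=
    chain b h u y * expR (L / t * `|x - y| * k * (b^-1 ^+ size u - 1)).
  elim: u x y => [|i u IH] x y; first by rewrite /= expr0 subrr mulr0 expR0 mulr1.
  rewrite [chain _ _ _ _]/= [X in X * expR _]/=.
  set x' := (x - _) / b; set y' := (y - _) / b.
  have xy' : `|x' - y'| = `|x - y| / b.
    rewrite /x' /y' -mulrBl normrM (gtr0_norm (_ : 0 < b^-1)) ?invr_gt0//.
    by congr (`|_| * _); ring.
  have -> : L / t * `|x - y| * k * (b^-1 ^+ size (i :: u) - 1) =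
     L / t * `|x - y| + L / t * `|x' - y'| * k * (b^-1 ^+ size u - 1).
    rewrite xy' /k /= exprS; field.
    by rewrite !gt_eqF//; lra.
  rewrite expRD mulrACA; apply: ler_pM => //.
  - exact/ltW/clipped_gt0.
  - by apply/ltW/chain_gt0 => // j z; exact: clipped_gt0.
have [k1 t2] := (ltW k0, ltW t0).
have Lt0 : 0 <= L / t by rewrite divr_ge0.
exists (L / t * k) => [|u x y]; first exact: mulr_ge0.
apply: le_trans (main u x y) _; rewrite ler_pM2l; last first.
  by apply: chain_gt0 => // j z; exact: clipped_gt0.
rewrite ler_expR -exprVn.
have : 0 <= L / t * `|x - y| * k by apply: mulr_ge0 => //; exact: mulr_ge0.
have -> : L / t * k * `|x - y| * b^-1 ^+ size u =
  L / t * `|x - y| * k * b^-1 ^+ size u by ring.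
by set z := L / t * _ * _ => z0; rewrite mulrBr mulr1 lerBlDr lerDl.
Qed.

(** [H n u] is the probability of a word [v] with value near that of [u]. In the mean of
    [H * chain / weight] the sums are exchanged: for fixed [v] the base point becomes [partial v],
    where the chains of all words sum to at most [expR (2 * t) ^+ n]. So this quotient is rarely
    large, and Birkhoff bounds [weight / chain]. *)
Lemma ball_mass_upper_ae (e : R) : 0 < e ->
  {ae mu, forall w, exists N, forall n, (N <= n)%N ->
    ball_mass muX (coding b w) (b ^+ n) <=
    expR (- (n%:R * (pressure q t - 2 * t - e)))}.
Proof.
move=> e0; have [t0 t1] := andP t01; have [b0 b1] := andP b01.
have uq := unit_lipschitz_measurable lq.
pose c := (1 - b)^-1.
have c0 : 0 < c by rewrite invr_gt0; lra.
(* [1] for the radius of the ball and [c] for each of the two truncations to [n] letters. *)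
pose c2 := 1 + 2 * c.
have [C C0 CL] := chain_lipschitz.
pose e' := e / 4.
have e'0 : 0 < e' by rewrite /e'; lra.
pose near_set n u : set (seq bool) :=
  [set v | `|partial v - partial u| <= c2 * b ^+ n].
pose H n u := wexp p n \1_(near_set n u).
have H0 n u : 0 <= H n u.
  by apply: wexp_ge0 => // s _; rewrite indicE.
pose Y n u := H n u * chain b h u (partial u) / weight u.
have h0 := clipped_gt0.
have ch0 u x : 0 < chain b h u x by apply: chain_gt0 => j z; exact: h0.
have Y0 n u : 0 <= Y n u.
  by rewrite /Y divr_ge0 ?mulr_ge0// ltW// weight_gt0.
have EY n : wexp p n (Y n) <= expR (C * c2) * expR (2 * t) ^+ n.
  apply: (@le_trans _ _ (wexp p n (fun u => wexp p n (fun v =>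
      expR (C * c2) * (chain b h u (partial v) / weight u))))).
    apply: le_wexp => // u un; rewrite /Y /H -mulrA mulrC -wexpZ.
    apply: le_wexp => // v vn; rewrite indicE.
    have W0 := weight_gt0 u.
    case: (boolP (v \in _)); last first.
      by rewrite mulr0 mulr_ge0 ?expR_ge0// divr_ge0// ltW.
    rewrite inE /near_set/= => uv; rewrite mulr1 mulrA ler_pM2r ?invr_gt0//.
    apply: le_trans (CL u (partial u) (partial v)) _.
    rewrite mulrC ler_pM2r//  ler_expR un -mulrA ler_wpM2l//.
    by rewrite ler_pdivrMr ?exprn_gt0// distrC.
  rewrite wexp_exchange.
  apply: (@le_trans _ _ (wexp p n (fun=> expR (C * c2) * expR (2 * t) ^+ n))).
    by apply: le_wexp => // v _; rewrite wexpZ ler_pM2l ?expR_gt0// wexp_chain_le.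
  by rewrite wexp_cst.
pose F n : set shift_space :=
  [set w | [set u | expR (n%:R * (2 * t + e')) < Y n u] (mkseq w n)].
have mF n : measurable (F n).
  exact: (@measurable_mkseq n [set u | expR (n%:R * (2 * t + e')) < Y n u]).
have bcF : {ae mu, forall w, exists N, forall n, (N <= n)%N -> ~ F n w}.
  apply: (@borel_cantelli_geometric _ _ _ _ _ (expR (C * c2)) (expR (- e'))) => //.
    by rewrite expR_ge0 expR_lt1; lra.
  exists 0%N => n _; rewrite /F (bernoulli_word mup)/=.
  apply: le_trans (wexp_markov p01 (expR_gt0 _) (fun s _ => Y0 n s)) _.
  rewrite ler_pdivrMr ?expR_gt0//; apply: le_trans (EY n) _.
  rewrite -!expRM_natl -!expRD ler_expR; lra.
have birk := @birkhoff_upper _ _ _ mup (fun w => - letter_potential q t w)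
  (- pressure q t + e') (measurable_funN (measurable_letter_potential uq t0)).
have {}birk : {ae mu, forall w, exists K : R, forall n : nat,
    \sum_(k < n) - letter_potential q t (shiftn k w) <=
    n%:R * (- pressure q t + e') + K}.
  apply: birk.
    have [M HM] := letter_potential_bounded uq t01.
    by exists M => w; rewrite normrN.
  rewrite (_ : \int[mu]_w _ = - pressure q t) ?ltrDl//.
  have [M HM] := letter_potential_bounded uq t01.
  have := @RintegralZl _ _ _ mu setT (letter_potential q t) (-1) measurableT.
  rewrite mulN1r => <-.
    by apply: eq_Rintegral => w _; rewrite mulN1r.
  exact: (bounded_integrable _ (measurable_letter_potential uq t0) HM).
apply: ae_imply (ae_and bcF birk) => w [[N hN] [K hK]].
pose M := Num.bound ((`|K| + C * c2) / e').
exists (maxn N M) => n; rewrite geq_max => /andP[Nn Mn].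
have Cc0 : 0 <= C * c2 by rewrite mulr_ge0// /c2; lra.
have Kn : `|K| + C * c2 < n%:R * e'.
  rewrite -ltr_pdivrMr//; apply: lt_le_trans (archi_boundP _) _.
    by rewrite divr_ge0 ?addr_ge0// ltW.
  by rewrite ler_nat.
set u := mkseq w n.
have un : size u = n by rewrite size_mkseq.
have W0 := weight_gt0 u.
have bn0 : 0 < b ^+ n by rewrite exprn_gt0.
have Jw := @coding_in_ball w n u erefl.
have h1 : ball_mass muX (coding b w) (b ^+ n) <= H n u.
  rewrite -lee_fin /H -(bernoulli_word mup) fineK; last first.
    by rewrite fin_num_measure//; exact: measurable_closed_ball_.
  rewrite -[leLHS]/(mu (coding b @^-1` _)); apply: le_measure; rewrite ?inE.
  - rewrite -[X in measurable X]setTI; apply: measurable_coding => //.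
    exact: measurable_closed_ball_.
  - exact: measurable_mkseq.
  move=> w' /= ww'; have Jw' := @coding_in_ball w' n _ erefl.
  move: Jw Jw' ww'; rewrite /near_set /closed_ball_/= => Jw Jw' ww'.
  have -> : partial (mkseq w' n) - partial u =
    (partial (mkseq w' n) - coding b w') - (partial u - coding b w) -
    (coding b w - coding b w') by ring.
  apply: le_trans (ler_normB _ _) _; rewrite /c2 mulrDl mul1r [leRHS]addrC.
  apply: lerD => //; apply: le_trans (ler_normB _ _) _.
  by rewrite -mulrA mulr_natl mulr2n; apply: lerD.
have h2 : Y n u <= expR (n%:R * (2 * t + e')).
  by rewrite leNgt; apply/negP => hY; exact: (hN n Nn).
have h3 : chain b h u (coding b w) <= chain b h u (partial u) * expR (C * c2).
  apply: le_trans (CL u (coding b w) (partial u)) _.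
  rewrite ler_pM2l// ler_expR un -mulrA ler_wpM2l// ler_pdivrMr// distrC.
  move: Jw; rewrite /closed_ball_/= => /le_trans; apply.
  by rewrite ler_pM2r// -/c /c2; lra.
have h4 := @sum_letter_potential q t w n t0; rewrite -/u in h4.
have h5 : expR (- \sum_(k < n) letter_potential q t (shiftn k w)) <=
    expR (n%:R * (- pressure q t + e') + K) by rewrite ler_expR -sumrN.
rewrite expRN h4 invf_div ler_pdivrMr// in h5.
apply: le_trans h1 _.
have h6 : H n u * chain b h u (coding b w) <=
    expR (n%:R * (2 * t + e')) * expR (C * c2) * weight u.
  apply: (@le_trans _ _ (H n u * (chain b h u (partial u) * expR (C * c2)))).
    by rewrite ler_wpM2l.
  rewrite mulrAC mulrA ler_pM2r ?expR_gt0//.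
  by rewrite -ler_pdivrMr.
have h7 : H n u * chain b h u (coding b w) <=
    expR (n%:R * (2 * t + e')) * expR (C * c2) *
    (expR (n%:R * (- pressure q t + e') + K) * chain b h u (coding b w)).
  by apply: le_trans h6 _; rewrite ler_pM2l// mulr_gt0 ?expR_gt0.
rewrite mulrA ler_pM2r// in h7.
apply: le_trans h7 _; rewrite -!expRD ler_expR.
have e4 : n%:R * e = 4 * (n%:R * e') by rewrite /e'; field.
have ne : 0 <= n%:R * e' by rewrite mulr_ge0// ltW.
by move: e4 ne Kn (ler_norm K); lra.
Qed.

End lower_bound.

Lemma ln_lipschitz (t x y : R) : 0 < t -> t <= x -> t <= y ->
  ln x - ln y <= `|x - y| / t.
Proof.
move=> t0 tx ty; have x0 : 0 < x by exact: lt_le_trans tx.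
have y0 : 0 < y by exact: lt_le_trans ty.
rewrite -ln_div ?posrE//.
have -> : x / y = 1 + (x - y) / y by field; rewrite gt_eqF.
apply: (@le_trans _ _ ((x - y) / y)).
  apply: le_ln1Dx; rewrite -subr_gt0 opprK addrC.
  by have -> : 1 + (x - y) / y = x / y;
    [by field; rewrite gt_eqF|exact: divr_gt0].
apply: (@le_trans _ _ (`|x - y| / y)).
  by rewrite ler_pM2r ?invr_gt0// ler_norm.
by rewrite ler_wpM2l// lef_pV2.
Qed.

(** Above the floor the logarithm is [t^-1]-Lipschitz, which is why closeness in L1 controls the
    pressure. *)
Lemma pressure_continuous (g q : R -> R) (t : R) : 0 < t < 1 ->
  unit_measurable g -> unit_measurable q ->
  pressure g t - pressure q t <= (\int[muX]_x `|g x - q x|) / t.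
Proof.
move=> t01 ug uq; have [t0 t1] := andP t01.
have [M HM] := letter_potential_bounded ug t01.
have [M' HM'] := letter_potential_bounded uq t01.
have mg := measurable_letter_potential ug t0.
have mq := measurable_letter_potential uq t0.
have ig := bounded_integrable mu mg HM.
have iq := bounded_integrable mu mq HM'.
have [mg' g01] := ug; have [mq' q01] := uq.
have md : measurable_fun setT (fun x => `|g x - q x|).
  by apply: measurableT_comp => //; exact: measurable_funB.
have id : mu.-integrable setT (EFin \o (fun w => `|g (coding b w) - q (coding b w)|)).
  apply: (@bounded_integrable _ _ _ _ _ 1).
    exact: (measurableT_comp md (@measurable_coding _ b)).
  move=> w; rewrite normr_id ler_norml.
  by have := g01 (coding b w); have := q01 (coding b w); lra.
have -> : \int[muX]_x `|g x - q x| =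
    \int[mu]_w `|g (coding b w) - q (coding b w)|.
  rewrite /Rintegral; congr fine.
  have H := @ge0_integral_distribution _ _ _ _ _ mu (coding b)
    (EFin \o (fun x => `|g x - q x|)).
  by apply: H; [exact/measurable_EFinP|move=> y; rewrite lee_fin].
rewrite mulrC -RintegralZl// /pressure -RintegralB//; apply: le_Rintegral => //.
- by have := integrableB measurableT ig iq.
- by have := integrableZl measurableT (t^-1) id.
move=> w _; rewrite /letter_potential.
have -> (x y z : R) : x - z - (y - z) = x - y by ring.
apply: (le_trans (ln_lipschitz t0 _ _)); rewrite ?le_max ?lexx ?orbT//.
rewrite mulrC ler_pM2l ?invr_gt0// ![Num.max _ t]maxC.
apply: le_trans (ler_dist_max _ _ _) _.
rewrite /letter_prob; case: (w 0%N) => //.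
by rewrite distrC (_ : _ - _ = g (coding b w) - q (coding b w))//; ring.
Qed.

Theorem bernoulli_convolution_dim :
  exists D, [/\ 0 <= D, dim_le muX D & dim_ge muX D].
Proof.
have [b0 b1] := andP b01.
have lb := ln_lt0 b01.
pose a : R := - ln b.
have a0 : 0 < a by rewrite oppr_gt0.
have [g ug gP] := letter_density_exists b01 p01 mup.
(* A negative pressure would make the lower bound on ball masses exceed 1. *)
have P0 t : 0 < t < 1 -> 0 <= pressure g t.
  move=> t01; rewrite leNgt; apply/negP => Pneg.
  have e0 : 0 < - pressure g t / 2 by lra.
  have [w [N hN]] := ae_nonempty (ball_mass_lower_ae ug gP t01 e0).
  have := le_trans (hN N.+1 (leqnSn N)) (ball_mass_le1 _ _ _).
  rewrite -[leRHS]expR0 ler_expR oppr_le0 pmulr_rge0//; lra.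
pose S : set R := [set pressure g t / a | t in [set t | 0 < t < 1]].
have S0 x : S x -> 0 <= x.
  by move=> [t t01 <-]; rewrite divr_ge0 ?P0// ltW.
have hS : has_inf S.
  split; last by exists 0 => x /S0.
  by exists (pressure g 2^-1 / a), 2^-1 => //=; apply/andP; split; lra.
(* The infimum replaces a limit in [t]: the lower mass bound uses a nearly optimal [t], the upper
   one any small [t], since [D] lies below all members of [S]. *)
pose D := inf S.
have D0 : 0 <= D by apply: lb_le_inf => //; case: hS.
exists D; split => //.
  apply: (@dim_le_scale _ _ b (2 * (1 - b)^-1)) => //.
    by rewrite mulr_gt0// invr_gt0; lra.
  move=> e e0.
  have e2 : 0 < e / 2 by rewrite divr_gt0.
  have [x [t t01 <-] xD] := inf_adherent e2 hS.
  have ea : 0 < e * a / 2 by rewrite divr_gt0// mulr_gt0.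
  pose F n := [set x | ball_mass muX x (2 * (1 - b)^-1 * b ^+ n) <
    expR (- (n%:R * (pressure g t + e * a / 2)))].
  have H := @ae_bernoulli_convolution F (fun n => measurable_ball_mass_lt _ _ _).
  apply: ae_imply (H _) => [{}x [N hN]|].
    exists 0, N => n Nn; rewrite subr0.
    apply: le_trans (_ : expR (- (n%:R * (pressure g t + e * a / 2))) <= _).
      have -> : n%:R * (D + e) * ln b = - (n%:R * ((D + e) * a)).
        by rewrite /a; ring.
      rewrite ler_expR lerN2 ler_wpM2l//.
      by move: xD; rewrite ltr_pdivrMr// -/D; lra.
    by rewrite leNgt; apply/negP; exact: hN.
  apply: ae_imply (ball_mass_lower_ae ug gP t01 ea) => w [N hN].
  by exists N => n Nn; apply/negP; rewrite -leNgt; exact: hN.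
apply: (@dim_ge_scale _ _ b) => // e e0.
(* Three losses of at most [e * a / 4] each: [2 * t], the passage from [g] to [q], and the error in
   [ball_mass_upper_ae]. *)
pose t : R := Num.min 2^-1 (e * a / 8).
have ea : 0 < e * a by rewrite mulr_gt0.
have t01 : 0 < t < 1.
  rewrite /t lt_min; apply/andP; split; first by apply/andP; split; lra.
  by rewrite gt_min; apply/orP; left; lra.
have [t0 t1] := andP t01.
have te : t <= e * a / 8 by rewrite /t ge_min lexx orbT.
have tau0 : 0 < t * (e * a / 4) by rewrite mulr_gt0//; lra.
have [_ /(_ _ tau0) [q lq gq]] := lipschitz_approx_unit_measurable muX ug.
have uq := unit_lipschitz_measurable lq.
have Pq : D * a - e * a / 4 <= pressure q t.
  have := pressure_continuous t01 ug uq.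
  have : (\int[muX]_x `|g x - q x|) / t <= e * a / 4.
    by rewrite ler_pdivrMr// mulrC.
  have : D <= pressure g t / a.
    by apply: ge_inf; [case: hS|exists t].
  rewrite ler_pdivlMr//; lra.
have ea4 : 0 < e * a / 4 by lra.
pose F n := [set x | expR (- (n%:R * (pressure q t - 2 * t - e * a / 4))) <
  ball_mass muX x (b ^+ n)].
have H := @ae_bernoulli_convolution F (fun n => measurable_ball_mass_gt _ _ _).
apply: ae_imply (H _) => [x [N hN]|].
  exists 0, N => n Nn; rewrite addr0.
  apply: (@le_trans _ _ (expR (- (n%:R * (pressure q t - 2 * t - e * a / 4))))).
    by rewrite leNgt; apply/negP; exact: hN.
  have -> : n%:R * (D - e) * ln b = - (n%:R * ((D - e) * a)).
    by rewrite /a; ring.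
  rewrite ler_expR lerN2 ler_wpM2l//; lra.
apply: ae_imply (ball_mass_upper_ae lq t01 ea4) => w [N hN].
by exists N => n Nn; apply/negP; rewrite -leNgt; exact: hN.
Qed.

End bernoulli_dimension.

(** * Irrational rotation and transversality *)

Section rotation.
Context {R : realType} (x : R).
Hypothesis x0 : 0 <= x.
Hypothesis irrx : forall (q : nat) (z : int), (0 < q)%N -> q%:R * x != z%:~R.

Definition rotation (k : nat) : R := k%:R * x - (Num.truncn (k%:R * x))%:R.

Lemma rotation_itv k : 0 <= rotation k < 1.
Proof.
have kx0 : 0 <= k%:R * x by rewrite mulr_ge0.
by have /andP[] := Num.Theory.truncn_itv kx0; rewrite -natr1 /rotation; lra.
Qed.

(* Dirichlet's pigeonhole argument. *)
Lemma rotation_return (l : R) : 0 < l -> exists (q : nat) (z : int),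
  (0 < q)%N /\ 0 < `|q%:R * x - z%:~R| < l.
Proof.
move=> l0; pose Q := Num.bound l^-1.
have Ql : l^-1 < Q%:R by apply: archi_boundP; rewrite invr_ge0 ltW.
have Q0 : 0 < Q%:R :> R by apply: lt_trans Ql; rewrite invr_gt0.
have binQ (k : 'I_Q.+1) : (Num.truncn (Q%:R * rotation k) < Q)%N.
  have /andP[r0 r1] := rotation_itv k.
  have /andP[+ _] := Num.Theory.truncn_itv (mulr_ge0 (ltW Q0) r0).
  rewrite -(ltr_nat R) => /le_lt_trans; apply.
  by rewrite -[ltRHS]mulr1 ltr_pM2l.
pose f k := Ordinal (binQ k).
have : ~~ injectiveb f.
  apply/negP => /injectiveP /leq_card; rewrite !card_ord.
  by rewrite ltnn.
move=> /injectivePn[i [j ij fij]].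
wlog lt_ij : i j ij fij / (i < j)%N.
  move=> H; have [|] := ltnP i j; first exact: H.
  rewrite leq_eqVlt => /orP[/eqP ji|]; last by apply: H; rewrite // eq_sym.
  by move: ij; rewrite -val_eqE /= ji eqxx.
exists (j - i)%N, ((Num.truncn (j%:R * x))%:Z - (Num.truncn (i%:R * x))%:Z).
split; first by rewrite subn_gt0.
rewrite normr_gt0 subr_eq0 irrx ?subn_gt0//=.
have -> : (j - i)%N%:R * x - ((Num.truncn (j%:R * x))%:Z -
    (Num.truncn (i%:R * x))%:Z)%:~R = rotation j - rotation i.
  rewrite natrB 1?ltnW// /rotation intrB -!pmulrn; ring.
have /andP[i0 _] := rotation_itv i; have /andP[j0 _] := rotation_itv j.
have /andP[a1 a2] := Num.Theory.truncn_itv (mulr_ge0 (ltW Q0) i0).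
have /andP[b1 b2] := Num.Theory.truncn_itv (mulr_ge0 (ltW Q0) j0).
move/(congr1 val): fij => /= fij; rewrite -fij -natr1 in b1 b2.
rewrite -natr1 in a2.
have lQ : 1 < l * Q%:R by rewrite -ltr_pdivrMl// mulr1.
rewrite -(ltr_pM2l Q0) -[X in X * `|_|]gtr0_norm// -normrM mulrBr.
by rewrite ltr_norml; apply/andP; split; lra.
Qed.

(** Shifting the indices of [A] by suitable multiples of a return time moves the rotation points
    more than [l] apart. So about [1 / (2 * l)] shifted copies of [A] are disjoint, and for large
    [N] they fit into [2 * N] indices. *)
Lemma rotation_count (l : R) : 0 < l -> exists N0, forall N, (N0 <= N)%N ->
  forall A : {set 'I_N},
    (forall i j, i \in A -> j \in A -> `|rotation i - rotation j| <= l) ->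
    #|A|%:R <= 8 * l * N%:R.
Proof.
move=> l0; have [l1|l1] := leP (8^-1) l.
  exists 0%N => N _ A _; apply: (@le_trans _ _ N%:R).
    by rewrite ler_nat (leq_trans (max_card _))// card_ord.
  have : 0 <= N%:R :> R by [].
  by nra.
have [q [z [q0 /andP[phi0 phil]]]] := rotation_return l0.
set phi := `|_| in phi0 phil.
(* The least number of returns whose total displacement [s * phi] exceeds [l]; it is then at most
   [2 * l]. *)
pose s := (Num.truncn (l / phi)).+1.
have sphi : l < s%:R * phi.
  by rewrite -ltr_pdivrMr// Num.Theory.truncnS_gt.
have sphi2 : s%:R * phi <= 2 * l.
  have /andP[+ _] := Num.Theory.truncn_itv (divr_ge0 (ltW l0) (ltW phi0)).
  rewrite ler_pdivlMr// /s -natr1 mulrDl mul1r; lra.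
have l20 : 0 <= (2 * l)^-1 by rewrite invr_ge0; lra.
(* Multiples [d * (s * phi)] with [0 < d < M] stay at distance more than [l] from every integer, so
   the copies do not wrap around the circle onto each other. *)
pose M := Num.truncn (2 * l)^-1.
have /andP[M1 M2] := Num.Theory.truncn_itv l20; rewrite -/M in M1 M2.
have {}M1 : M%:R * (2 * l) <= 1.
  by rewrite -ler_pdivlMr ?mul1r//; lra.
have {}M2 : 1 < (M%:R + 1) * (2 * l).
  by rewrite natr1 -ltr_pdivrMr ?mul1r//; lra.
exists (M * s * q)%N => N KN A HA.
pose f (ki : 'I_N * 'I_M) : nat := (ki.1 + ki.2 * (s * q))%N.
have f_lt ki : (f ki < N + M * s * q)%N.
  by rewrite /f -addSn leq_add// -mulnA leq_mul2r ltnW ?orbT.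
pose F ki : 'I_(N + M * s * q) := Ordinal (f_lt ki).
have key (k k' : 'I_N) (i i' : 'I_M) : k \in A -> k' \in A ->
    (i < i')%N -> f (k, i) <> f (k', i').
  move=> kA k'A ii' fe.
  pose d := (i' - i)%N.
  have d0 : 1 <= d%:R :> R by rewrite ler1n subn_gt0.
  have dM : d%:R <= M%:R - 1 :> R.
    by rewrite lerBrDr natr1 ler_nat (leq_ltn_trans (leq_subr _ _)).
  have kk' : k%:R - k'%:R = d%:R * (s%:R * q%:R) :> R.
    have -> : (k : nat) = (k' + d * (s * q))%N.
      apply/eqP; rewrite -(eqn_add2r (i * (s * q))) -addnA -mulnDl.
      by rewrite subnK 1?ltnW//; apply/eqP.
    by rewrite natrD !natrM; ring.
  have rk : rotation k - rotation k' = d%:R * s%:R * (q%:R * x - z%:~R) +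
    (z * (d * s)%:Z - (Num.truncn (k%:R * x))%:Z + (Num.truncn (k'%:R * x))%:Z)%:~R.
    rewrite intrD intrB intrM -!pmulrn natrM /rotation.
    have -> : k%:R * x - (Num.truncn (k%:R * x))%:R - (k'%:R * x - (Num.truncn (k'%:R * x))%:R)
      = (k%:R - k'%:R) * x - (Num.truncn (k%:R * x))%:R + (Num.truncn (k'%:R * x))%:R by ring.
    by rewrite kk'; ring.
  have := HA k k' kA k'A; rewrite rk.
  set Z : int := (_ + _)%R.
  have dsphi : l < d%:R * (s%:R * phi) by nra.
  have dsphi2 : d%:R * (s%:R * phi) <= 1 - 2 * l by nra.
  have ds0 : 0 <= d%:R * s%:R :> R by rewrite -natrM.
  have nd : `|d%:R * s%:R * (q%:R * x - z%:~R)| = d%:R * (s%:R * phi).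
    by rewrite normrM ger0_norm// mulrA.
  have [->|Zn0] := eqVneq Z 0.
    by rewrite addr0 nd leNgt dsphi.
  have Z1 : 1 <= `|Z%:~R| :> R.
    by rewrite -intr_norm -[1]/(1%:~R) ler_int -gtz0_ge1 normr_gt0.
  have := lerB_normD (Z%:~R : R) (d%:R * s%:R * (q%:R * x - z%:~R)).
  by rewrite nd [_%:~R + _]addrC => h1 h2; lra.
have Finj : {in finset.setX A (finset.setTfor 'I_M) &, injective F}.
  move=> [k i] [k' i']; rewrite !inE /= => /andP[kA _] /andP[k'A _].
  move=> /(congr1 val) /= fe.
  have [ii'|i'i|ii'] := ltngtP i i'.
  - by case: (key k k' i i' kA k'A ii' fe).
  - by case: (key k' k i' i k'A kA i'i (esym fe)).
  - have ei : i = i' by exact: val_inj.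
    move: fe; rewrite /f /= ei => /addIn ek.
    by congr pair; exact: val_inj.
have cardA : (#|A| * M <= N + M * s * q)%N.
  have := card_in_imset Finj; rewrite cardsX cardsT card_ord => <-.
  by rewrite (leq_trans (max_card _))// card_ord.
have : (#|A| * M)%:R <= (N + N)%:R :> R.
  by rewrite ler_nat (leq_trans cardA)// leq_add2l.
rewrite natrM natrD => h.
have N0 : 0 <= N%:R :> R by [].
have A0 : 0 <= #|A|%:R :> R by [].
have : 1 <= 4 * l * M%:R by lra.
nra.
Qed.

End rotation.

Section indicator_sums.
Context d (T : measurableType d) (R : realType) (P : probability T R).

Lemma Rintegral_sum_indic (w : nat -> R) (A : nat -> set T) J :
  (forall j, measurable (A j)) ->
  P.-integrable setT (EFin \o (fun x => \sum_(j < J) w j * \1_(A j) x)) /\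
  \int[P]_x (\sum_(j < J) w j * \1_(A j) x) = \sum_(j < J) w j * fine (P (A j)).
Proof.
move=> mA; elim: J => [|J [iJ eJ]].
  under eq_fun do rewrite big_ord0.
  split; first by apply: (@bounded_integrable _ _ _ _ _ 0) => // x; rewrite normr0.
  by rewrite big_ord0 Rintegral_cst// mul0r.
have iA := integrable_indic P (mA J).
have iw : P.-integrable setT (EFin \o (fun x => w J * \1_(A J) x)).
  by have := integrableZl measurableT (w J) iA.
have E x : \sum_(j < J.+1) w j * \1_(A j) x =
    \sum_(j < J) w j * \1_(A j) x + w J * \1_(A J) x by rewrite big_ord_recr.
under eq_fun do rewrite E.
split; first by have := integrableD measurableT iJ iw.
by rewrite RintegralD// eJ RintegralZl// Rintegral_indic// big_ord_recr.
Qed.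

Lemma sum_probability_le (A B : nat -> set T) (w : nat -> R) (w0 : R) N J :
  (forall k, measurable (A k)) -> (forall j, measurable (B j)) ->
  (forall x, \sum_(k < N) \1_(A k) x <= \sum_(j < J) w j * \1_(B j) x + w0) ->
  \sum_(k < N) fine (P (A k)) <= \sum_(j < J) w j * fine (P (B j)) + w0.
Proof.
move=> mA mB H.
have [iA eA] := @Rintegral_sum_indic (fun=> 1) A N mA.
have [iB eB] := @Rintegral_sum_indic w B J mB.
have ic : P.-integrable setT (EFin \o (fun=> w0)).
  by apply: (@bounded_integrable _ _ _ _ _ `|w0|).
have <- : \sum_(k < N) 1 * fine (P (A k)) = \sum_(k < N) fine (P (A k)).
  by apply: eq_bigr => k _; rewrite mul1r.
have -> : w0 = \int[P]_x (fun=> w0) x.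
  rewrite Rintegral_cst// (_ : fine _ = 1) ?mulr1//.
  by have /(congr1 fine) := @probability_setT _ _ _ P.
rewrite -eA -eB -RintegralD//; apply: le_Rintegral => //.
  by have := integrableD measurableT iB ic.
move=> x _; apply: le_trans (H x); apply: ler_sum => k _.
by rewrite mul1r.
Qed.

End indicator_sums.

Section scale_ratio.
Context {R : realType} (b b' : R) (m : nat).
Hypotheses (b01 : 0 < b < 1) (b'01 : 0 < b' < 1).

Definition log_ratio : R := m%:R * (ln b / ln b').

(* Number of letters of the second sequence read together with [k * m] letters
   of the first one, so that [b' ^+ letters2 k] is comparable to
   [b ^+ (k * m)]. *)
Definition letters2 (k : nat) : nat := Num.truncn (k%:R * log_ratio).

Definition scale_ratio (k : nat) : R := b' ^+ letters2 k / b ^+ (k * m).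

Lemma log_ratio_ge0 : 0 <= log_ratio.
Proof.
rewrite mulr_ge0// -mulrNN mulr_ge0//; first by rewrite oppr_ge0 ltW// ln_lt0.
by rewrite -invrN invr_ge0 oppr_ge0 ltW// ln_lt0.
Qed.

Lemma scale_ratioE k : scale_ratio k = expR (- ln b' * rotation log_ratio k).
Proof.
have [b0 b1] := andP b01; have [b'0 b'1] := andP b'01.
have lb' := ln_lt0 b'01.
rewrite /scale_ratio -[b' ^+ _]lnK ?posrE ?exprn_gt0//.
rewrite -[b ^+ _]lnK ?posrE ?exprn_gt0// -expRB; congr expR.
rewrite !lnXn// -[ln b' *+ _]mulr_natl -[ln b *+ _]mulr_natl natrM.
rewrite /rotation /letters2; set t := (Num.truncn _)%:R; rewrite /log_ratio.
by field; rewrite lt_eqF.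
Qed.

Lemma scale_ratio_itv k : 1 <= scale_ratio k <= b'^-1.
Proof.
have [b'0 b'1] := andP b'01; have lb' := ln_lt0 b'01.
have /andP[r0 r1] := rotation_itv log_ratio_ge0 k.
rewrite scale_ratioE -[X in X <= _ <= _]expR0 !ler_expR.
rewrite -[b'^-1]lnK ?posrE ?invr_gt0// lnV ?posrE// ler_expR.
by apply/andP; split; nra.
Qed.

(** By [scale_ratioE] both ratios are exponentials of nonnegative numbers, where the exponential has
    slope at least 1. *)
Lemma scale_ratio_expansive k k' :
  - ln b' * `|rotation log_ratio k - rotation log_ratio k'| <=
  `|scale_ratio k - scale_ratio k'|.
Proof.
have lb' := ln_lt0 b'01.
have exp_exp (u v : R) : 0 <= v -> v <= u -> u - v <= expR u - expR v.
  move=> v0 vu; rewrite -[in expR u](subrK v u) expRD.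
  have := expR_ge1Dx (u - v); have := expR_ge1Dx v.
  by set x := expR (u - v); set y := expR v => *; nra.
have /andP[r0 _] := rotation_itv log_ratio_ge0 k.
have /andP[r'0 _] := rotation_itv log_ratio_ge0 k'.
rewrite !scale_ratioE.
have {1}-> : - ln b' = `|- ln b'| by rewrite gtr0_norm; lra.
rewrite -normrM mulrBr.
set u := - ln b' * _; set v := - ln b' * _.
have u0 : 0 <= u by rewrite mulr_ge0//; lra.
have v0 : 0 <= v by rewrite mulr_ge0//; lra.
have [vu|uv] := leP v u.
  by rewrite !ger0_norm ?exp_exp// subr_ge0// ler_expR.
rewrite distrC [leRHS]distrC !ger0_norm ?exp_exp ?subr_ge0 ?ler_expR//;
  exact: ltW.
Qed.

Lemma scale_ratio0 : scale_ratio 0 = 1.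
Proof. by rewrite scale_ratioE /rotation mul0r Num.Theory.truncn0 subrr mulr0 expR0. Qed.

End scale_ratio.

(** * Proportion of the lines that pass near a point *)

Section transversality.
Context {R : realType} (b b' C2 : R).
Hypotheses (b01 : 0 < b < 1) (b'01 : 0 < b' < 1) (C21 : 1 <= C2).
Hypothesis irr : irrational (ln b / ln b').

Lemma log_ratio_irrational m (q : nat) (z : int) : (0 < m)%N -> (0 < q)%N ->
  q%:R * log_ratio b b' m != z%:~R.
Proof.
move=> m0 q0; apply/eqP => qz; apply: irr; apply/rationalP.
exists z, (q * m)%N; rewrite -qz /log_ratio natrM; field.
by rewrite !pnatr_eq0 -!lt0n q0 m0 lt_eqF// ln_lt0.
Qed.

(** [4 * C2 / (b' * - ln b')] converts the width of a line neighbourhood into a distance of the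
    rotation, [8] comes from [rotation_count], [2 * C2] covers points at distance comparable to
    [b ^+ m], and dividing by [b] pays for rounding that distance to a power of [b]. *)
Definition transversality_const : R :=
  (8 * (4 * C2 / (b' * - ln b')) + 2 * C2) / b.

Lemma transversality_const_gt1 : 1 <= transversality_const.
Proof.
have [b0 b1] := andP b01; have [b'0 b'1] := andP b'01.
have lb' := ln_lt0 b'01.
rewrite /transversality_const ler_pdivlMr// mul1r; have C2_1 := C21.
have : 0 <= 4 * C2 / (b' * - ln b').
  apply: divr_ge0; first by lra.
  by apply: mulr_ge0; lra.
lra.
Qed.

(** With [d] the larger of the two distances, the admissible ratios lie in an interval of length of
    order [b ^+ m / d], hence so does the proportion of [k]. Up to constants the sum over [j] is the
    minimum of 1 and [b ^+ m / d], written with indicators of squares, whose integrals are products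
    of ball masses. *)
Lemma transversality m : (0 < m)%N -> exists N0, forall N, (N0 <= N)%N ->
  forall dx dy : R,
  \sum_(k < N) (`|dx + scale_ratio b b' m k * dy| <= C2 * b ^+ m)%R%:R <=
  N%:R * transversality_const *
    (\sum_(j < m.+1) b ^+ j *
       ((`|dx| <= b ^+ (m - j)) && (`|dy| <= b ^+ (m - j)))%R%:R + b ^+ m).
Proof.
move=> m0.
have [b0 b1] := andP b01; have [b'0 b'1] := andP b'01.
have lb' := ln_lt0 b'01.
pose a' : R := - ln b'; have C2_1 := C21.
have a'0 : 0 < a' by rewrite oppr_gt0.
pose C5 : R := 4 * C2 / (b' * a').
have C50 : 0 < C5.
  by apply: divr_gt0; [lra|apply: mulr_gt0; lra].
pose C6 : R := 8 * C5 + 2 * C2.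
have C60 : 0 < C6 by rewrite /C6; lra.
have TE : transversality_const = C6 / b by [].
have irr' := fun q z => log_ratio_irrational z m0 (q := q).
have bn0 n : 0 < b ^+ n by rewrite exprn_gt0.
have bn1 n : b ^+ n <= 1 by rewrite exprn_ile1// ltW.
(* The threshold must not depend on the distance; only the finitely many scales [i <= m] occur. *)
have [N0 HN0] : exists N0, forall N, (N0 <= N)%N -> forall i, (i <= m)%N ->
    forall A : {set 'I_N},
    (forall k k', k \in A -> k' \in A -> `|rotation (log_ratio b b' m) k -
       rotation (log_ratio b b' m) k'| <= C5 * b ^+ i) ->
    #|A|%:R <= 8 * (C5 * b ^+ i) * N%:R.
  have /choice[f Hf] : forall i, exists N0, forall N, (N0 <= N)%N ->
    forall A : {set 'I_N},
    (forall k k', k \in A -> k' \in A -> `|rotation (log_ratio b b' m) k -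
       rotation (log_ratio b b' m) k'| <= C5 * b ^+ i) ->
    #|A|%:R <= 8 * (C5 * b ^+ i) * N%:R.
    move=> i; apply: (rotation_count (log_ratio_ge0 m b01 b'01)) => //.
    by rewrite mulr_gt0.
  exists (\max_(i < m.+1) f i) => N fN i im; apply: Hf.
  by apply: leq_trans fN; exact: (leq_bigmax (Ordinal (im : (i < m.+1)%N))).
exists N0 => N NN dx dy.
pose c k : R := scale_ratio b b' m k.
pose A := finset.finset (fun k : 'I_N => `|dx + c k * dy| <= C2 * b ^+ m).
have -> : \sum_(k < N) (`|dx + scale_ratio b b' m k * dy| <= C2 * b ^+ m)%R%:R =
    #|A|%:R :> R.
  rewrite -natr_sum -sum1_card [in RHS]big_mkcond/=; congr (_%:R).
  by apply: eq_bigr => k _; rewrite inE -/(c k); case: ifP.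
have AN : #|A|%:R <= N%:R :> R.
  by rewrite ler_nat (leq_trans (max_card _))// card_ord.
pose d : R := Num.max `|dx| `|dy|.
have dE (x : R) : (d <= x) = (`|dx| <= x) && (`|dy| <= x) by rewrite ge_max.
have key i : (i <= m)%N -> b ^+ (m - i) < d -> #|A|%:R <= N%:R * C6 * b ^+ i.
  move=> im di.
  have bmi : b ^+ m = b ^+ (m - i) * b ^+ i by rewrite -exprD subnK.
  have NR : 0 <= N%:R :> R by [].
  have [dr|rd] := leP d (2 * C2 * b ^+ m).
    apply: le_trans AN _; rewrite -mulrA ler_peMr//.
    have : 1 <= 2 * C2 * b ^+ i.
      rewrite -(ler_pM2l (bn0 (m - i)%N)) mulr1 mulrCA -bmi; exact: ltW (lt_le_trans di dr).
    move=> /le_trans; apply; rewrite ler_pM2r// /C6; lra.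
  have [A0|[k0 kA0]] := set_0Vmem A.
    rewrite A0 cards0.
    exact: mulr_ge0 (mulr_ge0 NR (ltW C60)) (ltW (bn0 i)).
  (* If [dx] is the larger one, [c k0 * dy] must cancel it up to [C2 * b ^+ m], less than half of
     [d]; as [c k0 <= b'^-1], [dy] cannot be small. *)
  have dyd : b' * d / 2 <= `|dy|.
    have [dxdy|dydx] := leP `|dx| `|dy|.
      have -> : d = `|dy| by rewrite /d max_r.
      have := normr_ge0 dy; nra.
    have dE' : d = `|dx| by rewrite /d max_l// ltW.
    move: kA0; rewrite inE => h.
    have /andP[c1 c2] := scale_ratio_itv m b01 b'01 k0.
    have h1 : `|dx| <= C2 * b ^+ m + c k0 * `|dy|.
      have -> : dx = (dx + c k0 * dy) - c k0 * dy by ring.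
      apply: le_trans (ler_normB _ _) _; apply: lerD => //.
      by rewrite normrM ger0_norm//; apply: le_trans c1.
    have h2 : d / 2 <= c k0 * `|dy| by rewrite dE'; lra.
    have h3 : d / 2 <= b'^-1 * `|dy|.
      by apply: le_trans h2 _; rewrite ler_wpM2r.
    by rewrite -mulrA -ler_pdivlMl// mulrC.
  have d0 : 0 < d by apply: lt_trans di.
  apply: le_trans (_ : 8 * (C5 * b ^+ i) * N%:R <= _); last first.
    have -> : 8 * (C5 * b ^+ i) * N%:R = 8 * C5 * (b ^+ i * N%:R) by ring.
    have -> : N%:R * C6 * b ^+ i = C6 * (b ^+ i * N%:R) by ring.
    by apply: ler_wpM2r; [rewrite mulr_ge0// ltW|rewrite /C6; lra].
  apply: HN0 => // k k'; rewrite !inE => kA k'A.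
  have h1 := scale_ratio_expansive m b01 b'01 k k'; rewrite -/a' in h1.
  have h2 : `|c k - c k'| * `|dy| <= 2 * C2 * b ^+ m.
    rewrite -normrM.
    have -> : (c k - c k') * dy = (dx + c k * dy) - (dx + c k' * dy) by ring.
    apply: le_trans (ler_normB _ _) _.
    by rewrite -mulrA mulr_natl mulr2n; apply: lerD.
  have h3 : a' * `|rotation (log_ratio b b' m) k - rotation (log_ratio b b' m) k'|
      * (b' * d / 2) <= 2 * C2 * b ^+ m.
    apply: le_trans _ h2; apply: ler_pM => //.
      by rewrite mulr_ge0// ltW.
    by rewrite divr_ge0// mulr_ge0// ltW.
  rewrite -(ler_pM2l (_ : 0 < a' * (b' * d / 2))); last first.
    by rewrite mulr_gt0// divr_gt0// mulr_gt0.
  rewrite mulrAC; apply: le_trans h3 _.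
  have -> : a' * (b' * d / 2) * (C5 * b ^+ i) = 2 * C2 * (d * b ^+ i).
    rewrite /C5; field; by rewrite !gt_eqF.
  by rewrite bmi ler_wpM2l ?ler_wpM2r ?ltW//; lra.
have T0 := transversality_const_gt1.
have sum_ge (j : 'I_m.+1) : d <= b ^+ (m - j) ->
    b ^+ j <= \sum_(j < m.+1) b ^+ j *
       ((`|dx| <= b ^+ (m - j)) && (`|dy| <= b ^+ (m - j)))%R%:R + b ^+ m.
  move=> dj; rewrite (bigD1 j)//= -dE dj mulr1 -addrA lerDl addr_ge0//; last exact: ltW.
  by apply: sumr_ge0 => i _; rewrite mulr_ge0// ltW.
have sum_gem : b ^+ m <= \sum_(j < m.+1) b ^+ j *
       ((`|dx| <= b ^+ (m - j)) && (`|dy| <= b ^+ (m - j)))%R%:R + b ^+ m.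
  by rewrite lerDr; apply: sumr_ge0 => i _; rewrite mulr_ge0// ltW.
have NT0 : 0 <= N%:R * transversality_const by rewrite mulr_ge0//; lra.
have [d1|d1] := leP d (b ^+ (m - 0)).
  apply: le_trans AN _; rewrite -mulrA ler_peMr//.
  have := sum_ge ord0 d1; rewrite expr0 => h.
  rewrite -[leLHS]mulr1; apply: ler_pM => //; lra.
have [[i [im di di']]|Hall] : (exists i, [/\ (i < m)%N, b ^+ (m - i) < d &
    d <= b ^+ (m - i.+1)]) \/ (forall i, (i <= m)%N -> b ^+ (m - i) < d).
  have [|H] := pselect (exists i, [/\ (i < m)%N, b ^+ (m - i) < d &
    d <= b ^+ (m - i.+1)]); first by left.
  right; elim => // i IH im; rewrite ltNge; apply/negP => h; apply: H.
  by exists i; split => //; apply: IH; exact: ltnW.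
- have h := key i (ltnW im) di.
  have := sum_ge (Ordinal (im : (i.+1 < m.+1)%N)) di'.
  move=> /= h'; apply: le_trans h _.
  apply: le_trans (ler_wpM2l NT0 h').
  by rewrite TE exprS -!mulrA mulKf// gt_eqF.
- have h := key m (leqnn m) (Hall m (leqnn m)).
  apply: le_trans h _; apply: le_trans (ler_wpM2l NT0 sum_gem).
  rewrite TE ler_pM2r// ler_wpM2l// ler_pdivlMr// ler_piMr ?ltW//.
Qed.

End transversality.

(** * Bad blocks *)

Section pair_expectation.
Context {R : realType} (p p' : R).
Hypotheses (p01 : 0 < p < 1) (p'01 : 0 < p' < 1).
Implicit Types (n m : nat) (F G : seq bool -> seq bool -> R).

Definition wexp2 n m F : R := wexp p n (fun u => wexp p' m (F u)).

Lemma eq_wexp2 n m F G :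
  (forall u v, size u = n -> size v = m -> F u v = G u v) ->
  wexp2 n m F = wexp2 n m G.
Proof.
by move=> FG; apply: eq_wexp => u un; apply: eq_wexp => v vm; exact: FG.
Qed.

Lemma le_wexp2 n m F G :
  (forall u v, size u = n -> size v = m -> F u v <= G u v) ->
  wexp2 n m F <= wexp2 n m G.
Proof.
by move=> FG; apply: le_wexp => // u un; apply: le_wexp => // v vm; exact: FG.
Qed.

Lemma wexp2_cst n m (c : R) : wexp2 n m (fun _ _ => c) = c.
Proof. by rewrite /wexp2 wexp_cst wexp_cst. Qed.

Lemma wexp2Z n m (c : R) F :
  wexp2 n m (fun u v => c * F u v) = c * wexp2 n m F.
Proof.
rewrite /wexp2 -wexpZ; apply: eq_wexp => u _.
by rewrite -wexpZ; apply: eq_wexp.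
Qed.

Lemma wexp2D n m F G :
  wexp2 n m (fun u v => F u v + G u v) = wexp2 n m F + wexp2 n m G.
Proof.
rewrite /wexp2 -wexpD; apply: eq_wexp => u _.
by rewrite -wexpD; apply: eq_wexp.
Qed.

Lemma wexp2_sum n m J (F : nat -> seq bool -> seq bool -> R) :
  wexp2 n m (fun u v => \sum_(j < J) F j u v) = \sum_(j < J) wexp2 n m (F j).
Proof.
elim: J => [|J IH].
  rewrite big_ord0 -[RHS](wexp2_cst n m); apply: eq_wexp2 => u v _ _.
  by rewrite big_ord0.
rewrite [RHS]big_ord_recr/= -IH -wexp2D; apply: eq_wexp2 => u v _ _.
by rewrite big_ord_recr.
Qed.

Lemma wexp2_ge0 n m F :
  (forall u v, size u = n -> size v = m -> 0 <= F u v) -> 0 <= wexp2 n m F.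
Proof. by move=> F0; rewrite -(wexp2_cst n m 0); exact: le_wexp2. Qed.

Lemma wexp2_cat n n' m m' F : wexp2 (n + n') (m + m') F =
  wexp2 n m (fun u v => wexp2 n' m' (fun u' v' => F (u ++ u') (v ++ v'))).
Proof.
rewrite /wexp2 wexp_cat; apply: eq_wexp => u _.
rewrite [RHS]wexp_exchange; apply: eq_wexp => u' _.
by rewrite wexp_cat.
Qed.

Lemma wexp2_exchange n m n' m'
    (F : seq bool -> seq bool -> seq bool -> seq bool -> R) :
  wexp2 n m (fun u v => wexp2 n' m' (F u v)) =
  wexp2 n' m' (fun u' v' => wexp2 n m (fun u v => F u v u' v')).
Proof.
rewrite /wexp2.
under eq_wexp => u _ do rewrite wexp_exchange.
rewrite wexp_exchange; apply: eq_wexp => u' _.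
under eq_wexp => u _ do rewrite wexp_exchange.
by rewrite wexp_exchange.
Qed.

Lemma wexp2_markov n m F (c : R) : 0 < c ->
  (forall u v, size u = n -> size v = m -> 0 <= F u v) ->
  wexp2 n m (fun u v => (c < F u v)%R%:R) <= wexp2 n m F / c.
Proof.
move=> c0 F0; rewrite ler_pdivlMr// mulrC -wexp2Z.
apply: le_wexp2 => u v un vm; case: ltP => [/ltW|_]; first by rewrite mulr1.
by rewrite mulr0 F0.
Qed.

End pair_expectation.

(** * Masses of windows for independent blocks *)

Section blocks.
Context {R : realType} (p p' : R) (m : nat) (l : nat -> nat).
Context (Z : nat -> seq bool -> seq bool -> R) (r C0 R1 : R).
Hypotheses (p01 : 0 < p < 1) (p'01 : 0 < p' < 1).
Hypotheses (r0 : 0 < r <= 2^-1) (R10 : 0 < R1 <= 1).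
Hypothesis Z0 : forall k, Z k [::] [::] = 0.
Hypothesis Zbound : forall k u v, `|Z k u v| <= C0.
Hypothesis Zcat : forall k u v u' v', size u = m -> size v = l k ->
  Z k (u ++ u') (v ++ v') = Z k u v + r * Z k.+1 u' v'.
Local Notation E := (wexp2 p p').
Implicit Types (k N : nat) (u v : seq bool).

Fixpoint blocks_len k N : nat :=
  if N is N'.+1 then (l k + blocks_len k.+1 N')%N else 0%N.

Definition block_mass k u v : R :=
  E m (l k) (fun u' v' => (`|Z k u' v' - Z k u v| <= r)%R%:R).

Definition bad_block k u v : bool := R1 < block_mass k u v.

Fixpoint bad_blocks k N u v : nat :=
  if N is N'.+1 then
    (bad_block k (take m u) (take (l k) v) +
     bad_blocks k.+1 N' (drop m u) (drop (l k) v))%N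
  else 0%N.

Lemma bad_blocks_cat k N u v u' v' : size u = m -> size v = l k ->
  bad_blocks k N.+1 (u ++ u') (v ++ v') =
  (bad_block k u v + bad_blocks k.+1 N u' v')%N.
Proof.
by move=> um vl; rewrite /= !take_size_cat// !drop_size_cat.
Qed.

(** A lower estimate of the inverse of [block_mass]: as a weight, it makes the smallness of good
    blocks multiplicative. *)
Definition boost k u v : R := if bad_block k u v then 1 else R1^-1.

Lemma boost_gt0 k u v : 0 < boost k u v.
Proof. by rewrite /boost; case: ifP => // _; rewrite invr_gt0; case/andP: R10. Qed.

Lemma block_mass_ge0 k u v : 0 <= block_mass k u v.
Proof. exact: wexp2_ge0. Qed.

Lemma block_mass_le1 k u v : block_mass k u v <= 1.
Proof.
rewrite -(wexp2_cst p p' m (l k) 1); by apply: le_wexp2 => // u' v' _ _; rewrite lern1 leq_b1.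
Qed.

Lemma boost_block_mass k u v : boost k u v * block_mass k u v <= 1.
Proof.
rewrite /boost; case: ifPn; first by rewrite mul1r block_mass_le1.
have [R1_0 _] := andP R10.
by rewrite -leNgt mulrC ler_pdivrMr// mul1r.
Qed.

(* On the event that the value lies in the interval, [block_mass] is at least the
   probability of that event, while [boost] is at most its inverse. *)
Lemma boost_interval k (t : R) :
  E m (l k) (fun u v => boost k u v * (t <= Z k u v <= t + r)%R%:R) <= 1.
Proof.
set q := E m (l k) (fun u v => (t <= Z k u v <= t + r)%R%:R).
have q0 : 0 <= q by exact: wexp2_ge0.
have key : q * E m (l k) (fun u v => boost k u v * (t <= Z k u v <= t + r)%R%:R) <= q.
  rewrite -wexp2Z; apply: le_wexp2 => // u v _ _.
  have [/andP[t1 t2]|_] := boolP (t <= Z k u v <= t + r); last by rewrite !mulr0.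
  rewrite !mulr1; apply: le_trans (boost_block_mass k u v).
  rewrite mulrC; apply: ler_wpM2l; first exact: ltW (boost_gt0 _ _ _).
  apply: le_wexp2 => // u' v' _ _.
  case: (boolP (t <= Z k u' v' <= t + r)) => // /andP[t'1 t'2].
  by rewrite (_ : _ <= r)// ler_norml; apply/andP; split; lra.
have [q00|qpos] := eqVneq q 0; last first.
  by move: key; rewrite -ler_pdivlMl ?mulVf// lt_def qpos.
apply: le_trans ler01; rewrite -[leRHS](mulr0 R1^-1) -q00 /q -wexp2Z.
apply: le_wexp2 => // u v _ _; apply: ler_wpM2r => //.
have [R1_0 R1_1] := andP R10.
by rewrite /boost; case: ifP => // _; rewrite invf_ge1.
Qed.

(** Chosen so that [C1 - 2 * C0 > C1 / 2 >= C1 * r]: from an offset beyond [C1] one block cannot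
    reach the window, and the recursion keeps the same [C1]. *)
Let C1 : R := 4 * C0 + 2.
Definition block_const : R := (Num.truncn (2 * C1)).+1%:R.

Let C00 : 0 <= C0.
Proof. exact: le_trans (normr_ge0 _) (Zbound 0 [::] [::]). Qed.

(* Each of the [block_const] intervals of length [r] covering the window
   contributes at most 1. *)
Lemma boost_window k (d : R) :
  E m (l k) (fun u v => boost k u v *
    E m (l k) (fun u' v' => (`|d + Z k u' v' - Z k u v| <= C1 * r)%R%:R)) <=
  block_const * (`|d| <= C1)%R%:R.
Proof.
have [r_0 r_1] := andP r0; have C00' := C00.
have [dC|Cd] := leP `|d| C1; last first.
  rewrite mulr0 (_ : E _ _ _ = 0)// -(wexp2_cst p p' m (l k) 0).
  apply: eq_wexp2 => u v _ _.
  rewrite (_ : E _ _ _ = 0) ?mulr0// -[RHS](wexp2_cst p p' m (l k) 0).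
  apply: eq_wexp2 => u' v' _ _; rewrite (_ : (_ <= _) = false)//.
  apply/negbTE; rewrite -ltNge.
  have h1 : `|d| <= `|d + Z k u' v' - Z k u v| + `|Z k u' v'| + `|Z k u v|.
    have {1}-> : d = (d + Z k u' v' - Z k u v) - Z k u' v' + Z k u v by ring.
    by apply: le_trans (ler_normD _ _) _; rewrite lerD2r; exact: ler_normB.
  have := Zbound k u v; have := Zbound k u' v'.
  move: h1 Cd; rewrite /C1; nra.
rewrite mulr1.
under eq_wexp2 => u v _ _ do rewrite -wexp2Z.
rewrite wexp2_exchange -[leRHS](wexp2_cst p p' m (l k)).
apply: le_wexp2 => // u' v' _ _.
pose t (j : nat) : R := d + Z k u' v' - C1 * r + j%:R * r.
apply: (@le_trans _ _ (E m (l k) (fun u v =>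
    \sum_(j < (Num.truncn (2 * C1)).+1)
      (boost k u v * (t j <= Z k u v <= t j + r)%R%:R)))).
  apply: le_wexp2 => // u v _ _; rewrite -mulr_sumr.
  apply: ler_wpM2l; first exact: ltW (boost_gt0 _ _ _).
  case: (boolP (`|_| <= _)) => [h|_]; last by apply: sumr_ge0.
  pose y : R := (Z k u v - (d + Z k u' v' - C1 * r)) / r.
  move: h; rewrite ler_norml => /andP[h1 h2].
  have y0 : 0 <= y by rewrite divr_ge0//; lra.
  have y1 : y <= 2 * C1 by rewrite ler_pdivrMr//; lra.
  have jJ : (Num.truncn y < (Num.truncn (2 * C1)).+1)%N.
    by rewrite ltnS; exact: Num.Theory.le_truncn.
  rewrite (bigD1 (Ordinal jJ))//= -[leLHS]addr0; apply: lerD; last exact: sumr_ge0.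
  have /andP[t1 t2] := Num.Theory.truncn_itv y0.
  rewrite ler_pdivlMr// in t1; rewrite ltr_pdivrMr// -[_.+1]addn1 natrD in t2.
  by rewrite (_ : _ <= _ <= _)// /t; apply/andP; split; lra.
rewrite (wexp2_sum _ _ _ _ _ (fun j u v =>
  boost k u v * (t j <= Z k u v <= t j + r)%R%:R)) /block_const.
apply: (@le_trans _ _ (\sum_(j < (Num.truncn (2 * C1)).+1) 1)).
  by apply: ler_sum => j _; exact: boost_interval.
by rewrite sumr_const card_ord.
Qed.

Definition window_mass k N (d : R) u v : R :=
  E (N * m) (blocks_len k N)
    (fun u' v' => (`|d + Z k u' v' - Z k u v| <= C1 * r ^+ N)%R%:R).

Lemma window_mass_ge0 k N d u v : 0 <= window_mass k N d u v.
Proof. exact: wexp2_ge0. Qed.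

(** Both sequences lose their first block and the window is rescaled by [r^-1], the difference of
    the first blocks entering the new offset. The inductive bound vanishes unless that offset is at
    most [C1], which is the event of [boost_window]. The powers of [R1] form the product of the
    boosts. *)
Lemma boosted_window_bound k N (d : R) :
  E (N * m) (blocks_len k N) (fun u v => window_mass k N d u v *
    (R1^-1 ^+ N * R1 ^+ bad_blocks k N u v)) <=
  block_const ^+ N * (`|d| <= C1)%R%:R.
Proof.
have [r_0 r_1] := andP r0; have [R1_0 R1_1] := andP R10.
elim: N k d => [|N IH] k d.
  by rewrite /window_mass /wexp2 /= !expr0 !mulr1 mul1r Z0 subr0 addr0.
rewrite mulSn [blocks_len _ _]/= wexp2_cat.
apply: (@le_trans _ _ (E m (l k) (fun u v => block_const ^+ N * (boost k u v *
    E m (l k) (fun u' v' => (`|d + Z k u' v' - Z k u v| <= C1 * r)%R%:R))))).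
  apply: le_wexp2 => // u v um vl.
  apply: (@le_trans _ _ (boost k u v * E m (l k) (fun u' v' =>
      E (N * m) (blocks_len k.+1 N) (fun u2 v2 =>
        window_mass k.+1 N ((d + Z k u' v' - Z k u v) / r) u2 v2 *
        (R1^-1 ^+ N * R1 ^+ bad_blocks k.+1 N u2 v2))))).
    rewrite le_eqVlt; apply/orP; left; apply/eqP.
    rewrite wexp2_exchange -wexp2Z; apply: eq_wexp2 => u2 v2 _ _.
    rewrite bad_blocks_cat// exprS exprD.
    have -> : window_mass k N.+1 d (u ++ u2) (v ++ v2) =
        E m (l k) (fun u' v' =>
          window_mass k.+1 N ((d + Z k u' v' - Z k u v) / r) u2 v2).
      rewrite /window_mass mulSn [blocks_len _ _]/= wexp2_cat.
      apply: eq_wexp2 => u' v' um' vl'; apply: eq_wexp2 => u2' v2' _ _.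
      rewrite !Zcat//; congr ((nat_of_bool _)%:R).
      have -> : d + (Z k u' v' + r * Z k.+1 u2' v2') -
          (Z k u v + r * Z k.+1 u2 v2) =
          r * ((d + Z k u' v' - Z k u v) / r + Z k.+1 u2' v2' - Z k.+1 u2 v2).
        by field; rewrite gt_eqF.
      by rewrite normrM gtr0_norm// exprS mulrCA ler_pM2l.
    rewrite (_ : R1^-1 * R1^-1 ^+ N * _ =
      boost k u v * (R1^-1 ^+ N * R1 ^+ bad_blocks k.+1 N u2 v2)); last first.
      set x := R1^-1 ^+ N; rewrite /boost; case: ifP => _ /=; last by ring.
      by rewrite expr1; field; rewrite gt_eqF.
    rewrite mulrCA; congr (_ * _); rewrite mulrC -wexp2Z.
    by apply: eq_wexp2 => u' v' _ _; rewrite mulrC.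
  rewrite [leRHS]mulrCA; apply: ler_wpM2l; first exact: ltW (boost_gt0 _ _ _).
  rewrite -wexp2Z; apply: le_wexp2 => // u' v' _ _.
  apply: le_trans (IH _ _) _.
  by rewrite normrM normfV (gtr0_norm r_0) ler_pdivrMr.
rewrite wexp2Z exprSr -mulrA; apply: ler_wpM2l; last exact: boost_window.
by rewrite exprn_ge0.
Qed.

Lemma window_tail N :
  E (N * m) (blocks_len 0 N) (fun u v => ((2 * block_const) ^+ N <
    window_mass 0 N 0 u v * (R1^-1 ^+ N * R1 ^+ bad_blocks 0 N u v))%R%:R) <=
  2^-1 ^+ N.
Proof.
have [R1_0 R1_1] := andP R10.
have A0 : 0 < block_const by rewrite ltr0n.
have cN : 0 < (2 * block_const) ^+ N by rewrite exprn_gt0// mulr_gt0.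
apply: le_trans (wexp2_markov p01 p'01 cN _) _.
  move=> u v _ _; apply: mulr_ge0; first exact: window_mass_ge0.
  by apply: mulr_ge0; rewrite exprn_ge0// ?invr_ge0 ltW.
rewrite ler_pdivrMr//; apply: le_trans (boosted_window_bound _ _ _) _.
rewrite -exprMn mulrA mulVf ?mul1r// ler_piMr ?exprn_ge0 ?(ltW A0)//.
by rewrite lern1 leq_b1.
Qed.

Definition bad_prob k : R := E m (l k) (fun u v => (bad_block k u v)%:R).

(** Independence gives a product of factors [1 + (K - 1) * bad_prob], each below an exponential.
    Only the sum of the probabilities enters, and only that sum is controlled by [sum_bad_prob]. *)
Lemma bad_blocks_mgf (K : R) k N : 1 <= K ->
  E (N * m) (blocks_len k N) (fun u v => K ^+ bad_blocks k N u v) <=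
  expR ((K - 1) * \sum_(j < N) bad_prob (k + j)).
Proof.
move=> K1; elim: N k => [|N IH] k.
  by rewrite /wexp2/= big_ord0 mulr0 expR0 expr0.
rewrite mulSn [blocks_len _ _]/= wexp2_cat.
have step u v : size u = m -> size v = l k ->
    E (N * m) (blocks_len k.+1 N)
      (fun u' v' => K ^+ bad_blocks k N.+1 (u ++ u') (v ++ v')) =
    (1 + (K - 1) * (bad_block k u v)%:R) * E (N * m) (blocks_len k.+1 N)
      (fun u' v' => K ^+ bad_blocks k.+1 N u' v').
  move=> um vl; rewrite -wexp2Z; apply: eq_wexp2 => u' v' _ _.
  rewrite bad_blocks_cat// exprD; congr (_ * _).
  by case: (bad_block k u v) => /=; rewrite ?expr1 ?expr0; ring.
set e := E (N * m) (blocks_len k.+1 N) _ in step.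
have -> : E m (l k) (fun u v => E (N * m) (blocks_len k.+1 N)
      (fun u' v' => K ^+ bad_blocks k N.+1 (u ++ u') (v ++ v'))) =
    E m (l k) (fun u v => e * (1 + (K - 1) * (bad_block k u v)%:R)).
  by apply: eq_wexp2 => u v um vl; rewrite step// mulrC.
rewrite wexp2Z wexp2D wexp2_cst wexp2Z -/(bad_prob k).
rewrite mulrC big_ord_recl/= [(K - 1) * (_ + _)]mulrDr expRD addn0.
apply: ler_pM => //.
- have : 0 <= bad_prob k by exact: wexp2_ge0.
  nra.
- by apply: wexp2_ge0 => // u v _ _; rewrite exprn_ge0//; lra.
- exact: expR_ge1Dx.
- apply: le_trans (IH _) _; rewrite ler_expR le_eqVlt; apply/orP; left; apply/eqP.
  by congr (_ * _); apply: eq_bigr => j _; rewrite /= /bump/= addnA addn1.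
Qed.

Lemma bad_blocks_tail (t q : R) N : 0 < t ->
  E (N * m) (blocks_len 0 N) (fun u v => (q < (bad_blocks 0 N u v)%:R)%R%:R) <=
  expR ((expR t - 1) * \sum_(j < N) bad_prob j - t * q).
Proof.
move=> t0.
have := wexp2_markov p01 p'01 (expR_gt0 (t * q)) (F := fun u v =>
  expR t ^+ bad_blocks 0 N u v) (n := (N * m)%N) (m := blocks_len 0 N).
move=> /(_ (fun u v _ _ => exprn_ge0 _ (expR_ge0 t))) h.
rewrite expRB; apply: le_trans (le_trans h _).
  apply: le_wexp2 => // u v _ _.
  by rewrite -expRM_natl ltr_expR [_ * t]mulrC ltr_pM2l.
rewrite ler_pdivlMr ?expR_gt0// divfK ?gt_eqF ?expR_gt0//.
by apply: bad_blocks_mgf; rewrite -expR0 ler_expR ltW.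
Qed.

End blocks.

(** * Lower bound for the convolution *)

Section product_words.
Context {R : realType} (p : R) (mu : probability shift_space R).
Context d (T : measurableType d) (nu : probability T R).
Hypothesis mup : is_bernoulli_measure p mu.

Lemma measurable_word_section n (A : seq bool -> set T) :
  (forall u, measurable (A u)) ->
  measurable ([set z | A (mkseq z.1 n) z.2] : set (shift_space * T)).
Proof.
move=> mA.
rewrite (_ : [set z | _] =
    \bigcup_(u in [set u | size u = n]) (cylinder u `*` A u)).
  rewrite bigcup_mkcond; apply: countable_bigcupT_measurable => [|u].
    exact: countableP.
  case: ifP => _ //; apply: measurableX => //; exact: measurable_cylinder.
apply/seteqP; split => -[w y] /=.
  move=> Ay; exists (mkseq w n); first by rewrite /= size_mkseq.
  by split => //; rewrite /cylinder/= size_mkseq.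
by move=> [u /= <- [/= wu Ay]]; move: wu; rewrite /cylinder/= => ->.
Qed.

Lemma product_prefix n s (A : seq bool -> set T) :
  (forall u, measurable (A u)) ->
  (mu \x nu)%E [set z | mkseq z.1 (size s) = s /\
    A (mkseq z.1 (size s + n)) z.2] =
  ((\prod_(i <- s) letter_weight p i) *
   wexp p n (fun t => fine (nu (A (s ++ t)))))%:E.
Proof.
move=> mA; elim: n s => [|n IH] s.
  rewrite /= cats0 addn0 EFinM fineK ?fin_num_measure// -mup.
  rewrite -product_measure1E//; last exact: measurable_cylinder.
  congr (_ _); apply/seteqP; split => -[w y] /=; rewrite /cylinder/=.
    by move=> [ws]; rewrite ws.
  by move=> [ws Ay]; split => //; rewrite ws.
have mp t : measurable ([set z | mkseq z.1 (size t) = t /\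
    A (mkseq z.1 (size t + n)) z.2] : set (shift_space * T)).
  apply: measurableI; last exact: measurable_word_section.
  rewrite [X in measurable X](_ : _ = cylinder t `*` setT).
    by apply: measurableX => //; exact: measurable_cylinder.
  by apply/seteqP; split => -[w y] /=; [split|case].
rewrite (_ : [set _ | _] =
    [set z | mkseq z.1 (size (rcons s false)) = rcons s false /\
             A (mkseq z.1 (size (rcons s false) + n)) z.2] `|`
    [set z | mkseq z.1 (size (rcons s true)) = rcons s true /\
             A (mkseq z.1 (size (rcons s true) + n)) z.2]); last first.
  apply/seteqP; split => -[w y] /=;
    rewrite !size_rcons !(mkseqS w (size s)) !addSn addnS.
    by move=> [-> ?]; case: (w (size s)); [right|left].
  by move=> [[/rcons_inj[-> ?] ?]|[/rcons_inj[-> ?] ?]].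
rewrite measureU; [|exact: mp|exact: mp|]; last first.
  rewrite -subset0 => -[w y] [/= [+ _] [+ _]]; rewrite !size_rcons => -> .
  by move=> /rcons_inj[].
etransitivity; first exact: (f_equal2 adde (IH (rcons s false))
  (IH (rcons s true))).
rewrite -[adde _ _]EFinD !big_rcons/=; congr EFin.
under eq_wexp => t _ do rewrite cat_rcons.
under [X in _ + _ * X = _]eq_wexp => t _ do rewrite cat_rcons.
by ring.
Qed.

Lemma product_word n (A : seq bool -> set T) : (forall u, measurable (A u)) ->
  (mu \x nu)%E [set z | A (mkseq z.1 n) z.2] =
  (wexp p n (fun t => fine (nu (A t))))%:E.
Proof.
move=> mA; have := product_prefix n [::] mA.
rewrite big_nil mul1r /= => <-.
by congr (_ _); apply/seteqP; split => z /=; [split|case].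
Qed.

End product_words.

Lemma bernoulli_product_word (R : realType) (p p' : R)
    (mu nu : probability shift_space R) n m (A : seq bool -> seq bool -> bool) :
  is_bernoulli_measure p mu -> is_bernoulli_measure p' nu ->
  fine ((mu \x nu)%E [set z | A (mkseq z.1 n) (mkseq z.2 m)]) =
  wexp2 p p' n m (fun u v => (A u v)%:R).
Proof.
move=> mup nup.
have := product_word nu mup n (A := fun u => [set w | A u (mkseq w m)]).
rewrite /= => ->; last by move=> u; exact: (measurable_mkseq m [set s | A u s]).
apply: eq_wexp => u _ /=.
rewrite (bernoulli_word nup m [set s | A u s]); apply: eq_wexp => v _.
rewrite indicE; congr ((nat_of_bool _)%:R).
by apply/idP/idP; rewrite inE.
Qed.

Lemma measurable_product_word (n m : nat) (A : seq bool -> seq bool -> bool) :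
  measurable ([set z | A (mkseq z.1 n) (mkseq z.2 m)] :
    set (shift_space * shift_space)).
Proof.
apply: (@measurable_word_section _ shift_space n
  (fun u => [set w | A u (mkseq w m)])).
by move=> u; exact: (measurable_mkseq m [set s | A u s]).
Qed.

Section convolution_coding.
Context {R : realType} (b b' : R) (mu nu : probability shift_space R).

Lemma measurable_coding_preimage (A : set (R * R)) : measurable A ->
  measurable ([set z | A (coding b z.1, coding b' z.2)] :
    set (shift_space * shift_space)).
Proof.
move=> mA; rewrite -[X in measurable X]setTI.
have : measurable_fun setT (fun z : shift_space * shift_space =>
    (coding b z.1, coding b' z.2)).
  apply/measurable_fun_pairP; split => /=.
    exact: measurableT_comp (measurable_coding b) _.
  exact: measurableT_comp (measurable_coding b') _.
exact.
Qed.

Lemma convolution_coding (A : set R) : measurable A ->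
  measure_convolution (bernoulli_convolution b mu)
    (bernoulli_convolution b' nu) A =
  (mu \x nu)%E [set z | A (coding b z.1 + coding b' z.2)].
Proof.
move=> mA; rewrite measure_convolutionE /product_measure1.
rewrite /bernoulli_convolution.
have mS := measurable_add_preimage mA.
rewrite [LHS](ge0_integral_pushforward (measurable_coding b))//; last first.
  exact: measurable_fun_xsection.
Qed.

End convolution_coding.

Section mass_bounded.
Context {R : realType} (lam : probability R R) (b : R).
Hypothesis b01 : 0 < b < 1.

(** [dim_ge] provides a constant depending on the point; fixing it confines that dependence to an
    exceptional set of small mass. *)
Definition mass_bounded (s K : R) : set R :=
  [set x | forall j : nat, ball_mass lam x (b ^+ j) <=
    expR (j%:R * s * ln b + K)].

Lemma measurable_mass_bounded s K : measurable (mass_bounded s K).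
Proof.
rewrite (_ : mass_bounded s K = \bigcap_j
    (~` [set x | expR (j%:R * s * ln b + K) < ball_mass lam x (b ^+ j)])).
  apply: bigcapT_measurable => j; apply: measurableC.
  exact: measurable_ball_mass_gt.
apply/seteqP; split => x /= h j; first by move=> _ /=; apply/negP; rewrite -leNgt.
by have /= /negP := h j Logic.I; rewrite -leNgt.
Qed.

Lemma le_mass_bounded s K K' : K <= K' ->
  mass_bounded s K `<=` mass_bounded s K'.
Proof. by move=> KK' x h j; apply: le_trans (h j) _; rewrite ler_expR lerD2l. Qed.

Lemma dim_ge_mass_bounded D (e delta : R) : dim_ge lam D -> 0 < e -> 0 < delta ->
  exists K0 : nat, forall K : nat, (K0 <= K)%N ->
    fine (lam (~` mass_bounded (D - e) K%:R)) <= delta.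
Proof.
move=> lamD e0 delta0; have [b0 b1] := andP b01.
have [|||K0 hK0] := probability_exhaust (P := lam)
  (F := fun n => mass_bounded (D - e) n%:R) _ _ _ delta0.
- by move=> n; exact: measurable_mass_bounded.
- by move=> n; apply: le_mass_bounded; rewrite ler_nat.
- apply: ae_imply (lamD e e0) => x [K hK].
  exists (Num.bound `|K|) => j; apply: le_trans (hK (b ^+ j) _) _.
    by rewrite exprn_gt0//= exprn_ile1// ltW.
  rewrite ler_expR lnXn// -[ln b *+ _]mulr_natl.
  have : K <= (Num.bound `|K|)%:R.
    by apply: le_trans (ler_norm _) _; exact: ltW (archi_boundP (normr_ge0 K)).
  have -> : (D - e) * (j%:R * ln b) = j%:R * (D - e) * ln b by ring.
  lra.
exists K0 => K KK0; rewrite -lee_fin fineK ?fin_num_measure//; last first.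
  by apply: measurableC; exact: measurable_mass_bounded.
apply: le_trans (ltW hK0); apply: le_measure; rewrite ?inE.
- by apply: measurableC; exact: measurable_mass_bounded.
- by apply: measurableC; exact: measurable_mass_bounded.
by apply: subsetC; apply: le_mass_bounded; rewrite ler_nat.
Qed.

End mass_bounded.

Section block_values.
Context {R : realType} (b b' : R) (m : nat).
Hypotheses (b01 : 0 < b < 1) (b'01 : 0 < b' < 1).
Local Notation c k := (scale_ratio b b' m k).

Definition block_len (k : nat) : nat :=
  (letters2 b b' m k.+1 - letters2 b b' m k)%N.

Definition block_value k (u v : seq bool) : R :=
  foldr (ifs b) 0 u + c k * foldr (ifs b') 0 v.

Definition value_bound : R := (1 - b)^-1 + b'^-1 * (1 - b')^-1.

Lemma value_bound_ge0 : 0 <= value_bound.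
Proof.
have [b0 b1] := andP b01; have [b'0 b'1] := andP b'01.
by rewrite addr_ge0 ?mulr_ge0 ?invr_ge0//; lra.
Qed.

Lemma letters2S k :
  (letters2 b b' m k + block_len k)%N = letters2 b b' m k.+1.
Proof.
rewrite subnKC//; apply: Num.Theory.le_truncn; apply: ler_wpM2r.
  exact: log_ratio_ge0.
by rewrite ler_nat.
Qed.

Lemma letters2_0 : letters2 b b' m 0 = 0%N.
Proof. by rewrite /letters2 mul0r Num.Theory.truncn0. Qed.

Lemma blocks_len_letters2 k N :
  (letters2 b b' m k + blocks_len block_len k N)%N = letters2 b b' m (k + N).
Proof.
elim: N k => [|N IH] k; first by rewrite !addn0.
by rewrite /= addnA letters2S IH addSnnS.
Qed.

(** The self-similarity behind the choice of block lengths: after one block of each sequence the sum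
    is scaled by [b ^+ m], with [c k.+1] in place of [c k]. *)
Lemma scale_ratio_block k :
  c k * b' ^+ block_len k = b ^+ m * c k.+1.
Proof.
have [b0 b1] := andP b01.
rewrite /scale_ratio -(letters2S k) exprD mulSn exprD.
have x0 : b ^+ m != 0 by rewrite expf_eq0 gt_eqF// andbF.
have y0 : b ^+ (k * m) != 0 by rewrite expf_eq0 gt_eqF// andbF.
move: x0 y0; set x := b ^+ m; set y := b ^+ (k * m) => x0 y0.
set z := b' ^+ _; set t := b' ^+ _; field; exact/andP.
Qed.

Lemma block_value_cat k u v u' v' : size u = m -> size v = block_len k ->
  block_value k (u ++ u') (v ++ v') =
  block_value k u v + b ^+ m * block_value k.+1 u' v'.
Proof.
move=> um vl; rewrite /block_value !partial_cat um vl.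
move: (scale_ratio_block k) (foldr _ _ u) (foldr _ _ u') (foldr _ _ v) (foldr _ _ v').
move: (c k) (c k.+1) (b' ^+ _) (b ^+ _) => s s' B' B sB x x' y y'.
have -> : s * (y + B' * y') = s * y + s * B' * y' by ring.
by rewrite sB; ring.
Qed.

Lemma scaled_bound k (x y : R) : `|x| <= (1 - b)^-1 -> `|y| <= (1 - b')^-1 ->
  `|x + c k * y| <= value_bound.
Proof.
move=> x1 y1; have /andP[c1 c2] := scale_ratio_itv m b01 b'01 k.
apply: le_trans (ler_normD _ _) _; apply: lerD => //.
rewrite normrM ger0_norm; last exact: le_trans c1.
by apply: ler_pM => //; exact: le_trans c1.
Qed.

Lemma block_value_bound k u v : `|block_value k u v| <= value_bound.
Proof. by apply: scaled_bound; apply: partial_bound. Qed.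

Lemma coding_block k (w w' : shift_space) :
  `|coding b w + c k * coding b' w' -
    block_value k (mkseq w m) (mkseq w' (block_len k))| <=
  value_bound * b ^+ m.
Proof.
have [b0 b1] := andP b01.
rewrite {1}(codingE b01 w m) {1}(codingE b'01 w' (block_len k)) /block_value.
rewrite (_ : _ - _ = b ^+ m * (coding b (shiftn m w) +
    c k.+1 * coding b' (shiftn (block_len k) w'))); last first.
  move: (scale_ratio_block k) (foldr _ _ _) (foldr _ _ _) (coding b _) (coding b' _).
  move: (c k) (c k.+1) (b' ^+ _) (b ^+ _) => s s' B' B sB x y x' y'.
  have -> : s * (x + B' * y') = s * x + s * B' * y' by ring.
  by rewrite sB; ring.
rewrite normrM ger0_norm ?exprn_ge0 ?(ltW b0)// mulrC.
rewrite ler_wpM2r ?exprn_ge0 ?(ltW b0)//.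
by apply: scaled_bound; apply: coding_bound.
Qed.

Lemma coding_blocks N (w w' : shift_space) :
  `|coding b w + coding b' w' - block_value 0 (mkseq w (N * m))
    (mkseq w' (blocks_len block_len 0 N))| <= value_bound * (b ^+ m) ^+ N.
Proof.
have [b0 b1] := andP b01.
have -> : blocks_len block_len 0 N = letters2 b b' m N.
  by rewrite -[RHS]add0n -[in RHS](blocks_len_letters2 0 N) letters2_0.
rewrite {1}(codingE b01 w (N * m)) {1}(codingE b'01 w' (letters2 b b' m N)).
rewrite /block_value scale_ratio0// mul1r.
have bN : (b ^+ m) ^+ N = b ^+ (N * m) by rewrite -exprM mulnC.
have bL : b' ^+ letters2 b b' m N = b ^+ (N * m) * c N.
  by rewrite /scale_ratio mulrCA mulfV ?mulr1// expf_eq0 gt_eqF// andbF.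
rewrite bN bL (_ : _ - _ = b ^+ (N * m) * (coding b (shiftn (N * m) w) +
    c N * coding b' (shiftn (letters2 b b' m N) w'))); last by ring.
rewrite normrM ger0_norm ?exprn_ge0 ?(ltW b0)// mulrC.
rewrite ler_wpM2r ?exprn_ge0 ?(ltW b0)//.
by apply: scaled_bound; apply: coding_bound.
Qed.

End block_values.

(** * Energy of typical pairs *)

Section energy.
Context {R : realType} (b b' : R) (mu nu : probability shift_space R).
Hypotheses (b01 : 0 < b < 1) (b'01 : 0 < b' < 1).
Hypothesis irr : irrational (ln b / ln b').
Let muX := bernoulli_convolution b mu.
Let nuY := bernoulli_convolution b' nu.
Local Notation P2 := (mu \x nu)%E.
(** [1] for a distance [b ^+ m] between block values and one [value_bound] for each of the two
    truncations to a block. *)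
Let C2 : R := 1 + 2 * value_bound b b'.
Let Ct : R := transversality_const b b' C2.

Let C21 : 1 <= C2.
Proof. by rewrite lerDl mulr_ge0// value_bound_ge0. Qed.

Definition near_pair m k (x y : R) : set (shift_space * shift_space) :=
  [set z | `|coding b z.1 - x + scale_ratio b b' m k * (coding b' z.2 - y)|
    <= C2 * b ^+ m].

Lemma measurable_near_pair m k x y : measurable (near_pair m k x y).
Proof.
pose A : set (R * R) := [set z | `|z.1 - x + scale_ratio b b' m k * (z.2 - y)|
    <= C2 * b ^+ m].
apply: (measurable_coding_preimage b b' (A := A)).
rewrite -[A]setTI; apply: measurable_fun_ler => //.
apply: measurableT_comp => //; apply: measurable_funD.
  exact: measurable_funB.
by apply: measurable_funM => //; exact: measurable_funB.
Qed.

(** [transversality] is integrated with [(x, y)] fixed. The square of side [b ^+ (m - j)] has mass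
    at most its power [d + d'] up to [expR (2 * K)]; with the weight [b ^+ j] and the two bounds on
    [s], every scale costs at most [b ^ (m * s)]. The last summand makes [m + 2] terms. *)
Lemma energy_bound m (s d d' K : R) : (0 < m)%N -> s <= 1 -> s <= d + d' ->
  0 <= K -> exists N0, forall N, (N0 <= N)%N -> forall x y,
  mass_bounded muX b d K x -> mass_bounded nuY b d' K y ->
  \sum_(k < N) fine (P2 (near_pair m k x y)) <=
  N%:R * (Ct * (m.+2%:R * expR (m%:R * s * ln b + 2 * K))).
Proof.
move=> m0 s1 sdd K0; have lb := ln_lt0 b01; have [b0 b1] := andP b01.
have [N0 HN0] := transversality b01 b'01 C21 irr m0.
exists N0 => N NN x y xK yK.
have Ct0 : 0 <= N%:R * Ct.
  apply: mulr_ge0 => //.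
  exact: le_trans ler01 (transversality_const_gt1 b01 b'01 C21).
pose T (j : nat) : set (shift_space * shift_space) :=
  (coding b @^-1` closed_ball_ Num.norm x (b ^+ (m - j))) `*`
  (coding b' @^-1` closed_ball_ Num.norm y (b ^+ (m - j))).
have mX r : measurable (coding b @^-1` closed_ball_ Num.norm x r).
  rewrite -[X in measurable X]setTI; apply: measurable_coding => //.
  exact: measurable_closed_ball_.
have mY r : measurable (coding b' @^-1` closed_ball_ Num.norm y r).
  rewrite -[X in measurable X]setTI; apply: measurable_coding => //.
  exact: measurable_closed_ball_.
have mT j : measurable (T j) by apply: measurableX.
have := @sum_probability_le _ _ _ P2 (near_pair m ^~ x ^~ y) T
  (fun j => N%:R * Ct * b ^+ j) (N%:R * Ct * b ^+ m) N m.+1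
  (fun k => measurable_near_pair m k x y) mT.
move=> /(_ _)/le_trans; apply.
  move=> z.
  have := HN0 N NN (coding b z.1 - x) (coding b' z.2 - y).
  rewrite -/Ct mulrDr mulr_sumr => h.
  apply: le_trans (le_trans _ h) _.
    apply: ler_sum => k _; rewrite indicE ler_nat.
    by case: (boolP (z \in _)) => //; rewrite inE => ->.
  rewrite lerD2r; apply: ler_sum => j _.
  have NC : 0 <= N%:R * Ct * b ^+ j.
    by apply: mulr_ge0 => //; rewrite exprn_ge0// ltW.
  rewrite mulrA; apply: ler_wpM2l => //.
  rewrite indicE ler_nat; case: andP => // -[h1 h2].
  by rewrite mem_set// /T; split; rewrite /= /closed_ball_/= distrC.
pose E := expR (m%:R * s * ln b + 2 * K).

apply: (@le_trans _ _ (\sum_(j < m.+1) N%:R * Ct * E + N%:R * Ct * E)).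
  apply: lerD; last first.
    apply: ler_wpM2l => //; rewrite -[b ^+ m]lnK ?posrE ?exprn_gt0//.
    rewrite ler_expR lnXn// -[ln b *+ _]mulr_natl.
    have : m%:R * ln b <= m%:R * (s * ln b).
      by apply: ler_wpM2l => //; nra.
    rewrite mulrA; lra.
  apply: ler_sum => j _; rewrite -mulrA; apply: ler_wpM2l => //.
  have -> : fine (P2 (T j)) = ball_mass muX x (b ^+ (m - j)) *
      ball_mass nuY y (b ^+ (m - j)).
    by rewrite /T product_measure1E// fineM// fin_num_measure.
  apply: (@le_trans _ _ (b ^+ j * (expR ((m - j)%:R * d * ln b + K) *
      expR ((m - j)%:R * d' * ln b + K)))).
    apply: ler_wpM2l; first by rewrite exprn_ge0// ltW.
    by apply: ler_pM; rewrite ?ball_mass_ge0.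
  rewrite -[b ^+ j]lnK ?posrE ?exprn_gt0// lnXn// -!expRD ler_expR.
  rewrite -[ln b *+ _]mulr_natl.
  have jm : (j <= m)%N by rewrite -ltnS.
  have -> : m%:R = (m - j)%:R + j%:R :> R by rewrite -natrD subnK.
  move: ((m - j)%:R : R) (j%:R : R) (ler0n R (m - j)) (ler0n R j) => u v u0 v0.
  have : u * ((d + d') * ln b) <= u * (s * ln b).
    by apply: ler_wpM2l => //; nra.
  have : v * (1 * ln b) <= v * (s * ln b).
    by apply: ler_wpM2l => //; nra.
  nra.
rewrite sumr_const card_ord -mulr_natl -/E -[m.+2]addn1 natrD.
by rewrite le_eqVlt; apply/orP; left; apply/eqP; ring.
Qed.

End energy.

Lemma fine_measureU2 d (T : measurableType d) (R : realType)
    (P : probability T R) (A B : set T) : measurable A -> measurable B ->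
  fine (P (A `|` B)) <= fine (P A) + fine (P B).
Proof.
move=> mA mB; have mAB : measurable (A `|` B) by exact: measurableU.
rewrite -lee_fin EFinD !fineK ?fin_num_measure//; exact: measureU2.
Qed.

(** The budget of [e]: one half in the threshold for bad blocks, a quarter for the constant per
    block, a quarter for the bad blocks, whose exponent is at most 1. *)
Lemma exponent_bound (R : realFieldType) (N n a L s e : R) :
  0 <= N -> 0 <= L -> 0 < e -> e <= s -> s <= 1 ->
  a <= e / 4 * L -> n <= e / 4 * N ->
  N * a - N * ((s - e / 2) * L) + n * ((s - e / 2) * L) <= - (N * (s - e) * L).
Proof.
move=> N0 L0 e0 es s1 aL nN.
have h1 : N * a <= N * (e / 4 * L) by apply: ler_wpM2l.
have h2 : n * ((s - e / 2) * L) <= e / 4 * N * ((s - e / 2) * L).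
  by apply: ler_wpM2r => //; apply: mulr_ge0 => //; lra.
have h3 : e / 4 * N * ((s - e / 2) * L) <= e / 4 * N * (1 * L).
  apply: ler_wpM2l; first by rewrite mulr_ge0//; lra.
  by apply: ler_wpM2r => //; lra.
lra.
Qed.

Section convolution_lower_bound.
Context {R : realType} (b b' p p' : R) (mu nu : probability shift_space R).
Hypotheses (b01 : 0 < b < 1) (b'01 : 0 < b' < 1).
Hypotheses (p01 : 0 < p < 1) (p'01 : 0 < p' < 1).
Hypotheses (mup : is_bernoulli_measure p mu) (nup : is_bernoulli_measure p' nu).
Hypothesis irr : irrational (ln b / ln b').
Let muX := bernoulli_convolution b mu.
Let nuY := bernoulli_convolution b' nu.
Local Notation P2 := (mu \x nu)%E.
Local Notation l := (block_len b b').
Local Notation Z := (block_value b b').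
Local Notation C0 := (value_bound b b').
Let Ct : R := transversality_const b b' (1 + 2 * C0).

Lemma block_mass_near_pair m k (w w' : shift_space) :
  block_mass p p' m (l m) (Z m) (b ^+ m) k (mkseq w m) (mkseq w' (l m k)) <=
  fine (P2 (near_pair b b' m k (coding b w) (coding b' w'))).
Proof.
rewrite /block_mass -(bernoulli_product_word m (l m k) (fun u' v' =>
  `|Z m k u' v' - Z m k (mkseq w m) (mkseq w' (l m k))| <= b ^+ m) mup nup).
apply: le_fine_measure; last 1 first.
- move=> [v v'] /= h.
  have := coding_block m b01 b'01 k v v'.
  have := coding_block m b01 b'01 k w w'.
  rewrite /near_pair/=; move: h.
  move: (Z m k _ _) (Z m k _ _) (scale_ratio _ _ _ _) => z z' s.
  rewrite !ler_norml => /andP[h1 h2] /andP[h3 h4] /andP[h5 h6].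
  by apply/andP; split; lra.
- exact: (@measurable_product_word m (l m k) (fun u' v' =>
    `|Z m k u' v' - Z m k (mkseq w m) (mkseq w' (l m k))| <= b ^+ m)).
- exact: measurable_near_pair.
Qed.

(** Markov's inequality in [k] at each typical pair: the block masses sum to at most [N * B], so at
    most [N * B / R1] of them exceed [R1]. Atypical pairs are charged all [N] blocks. *)
Lemma sum_bad_prob m (s d d' K R1 : R) : (0 < m)%N -> s <= 1 -> s <= d + d' ->
  0 <= K -> 0 < R1 -> exists N0, forall N, (N0 <= N)%N ->
  \sum_(k < N) bad_prob p p' m (l m) (Z m) (b ^+ m) R1 k <=
  N%:R * (fine (muX (~` mass_bounded muX b d K)) +
          fine (nuY (~` mass_bounded nuY b d' K)) +
          Ct * (m.+2%:R * expR (m%:R * s * ln b + 2 * K)) / R1).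
Proof.
move=> m0 s1 sdd K0 R10.
have [N0 HN0] := energy_bound mu nu b01 b'01 irr m0 s1 sdd K0.
exists N0 => N NN.
set B := Ct * _.
pose bad k u v := bad_block p p' m (l m) (Z m) (b ^+ m) R1 k u v.
pose A k : set (shift_space * shift_space) :=
  [set z | bad k (mkseq z.1 m) (mkseq z.2 (l m k))].
have mA k : measurable (A k).
  exact: (@measurable_product_word m (l m k) (bad k)).
pose G : set shift_space := coding b @^-1` (~` mass_bounded muX b d K).
pose G' : set shift_space := coding b' @^-1` (~` mass_bounded nuY b d' K).
have mG : measurable G.
  rewrite -[X in measurable X]setTI; apply: measurable_coding => //.
  by apply: measurableC; exact: measurable_mass_bounded.
have mG' : measurable G'.
  rewrite -[X in measurable X]setTI; apply: measurable_coding => //.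
  by apply: measurableC; exact: measurable_mass_bounded.
pose F (j : nat) : set (shift_space * shift_space) :=
  if j is 0 then G `*` setT else setT `*` G'.
have mF j : measurable (F j) by case: j => [|j]; exact: measurableX.
have F0 : fine (P2 (F 0%N)) = fine (muX (~` mass_bounded muX b d K)).
  transitivity (fine (mu G * nu setT)%E); last by rewrite probability_setT mule1.
  by congr fine; exact: product_measure1E.
have F1 : fine (P2 (F 1%N)) = fine (nuY (~` mass_bounded nuY b d' K)).
  transitivity (fine (mu setT * nu G')%E); last by rewrite probability_setT mul1e.
  by congr fine; exact: product_measure1E.
have := @sum_probability_le _ _ _ P2 A F (fun=> N%:R) (N%:R * (B / R1)) N 2 mA mF.
rewrite big_ord_recl big_ord1/= F0 F1 -!mulrDr.
rewrite (eq_bigr (fun k : 'I_N => bad_prob p p' m (l m) (Z m) (b ^+ m) R1 k)).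
  apply=> -[w w'].
  rewrite big_ord_recl big_ord1/=.
  have cntN : \sum_(k < N) \1_(A k) (w, w') <= N%:R :> R.
    rewrite -[leRHS]mulr1 mulr_natl -[X in _ *+ X]card_ord -sumr_const.
    by apply: ler_sum => k _; rewrite indicE lern1 leq_b1.
  have B0 : 0 <= B.
    apply: mulr_ge0; last by rewrite mulr_ge0// expR_ge0.
    apply: le_trans ler01 (transversality_const_gt1 b01 b'01 _).
    by rewrite lerDl mulr_ge0// value_bound_ge0.
  have BR : 0 <= B / R1 by rewrite divr_ge0// ltW.
  have N00 : 0 <= N%:R :> R by [].
  have NBR : 0 <= N%:R * (B / R1) by rewrite mulr_ge0.
  have i0 (S : set (shift_space * shift_space)) : 0 <= \1_S (w, w') :> R.
    by rewrite indicE.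
  have [Gw|Gw] := pselect (G w).
    apply: le_trans cntN _.
    have -> : \1_(G `*` setT) (w, w') = 1 :> R by rewrite indicE mem_set.
    have := i0 (setT `*` G'); nra.
  have [Gw'|Gw'] := pselect (G' w').
    apply: le_trans cntN _.
    have -> : \1_(setT `*` G') (w, w') = 1 :> R by rewrite indicE mem_set.
    have := i0 (G `*` setT); nra.
  have xK : mass_bounded muX b d K (coding b w) by apply: contrapT.
  have yK : mass_bounded nuY b d' K (coding b' w') by apply: contrapT.
  have h := HN0 N NN _ _ xK yK.
  apply: (@le_trans _ _ (N%:R * (B / R1))); last first.
    by rewrite lerDr addr_ge0// mulr_ge0// indicE.
  rewrite mulrA ler_pdivlMr// mulr_suml; apply: le_trans h.
  apply: ler_sum => k _.
  apply: le_trans (block_mass_near_pair m k w w').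
  rewrite indicE; case: (boolP (_ \in _)); last first.
    by rewrite mul0r block_mass_ge0.
  by rewrite inE mul1r => /ltW.
move=> k _; rewrite /bad_prob.
by rewrite -(bernoulli_product_word m (l m k) (bad k) mup nup).
Qed.

Lemma ball_mass_window m N (w w' : shift_space) :
  ball_mass (measure_convolution muX nuY) (coding b w + coding b' w')
    ((b ^+ m) ^+ N) <=
  window_mass p p' m (l m) (Z m) (b ^+ m) C0 0 N 0
    (mkseq w (N * m)) (mkseq w' (blocks_len (l m) 0 N)).
Proof.
have [b0 b1] := andP b01.
pose ball := closed_ball_ Num.norm (coding b w + coding b' w') ((b ^+ m) ^+ N).
have mB : measurable ball by exact: measurable_closed_ball_.
rewrite /ball_mass [X in fine X <= _](_ : _ =
  P2 [set z | ball (coding b z.1 + coding b' z.2)]); last first.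
  exact: convolution_coding.
set u := mkseq w _; set v := mkseq w' _.
rewrite /window_mass -(bernoulli_product_word (N * m) (blocks_len (l m) 0 N)
  (fun u' v' => `|0 + Z m 0 u' v' - Z m 0 u v| <=
    (4 * C0 + 2) * (b ^+ m) ^+ N) mup nup).
apply: le_fine_measure; last 1 first.
- move=> [x x'] /=; rewrite /ball /closed_ball_/= add0r => h.
  have := coding_blocks m b01 b'01 N w w'.
  have := coding_blocks m b01 b'01 N x x'.
  move: h; rewrite -/u -/v.
  have r0 : 0 < (b ^+ m) ^+ N by rewrite !exprn_gt0.
  have C00 := value_bound_ge0 b01 b'01.
  move: (Z m 0 _ _) (Z m 0 _ _) (_ ^+ N) r0 C00 => z z' r r0.
  move: C0 => C0' C00.
  rewrite !ler_norml => /andP[h1 h2] /andP[h3 h4] /andP[h5 h6].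
  by have := mulr_ge0 C00 (ltW r0); move=> ?; apply/andP; split; nra.
- exact: (measurable_coding_preimage b b' (A := [set z | ball (z.1 + z.2)])
    (measurable_add_preimage mB)).
- exact: (@measurable_product_word (N * m) (blocks_len (l m) 0 N)
    (fun u' v' => `|0 + Z m 0 u' v' - Z m 0 u v| <=
      (4 * C0 + 2) * (b ^+ m) ^+ N)).
Qed.

Lemma block_length_exists (A B h delta : R) : 0 < h -> 0 < delta -> 0 <= B ->
  exists m : nat, [/\ (0 < m)%N, b ^+ m <= 2^-1, ln A <= m%:R * h &
    B * (m.+2%:R * expR (- (m%:R * h))) <= delta].
Proof.
move=> h0 delta0 B0; have [b0 b1] := andP b01; have lb := ln_lt0 b01.
pose x1 : R := (- ln b)^-1; pose x2 : R := `|ln A| / h.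
(* [12 = 3 * 4] comes from [m + 2 <= 3 * m] and from [(m * h / 2) ^+ 2 <= expR (m * h)]; [x1] and
   [x2] serve the bounds on [b ^+ m] and [ln A]. *)
pose x3 : R := 12 * B / (h ^+ 2 * delta).
have x10 : 0 <= x1 by rewrite invr_ge0; lra.
have x20 : 0 <= x2 by rewrite divr_ge0// ltW.
have h2 : 0 < h ^+ 2 * delta by rewrite mulr_gt0 ?exprn_gt0.
have x30 : 0 <= x3 by apply: divr_ge0; [rewrite mulr_ge0|exact: ltW].
have y0 : 0 <= x1 + x2 + x3 + 1 by lra.
have := archi_boundP y0; set m := Num.bound _ => ym.
have m1 : 1 <= m%:R :> R by lra.
exists m; split.
- by rewrite -(ltr0n R); lra.
- rewrite -[b ^+ m]lnK ?posrE ?exprn_gt0// lnXn// -[ln b *+ _]mulr_natl.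
  rewrite -[m%:R * _]opprK expRN lef_pV2 ?posrE ?expR_gt0// -mulrN.
  apply: le_trans (expR_ge1Dx _).
  have : 1 <= m%:R * - ln b.
    by rewrite -ler_pdivrMr ?oppr_gt0// mul1r -/x1; lra.
  lra.
- apply: le_trans (ler_norm _) _.
  by rewrite -ler_pdivrMr// -/x2; lra.
- have e1 : (m%:R * h / 2) ^+ 2 <= expR (m%:R * h).
    have -> : m%:R * h = m%:R * h / 2 + m%:R * h / 2 by field.
    rewrite expRD -expr2.
    have := expR_ge1Dx (m%:R * h / 2).
    have : 0 <= m%:R * h / 2 by rewrite divr_ge0 ?mulr_ge0// ltW.
    have -> : m%:R * h / 2 + m%:R * h / 2 = m%:R * h by field.
    move=> u0 u1; rewrite lerXn2r ?nnegrE ?expR_ge0//; lra.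
  rewrite expRN mulrA ler_pdivrMr ?expR_gt0//.
  apply: (@le_trans _ _ (delta * (m%:R * h / 2) ^+ 2)); last first.
    by rewrite ler_pM2l.
  have m2 : m.+2%:R <= 3 * m%:R :> R by rewrite -addn2 natrD; lra.
  have x3m : 12 * B <= m%:R * (h ^+ 2 * delta).
    by rewrite -ler_pdivrMr// -/x3; lra.
  have Bm : B * m.+2%:R <= B * (3 * m%:R) by apply: ler_wpM2l.
  apply: le_trans Bm _.
  have : m%:R * (12 * B) <= m%:R * (m%:R * (h ^+ 2 * delta)).
    by apply: ler_wpM2l.
  have -> : delta * (m%:R * h / 2) ^+ 2 =
      m%:R * (m%:R * (h ^+ 2 * delta)) / 4 by field.
  lra.
Qed.

Lemma convolution_ball_mass D D' (e : R) :
  dim_ge muX D -> dim_ge nuY D' -> 0 < e -> e <= Num.min 1 (D + D') ->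
  exists m, (0 < m)%N /\ {ae measure_convolution muX nuY, forall z,
    exists N0, forall N, (N0 <= N)%N ->
    ball_mass (measure_convolution muX nuY) z ((b ^+ m) ^+ N) <=
    expR (N%:R * (Num.min 1 (D + D') - e) * ln (b ^+ m))}.
Proof.
move=> muD nuD'; set s : R := Num.min 1 (D + D').
have s1 : s <= 1 by rewrite /s ge_min lexx.
have sD : s <= D + D' by rewrite /s ge_min lexx orbT.
move: s s1 sD => s s1 sD e0 es.
have [b0 b1] := andP b01; have lb := ln_lt0 b01.
(* [th] is the tolerated proportion of bad blocks. With [tau * th = 2] and [expR tau * delta = 1]
   the exponent in [bad_blocks_tail] is at most [N - 2 * N]. *)
pose th : R := e / 4; pose tau : R := 2 / th; pose delta : R := expR (- tau).
have th0 : 0 < th by rewrite divr_gt0.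
have tau0 : 0 < tau by rewrite divr_gt0.
have delta0 : 0 < delta by exact: expR_gt0.
(* The constant [K] is fixed before [m], so that a long block can absorb [expR (2 * K)]. The two
   losses [e / 8] turn [s] into [s - e / 4], and the two exceptional masses use half of [delta]. *)
have [K1 HK1] := dim_ge_mass_bounded b01 (e := e / 8) (delta := delta / 4) muD
  ltac:(lra) ltac:(lra).
have [K2 HK2] := dim_ge_mass_bounded b01 (e := e / 8) (delta := delta / 4) nuD'
  ltac:(lra) ltac:(lra).
pose K := maxn K1 K2.
have {}HK1 := HK1 K (leq_maxl _ _); have {}HK2 := HK2 K (leq_maxr _ _).
pose A : R := 2 * block_const C0.
have A0 : 0 < A by rewrite mulr_gt0// ltr0n.
have Ct0 : 0 <= Ct.
  apply: le_trans ler01 (transversality_const_gt1 b01 b'01 _).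
  by rewrite lerDl mulr_ge0// value_bound_ge0.
pose h : R := e / 4 * - ln b.
have h0 : 0 < h by rewrite mulr_gt0 ?oppr_gt0// divr_gt0.
have [m [m0 m2 mA mB]] := @block_length_exists A (Ct * expR (2 * K%:R)) h
  (delta / 2) h0 ltac:(lra) (mulr_ge0 Ct0 (expR_ge0 _)).
exists m; split => //.
(* Dividing the energy bound, of exponent [s - e / 4], by this threshold leaves [expR (- (m * h))],
   which beats [m + 2] and the constants. *)
pose R1 : R := expR (m%:R * (s - e / 2) * ln b).
have R10 : 0 < R1 <= 1.
  rewrite expR_gt0/= -[leRHS]expR0 ler_expR.
  have : 0 <= m%:R * (s - e / 2) by rewrite mulr_ge0//; lra.
  nra.
have r0 : 0 < b ^+ m <= 2^-1 by rewrite exprn_gt0.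
have [N1 HN1] := sum_bad_prob (s := s - e / 4) (d := D - e / 8)
  (d' := D' - e / 8) (K := K%:R) (R1 := R1) m0 ltac:(lra) ltac:(lra)
  (ler0n _ _) ltac:(by case/andP: R10).
pose bad N u v := bad_blocks p p' m (l m) (Z m) (b ^+ m) R1 0 N u v.
pose win N u v := window_mass p p' m (l m) (Z m) (b ^+ m) C0 0 N 0 u v.
pose F N : set R := [set z | expR (N%:R * (s - e) * ln (b ^+ m)) <
  ball_mass (measure_convolution muX nuY) z ((b ^+ m) ^+ N)].
have mF N : measurable (F N) by exact: measurable_ball_mass_gt.
suff bc : {ae measure_convolution muX nuY, forall z,
    exists N0, forall N, (N0 <= N)%N -> ~ F N z}.
  apply: ae_imply bc => z [N0 HN0]; exists N0 => N NN.
  by rewrite leNgt; apply/negP; exact: HN0.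
apply: (@borel_cantelli_geometric _ _ _ _ _ 2 2^-1) => //.
  by apply/andP; split; lra.
exists N1 => N NN.
pose W1 : set (shift_space * shift_space) := [set z |
  (fun u v => A ^+ N < win N u v * (R1^-1 ^+ N * R1 ^+ bad N u v))
  (mkseq z.1 (N * m)) (mkseq z.2 (blocks_len (l m) 0 N))].
pose W2 : set (shift_space * shift_space) := [set z |
  (fun u v => th * N%:R < (bad N u v)%:R)
  (mkseq z.1 (N * m)) (mkseq z.2 (blocks_len (l m) 0 N))].
have mW1 : measurable W1.
  exact: (@measurable_product_word _ _ (fun u v =>
    A ^+ N < win N u v * (R1^-1 ^+ N * R1 ^+ bad N u v))).
have mW2 : measurable W2.
  exact: (@measurable_product_word _ _ (fun u v => th * N%:R < (bad N u v)%:R)).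
have PW1 : fine (P2 W1) <= 2^-1 ^+ N.
  rewrite (bernoulli_product_word _ _ (fun u v =>
    A ^+ N < win N u v * (R1^-1 ^+ N * R1 ^+ bad N u v)) mup nup).
  apply: window_tail => //.
  - by move=> k; rewrite /block_value/= mulr0 addr0.
  - exact: block_value_bound.
  - exact: block_value_cat.
have PW2 : fine (P2 W2) <= 2^-1 ^+ N.
  rewrite (bernoulli_product_word _ _ (fun u v => th * N%:R < (bad N u v)%:R)
    mup nup).
  apply: le_trans (bad_blocks_tail m (l m) (Z m) (b ^+ m) R1 p01 p'01
    (th * N%:R) N tau0) _.
  apply: (@le_trans _ _ (expR (- N%:R))); last first.
    rewrite expRN exprVn lef_pV2 ?posrE ?expR_gt0 ?exprn_gt0//.
    rewrite -[N%:R]mulr1 expRM_natl lerXn2r ?nnegrE ?expR_ge0//.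
    by have := expR_ge1Dx (1 : R); lra.
  rewrite ler_expR.
  have B1 : Ct * (m.+2%:R * expR (m%:R * (s - e / 4) * ln b + 2 * K%:R)) / R1 <=
      delta / 2.
    apply: le_trans mB; rewrite le_eqVlt; apply/orP; left; apply/eqP.
    have E : expR (m%:R * (s - e / 4) * ln b + 2 * K%:R) / R1 =
        expR (2 * K%:R) * expR (- (m%:R * h)).
      by rewrite /R1 -expRN -!expRD; congr expR; rewrite /h; field.
    by rewrite -mulrA -[(_ * _) / R1]mulrA E; ring.
  have Sd : \sum_(k < N) bad_prob p p' m (l m) (Z m) (b ^+ m) R1 k <= N%:R * delta.
    apply: le_trans (HN1 N NN) _; apply: ler_wpM2l => //.
    lra.
  have S0 : 0 <= \sum_(k < N) bad_prob p p' m (l m) (Z m) (b ^+ m) R1 k.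
    by apply: sumr_ge0 => k _; apply: wexp2_ge0.
  have t2 : tau * (th * N%:R) = 2 * N%:R.
    by rewrite /tau mulrA divfK// gt_eqF.
  rewrite t2.
  have td : expR tau * delta = 1 by rewrite /delta -expRD subrr expR0.
  move: Sd S0; set S := \sum_(k < N) _ => Sd S0.
  have : expR tau * S <= expR tau * (N%:R * delta).
    by rewrite ler_pM2l ?expR_gt0.
  rewrite mulrCA td; lra.
(* Off both events the window mass is at most [A ^+ N * R1 ^+ N / R1 ^+ n], where the number [n] of
   bad blocks is at most [th * N]. *)
have FW z : F N (coding b z.1 + coding b' z.2) -> W1 z \/ W2 z.
  move=> Fz; apply: contrapT => /not_orP[/negP + /negP].
  rewrite /= -!leNgt; set u := mkseq _ _; set v := mkseq _ _ => w1 w2.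
  move: Fz; apply/negP; rewrite -leNgt.
  apply: le_trans (ball_mass_window _ _ _ _) _; rewrite -/u -/v -/(win N u v).
  move: w1 w2; move: (win N u v) (bad N u v) => q n w1 w2.
  have {}w1 : q <= expR (N%:R * ln A + N%:R * (m%:R * (s - e / 2) * ln b) -
      n%:R * (m%:R * (s - e / 2) * ln b)).
    rewrite expRB expRD !expRM_natl -/R1 lnK ?posrE//.
    have [R1_0 _] := andP R10.
    rewrite ler_pdivlMr ?exprn_gt0// -ler_pdivrMr ?exprn_gt0//.
    by rewrite -exprVn mulrAC -mulrA.
  apply: le_trans w1 _; rewrite ler_expR lnXn// -[ln b *+ _]mulr_natl.
  have h1 : ln A <= e / 4 * (m%:R * - ln b) by apply: le_trans mA _; rewrite mulrCA.
  have mb0 : 0 <= m%:R * - ln b by rewrite mulr_ge0// oppr_ge0 ltW.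
  have -> : m%:R * (s - e / 2) * ln b = - ((s - e / 2) * (m%:R * - ln b)).
    by rewrite !mulrN opprK [RHS]mulrCA mulrA.
  rewrite [N%:R * - _]mulrN [n%:R * - _]mulrN opprK.
  apply: le_trans (exponent_bound (ler0n R N) mb0 e0 es s1 h1 w2) _.
  by rewrite [m%:R * - _]mulrN mulrN opprK.
apply: (@le_trans _ _ (fine (P2 W1) + fine (P2 W2))); last first.
  by rewrite mulr_natl mulr2n; apply: lerD.
rewrite [X in fine X <= _](_ : _ =
  P2 [set z | F N (coding b z.1 + coding b' z.2)]); last first.
  exact: convolution_coding.
have mW : measurable (W1 `|` W2) by exact: measurableU.
apply: (@le_trans _ _ (fine (P2 (W1 `|` W2)))).
  apply: le_fine_measure => //.
  exact: (measurable_coding_preimage b b'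
    (A := [set z | F N (z.1 + z.2)]) (measurable_add_preimage (mF N))).
exact: (fine_measureU2 P2).
Qed.

(** The block length depends on [e], so every [e] applies [dim_ge_scale] with its own base [b ^+ m].
    A negative exponent only asks for masses at most 1. *)
Lemma dim_ge_convolution D D' : dim_ge muX D -> dim_ge nuY D' ->
  dim_ge (measure_convolution muX nuY) (Num.min 1 (D + D')).
Proof.
move=> muD nuD' e e0; have [b0 b1] := andP b01.
have [es|se] := leP (e / 2) (Num.min 1 (D + D')); last first.
  apply: aeW => z; exists 0 => r /andP[r0 r1].
  apply: le_trans (ball_mass_le1 _ _ _) _.
  rewrite -[leLHS]expR0 ler_expR addr0.
  by move: se; move: (Num.min _ _) (ln r) (ln_le0 r1) => s x *; nra.
have [m [m0 H]] := convolution_ball_mass muD nuD' (e := e / 2) ltac:(lra) es.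
have bm : 0 < b ^+ m < 1 by rewrite exprn_gt0//= exprn_ilt1 -?lt0n// ltW.
set s : R := Num.min 1 (D + D') in es H *.
have : dim_ge (measure_convolution muX nuY) (s - e / 2).
  apply: (dim_ge_scale bm) => e' e'0; apply: ae_imply H => z [N HN].
  exists 0, N => n Nn; apply: le_trans (HN n Nn) _.
  rewrite ler_expR addr0; have lb := ln_lt0 bm.
  have : n%:R * (e' * ln (b ^+ m)) <= 0.
    by rewrite mulr_ge0_le0//; nra.
  lra.
move=> /(_ (e / 2) ltac:(lra)); apply: ae_imply => z [K HK]; exists K => r r01.
apply: le_trans (HK r r01) _.
by rewrite -[s - e / 2 - e / 2]addrA -opprD -splitr.
Qed.

End convolution_lower_bound.

Theorem corollary1p5 (R : realType) (b b' p p' : R)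
    (mu nu : probability shift_space R) :
  0 < b < 1 -> 0 < b' < 1 -> 0 < p < 1 -> 0 < p' < 1 ->
  is_bernoulli_measure p mu -> is_bernoulli_measure p' nu ->
  irrational (ln b / ln b') ->
  exists D D' : R,
    [/\ exact_dimensional (bernoulli_convolution b mu) D,
        exact_dimensional (bernoulli_convolution b' nu) D' &
        exact_dimensional
          (measure_convolution (bernoulli_convolution b mu)
                               (bernoulli_convolution b' nu))
          (Num.min 1 (D + D'))].
Proof.
move=> b01 b'01 p01 p'01 mup nup irr.
have [D [D0 leD geD]] := bernoulli_convolution_dim b01 p01 mup.
have [D' [D'0 leD' geD']] := bernoulli_convolution_dim b'01 p'01 nup.
exists D, D'; split; [exact: exact_dimensional_le_ge..|].
apply: exact_dimensional_le_ge.
  apply: dim_le_min; last exact: dim_le_convolution.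
  apply: dim_le1; apply: convolution_bound;
    exact: bernoulli_convolution_bound.
exact: (dim_ge_convolution b01 b'01 p01 p'01 mup nup irr).
Qed.
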